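(* Let $f\in\mathcal{A}_p$ and let $\psi_j$ ($j=1,2$) be convex univalent in $\mathbb{U}$ with $\psi_j(0)=1$. Assume that $\alpha_{a+1}\ne0$ and $\mathrm{Re}\,[\alpha_{a+1}\mu-\alpha_a\nu]\ge0$, and let $$\Phi(z):=\Omega_{L,\mu,\nu}^{a}(f(z))\left(\mu\,\Omega_{L,1,1}^{a+1}(f(z))-\frac{\alpha_a\nu}{\alpha_{a+1}}\,\Omega_{L,1,1}^{a}(f(z))\right),$$ $$\chi_j(z):=\frac{1}{\alpha_{a+1}}\left[(\alpha_{a+1}\mu-\alpha_a\nu)\psi_j(z)+z\psi_j'(z)\right]\quad(j=1,2).$$ If $0\neq\Omega_{L,\mu,\nu}^{a}(f(z))\in\mathcal{H}[1,1]\cap\mathcal{Q}$, $\Phi$ is univalent in $\mathbb{U}$, and $\chi_1(z)\prec\Phi(z)\prec\chi_2(z)$, then $$\psi_1(z)\prec\Omega_{L,\mu,\nu}^{a}(f(z))\prec\psi_2(z).$$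
   Context: $\mathbb{U}=\{z\in\mathbb{C}:|z|<1\}$; $p\ge 1$ is an integer; $\mathcal{A}_p$ is the class of functions analytic in $\mathbb{U}$ of the form $f(z)=z^p+\sum_{k=p+1}^\infty a_kz^k$. $\mathcal{H}[1,1]$ is the class of analytic functions in $\mathbb{U}$ of the form $1+a_1z+a_2z^2+\cdots$. $\mathcal{Q}$ is the set of functions $f$ analytic and injective on $\overline{\mathbb{U}}\setminus E(f)$, where $E(f)=\{\zeta\in\partial\mathbb{U}:\lim_{z\to\zeta}f(z)=\infty\}$, with $f'(\zeta)\ne0$ for $\zeta\in\partial\mathbb{U}\setminus E(f)$. For analytic $g,h$ in $\mathbb{U}$, $g\prec h$ means $g(z)=h(w(z))$ for some analytic $w$ in $\mathbb{U}$ with $|w(z)|\le|z|$. Operators: $(L_p^a)$ is a family of linear operators mapping $\mathcal{A}_p$ into $\mathcal{A}_p$, indexed by a parameter $a$ (with shifts $a+1,a+2$ allowed), with complex constants $\alpha_a$ such that for all $f\in\mathcal{A}_p$ $$z[L_p^af(z)]'=\alpha_aL_p^{a+1}f(z)-(\alpha_a-p)L_p^af(z).$$ For real $\mu,\nu$ not both zero, $$\Omega_{L,\mu,\nu}^a(f(z))=\left(\frac{L_p^{a+1}f(z)}{z^p}\right)^\mu\left(\frac{z^p}{L_p^af(z)}\right)^\nu .$$ Powers are principal ones (branches with value $1$ at $z=0$). It is understood that $L_p^{a+1}f(z)/z^p$ has no zeros in $\mathbb{U}$ if $\mu\notin\{0,1,2,\dots\}$ and $L_p^{a}f(z)/z^p$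 has no zeros in $\mathbb{U}$ if $-\nu\notin\{0,1,2,\dots\}$; products are extended analytically over removable singularities. *)

(* Defs.v *)
From Stdlib Require Import Reals ClassicalEpsilon.
From Coquelicot Require Import Coquelicot.

Open Scope C_scope.

(** Functions on the unit disk are total functions [C -> C]; every predicate
    below looks only at their values on the disk. *)
Definition disk (z : C) : Prop := (Cmod z < 1)%R.
Definition circle (z : C) : Prop := Cmod z = 1%R.

Definition is_power_series (a : nat -> C) (z l : C) : Prop :=
  is_pseries (K := C_AbsRing) (V := C_NormedModule) a z l.

Definition analytic_at (f : C -> C) (z : C) : Prop :=
  exists (r : R) (a : nat -> C), (0 < r)%R /\
    forall h : C, (Cmod h < r)%R -> is_power_series a h (f (z + h)).

Definition analytic_on (A : C -> Prop) (f : C -> C) : Prop :=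
  forall z, A z -> analytic_at f z.

Definition injective_on (A : C -> Prop) (f : C -> C) : Prop :=
  forall x y, A x -> A y -> f x = f y -> x = y.

Definition univalent (f : C -> C) : Prop :=
  analytic_on disk f /\ injective_on disk f.

Definition convex_set (A : C -> Prop) : Prop :=
  forall (x y : C) (t : R), A x -> A y -> (0 <= t <= 1)%R ->
    A (RtoC (1 - t) * x + RtoC t * y).

Definition image (A : C -> Prop) (f : C -> C) (w : C) : Prop :=
  exists z, A z /\ f z = w.

Definition convex_univalent (f : C -> C) : Prop :=
  univalent f /\ convex_set (image disk f).

Definition subordinate (g h : C -> C) : Prop :=
  exists w : C -> C, analytic_on disk w /\
    (forall z, disk z -> (Cmod (w z) <= Cmod z)%R) /\
    (forall z, disk z -> g z = h (w z)).

(** The class of [z^p + sum_(k > p) a_k z^k]. *)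
Definition class_A (p : nat) (f : C -> C) : Prop :=
  analytic_on disk f /\
  exists a : nat -> C,
    (forall k, (k < p)%nat -> a k = 0) /\ a p = 1 /\
    forall z, disk z -> is_power_series a z (f z).

(** The class H[1,1] of [1 + a_1 z + a_2 z^2 + ...]. *)
Definition class_H11 (f : C -> C) : Prop :=
  analytic_on disk f /\
  exists a : nat -> C,
    a 0%nat = 1 /\ forall z, disk z -> is_power_series a z (f z).

(** The set E(f); the limit is taken from inside the disk. *)
Definition pole_set (f : C -> C) (zeta : C) : Prop :=
  circle zeta /\
  filterlim (fun z : C => Cmod (f z))
    (within disk (locally (T := C_UniformSpace) zeta)) (Rbar_locally p_infty).

(** [f] matters only on the open disk; [g] is its analytic extension to the
    points of the closed disk outside E(f).  Two local extensions across
    boundary points agree by the identity theorem (intersecting balls centred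
    in the closed disk meet inside the disk), so asking for a single [g] loses
    nothing. *)
Definition class_Q (f : C -> C) : Prop :=
  exists g : C -> C,
    let D z := (Cmod z <= 1)%R /\ ~ pole_set f z in
    (forall z, disk z -> g z = f z) /\
    analytic_on D g /\ injective_on D g /\
    (forall zeta, circle zeta -> ~ pole_set f zeta -> C_derive g zeta <> 0).

(** Analytic extension over removable singularities: whenever [g] has a limit
    over punctured neighbourhoods of [z], [C_lim g z] is that limit; it does not
    depend on [g z], and equals [g z] where [g] is continuous. *)
Definition extend (g : C -> C) (z : C) : C := C_lim g z.

Definition Cexp (z : C) : C :=
  ((exp (Re z) * cos (Im z))%R, (exp (Re z) * sin (Im z))%R).

(** [G] is the principal power [F^s] on the disk ([F 0 = 1]).  Integer powers
    are plain powers and make sense even if [F] has zeros (a negative one has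
    value [0] there, since [/ 0 = 0]); otherwise [G = exp (s log F)] for the
    analytic branch of [log F] vanishing at [0].  The clauses agree on their
    overlap. *)
Definition is_power (F : C -> C) (s : R) (G : C -> C) : Prop :=
  (exists n : nat, s = INR n /\ forall z, disk z -> G z = F z ^ n) \/
  (exists n : nat, s = (- INR n)%R /\ forall z, disk z -> G z = / (F z ^ n)) \/
  (exists l : C -> C, analytic_on disk l /\ l 0 = 0 /\
     (forall z, disk z -> Cexp (l z) = F z) /\
     (forall z, disk z -> G z = Cexp (RtoC s * l z))).

Definition power (F : C -> C) (s : R) : C -> C :=
  epsilon (inhabits F) (is_power F s).

(** [g z / z^p], including its value at [0]. *)
Definition quot_pow (p : nat) (g : C -> C) : C -> C :=
  extend (fun z => g z / z ^ p).

Definition is_nat (s : R) : Prop := exists n : nat, s = INR n.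

Definition zero_free (f : C -> C) : Prop := forall z, disk z -> f z <> 0.

(** [class_A p] is not a vector space, so linearity is required for those
    linear combinations that stay in the class. *)
Definition linear_on_A (p : nat) (T : (C -> C) -> (C -> C)) : Prop :=
  forall (f g : C -> C) (c d : C),
    class_A p f -> class_A p g -> class_A p (fun z => c * f z + d * g z) ->
    forall z, disk z ->
      T (fun x => c * f x + d * g x) z = c * T f z + d * T g z.

(** The family [L b], for parameters [b] in [D], with constants [alpha b]. *)
Definition operator_family (p : nat) (D : C -> Prop)
    (L : C -> (C -> C) -> (C -> C)) (alpha : C -> C) : Prop :=
  (forall b, D b ->
     (forall f, class_A p f -> class_A p (L b f)) /\ linear_on_A p (L b)) /\
  (forall b, D b -> D (b + 1) ->
     forall f, class_A p f -> forall z, disk z ->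
       z * C_derive (L b f) z =
         alpha b * L (b + 1) f z - (alpha b - RtoC (INR p)) * L b f z).

(** [(z^p / L_p^b f(z))^nu] is read as [(L_p^b f(z) / z^p)^(-nu)]. *)
Definition Omega (p : nat) (L : C -> (C -> C) -> (C -> C)) (mu nu : R) (b : C)
    (f : C -> C) : C -> C :=
  fun z => power (quot_pow p (L (b + 1) f)) mu z *
           power (quot_pow p (L b f)) (- nu) z.

(* Main.v *)
Require Import Defs.
From Stdlib Require Ranalysis5.
From Stdlib Require Import Reals Lra Lia ClassicalEpsilon Classical FunctionalExtensionality.
From Coquelicot Require Import Coquelicot.

(** Write [q] for [Omega f] and [gam = alpha_(a+1) mu - alpha_a nu].  Logarithmic differentiation and the
    recurrence of the operators give [alpha_(a+1) Phi = gam q + z q'], so both halves compare [q] with a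
    convex [psi] through the first order operator [h(psi) = gam psi + z psi'].

    Schwarz's lemma for [psi^-1 ((1-t) psi(z) + t psi(cz))] gives
    [Re ((psi z - psi zeta) / (zeta psi'(zeta))) <= 0] for [|z| <= |zeta|].  By the minimum principle for real
    parts, this implies that [gam psi(zeta) + m zeta psi'(zeta)] is not a value of [h(psi)] on [|z| < |zeta|]
    when [m >= 1], and is one on [|z| <= |zeta|] when [0 < m <= 1].  These two facts replace the Loewner
    chains of the classical proofs.

    If one of the subordinations failed, the lift of the inner function through the outer one would reach
    the unit circle at a first point, where Jack's lemma gives contact with ratio [m >= 1]; the two facts
    contradict the hypothesis, for the superordination because a boundary value of the injective open map
    [Phi] is not a value inside the disk.

    Analyticity is by power series; the closure properties come from Cauchy's formula, which makes every
    holomorphic function with continuous derivative analytic. *)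

(** Both halves call the same contact lemma with the roles exchanged. For [q] subordinate to [psi2],
    the outer function is [psi2] and contact reads [zder q = m zder psi2]; for [psi1] subordinate to
    [q], the outer function is [q] and contact reads [zder psi1 = m zder q], so the ratio seen from
    [psi1] is [1 / m]. Hence one fact is needed for factors at least 1 and the other for factors in
    [(0, 1]]. The hypothesis [Re gam >= 0] enters once an equation is divided by a difference of
    values of [psi]: the term [gam psi] then contributes the constant [gam], and the rest is a
    matter of signs of real parts. The obstacle is the boundary. A convex [psi2] need not extend to
    the unit circle, so the subordination is proved after a dilation; in the superordination the
    class Q supplies the extension. The lift of the inner function is not known to have a limit at
    the point of contact, only a cluster value, and has to be joined there to a local inverse. A
    second obstacle is that the quotients [L f / z^p] may have zeros, so the formula for [Phi] is
    computed off an isolated set and reaches the other points by continuity. *)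

Open Scope C_scope.

(** * Complex derivatives *)

(* Coquelicot gives [C] two uniform structures; in this one balls are those of [Cmod], in [C_UniformSpace]
   they are squares.  [locally_C] relates them. *)
Notation Cuni := (AbsRing_UniformSpace C_AbsRing).
Notation ccont := (continuous (T := Cuni) (U := Cuni)).
Notation cnear := (locally (T := Cuni)).
Notation is_cderive f z l := (is_derive (K := C_AbsRing) (V := C_NormedModule) f (z : C) (l : C)).

Lemma cnear_ex (z : C) (P : C -> Prop) :
  cnear z P <-> exists d, (0 < d)%R /\ forall x, (Cmod (x - z) < d)%R -> P x.
Proof.
  split.
  - intros [d H]. exists d. split; [apply cond_pos|]. intros x Hx. apply H. exact Hx.
  - intros [d [Hd H]]. exists (mkposreal d Hd). intros x Hx. apply H. exact Hx.
Qed.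

Lemma ccont_eps (f : C -> C) (z : C) :
  ccont f z <-> forall e, (0 < e)%R -> cnear z (fun x => (Cmod (f x - f z) < e)%R).
Proof.
  split.
  - intros H e He. apply (proj1 (filterlim_locally (U := Cuni) f (f z)) H (mkposreal e He)).
  - intros H. apply filterlim_locally. intros e. apply (H e). apply cond_pos.
Qed.

Lemma ccont_const (c z : C) : ccont (fun _ => c) z.
Proof. apply continuous_const. Qed.
Lemma ccont_id (z : C) : ccont (fun x => x) z.
Proof. apply continuous_id. Qed.
Lemma ccont_plus (f g : C -> C) (z : C) :
  ccont f z -> ccont g z -> ccont (fun x => f x + g x) z.
Proof. apply (continuous_plus (V := AbsRing_NormedModule C_AbsRing)). Qed.
Lemma ccont_opp (f : C -> C) (z : C) : ccont f z -> ccont (fun x => - f x) z.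
Proof. apply (continuous_opp (V := AbsRing_NormedModule C_AbsRing)). Qed.
Lemma ccont_minus (f g : C -> C) (z : C) :
  ccont f z -> ccont g z -> ccont (fun x => f x - g x) z.
Proof. apply (continuous_minus (V := AbsRing_NormedModule C_AbsRing)). Qed.
Lemma ccont_mult (f g : C -> C) (z : C) :
  ccont f z -> ccont g z -> ccont (fun x => f x * g x) z.
Proof. apply (continuous_mult (K := C_AbsRing)). Qed.
Lemma ccont_comp (f g : C -> C) (z : C) :
  ccont g z -> ccont f (g z) -> ccont (fun x => f (g x)) z.
Proof. intros; now apply (@continuous_comp Cuni Cuni Cuni g f). Qed.
Lemma ccont_ext_loc (f g : C -> C) (z : C) :
  cnear z (fun x => f x = g x) -> ccont f z -> ccont g z.
Proof. intros H Hf. apply (@continuous_ext_loc Cuni Cuni g f z); auto.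
Qed.

Lemma ccont_ne (f : C -> C) (z c : C) :
  ccont f z -> f z <> c -> cnear z (fun x => f x <> c).
Proof.
  intros Hf Hz.
  assert (Hp : (0 < Cmod (f z - c))%R) by (apply Cmod_gt_0; intro E; apply Hz; now apply Ceq_minus).
  apply (filter_imp (fun x => (Cmod (f x - f z) < Cmod (f z - c))%R)).
  - intros x Hx E. rewrite E in Hx. replace (f z - c) with (- (c - f z)) in Hx by ring.
    rewrite Cmod_opp in Hx. lra.
  - exact (proj1 (ccont_eps f z) Hf _ Hp).
Qed.

Lemma ccont_inv (f : C -> C) (z : C) :
  ccont f z -> f z <> 0 -> ccont (fun x => / f x) z.
Proof.
  intros Hf Hz.
  apply (ccont_comp Cinv f); [exact Hf|].
  generalize (f z) Hz. clear. intros w Hw.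
  assert (Hm := proj1 (Cmod_gt_0 w) Hw).
  apply ccont_eps. intros e He.
  apply cnear_ex. exists (Rmin (Cmod w / 2) (e * Cmod w * Cmod w / 2)). split.
  { apply Rmin_pos; [lra|]. assert (0 < e * Cmod w)%R by nra. nra. }
  intros x Hx.
  assert (H1 : (Cmod (x - w) < Cmod w / 2)%R) by (eapply Rlt_le_trans; [exact Hx|apply Rmin_l]).
  assert (H2 : (Cmod (x - w) < e * Cmod w * Cmod w / 2)%R) by (eapply Rlt_le_trans; [exact Hx|apply Rmin_r]).
  assert (H3 : (Cmod w / 2 < Cmod x)%R).
  { assert (H := Cmod_triangle x (- (x - w))). rewrite Cmod_opp in H.
    replace (x + - (x - w)) with w in H by ring. lra. }
  assert (Hx0 : x <> 0) by (apply Cmod_gt_0; lra).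
  replace (/ x - / w) with (- (x - w) * (/ x * / w)) by (field; auto).
  rewrite Cmod_mult, Cmod_opp, Cmod_mult, !Cmod_inv by assumption.
  rewrite <- Rinv_mult.
  apply (Rmult_lt_reg_r (Cmod x * Cmod w)); [nra|].
  rewrite Rmult_assoc, Rinv_l, Rmult_1_r by nra.
  assert (e * Cmod w * (Cmod w/2) < e * Cmod w * Cmod x)%R by (apply Rmult_lt_compat_l; nra).
  lra.
Qed.

Lemma is_cderive_eps (f : C -> C) (z l : C) :
  is_cderive f z l <->
  forall e, (0 < e)%R -> cnear z (fun x => (Cmod (f x - f z - l * (x - z)) <= e * Cmod (x - z))%R).
Proof.
  split.
  - intros [_ H] e He. specialize (H z (fun P HP => HP) (mkposreal e He)).
    apply (filter_imp (F := cnear z)) with (2 := H). intros x Hx.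
    rewrite (Cmult_comm l). exact Hx.
  - intros H. split; [apply (is_linear_scal_l (K := C_AbsRing) (V := C_NormedModule))|].
    intros y Hy.
    assert (Ey : z = y).
    { apply (is_filter_lim_locally_unique (K := C_AbsRing) (V := AbsRing_NormedModule C_AbsRing)). exact Hy. }
    subst y. intros e. generalize (H e (cond_pos e)). apply filter_imp. intros x Hx.
    rewrite (Cmult_comm l) in Hx. exact Hx.
Qed.

(** Carathéodory's form of the derivative. The slope is continuous at [z] and the factorization
    holds at every [x] without division, so the product, chain and inversion rules below become
    algebra on slopes. *)
Lemma is_cderive_slope (f : C -> C) (z l : C) :
  is_cderive f z l <->
  exists s : C -> C, ccont s z /\ s z = l /\ forall x, f x - f z = s x * (x - z).
Proof.
  split.
  - intros H. rewrite is_cderive_eps in H.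
    exists (fun x => match Ceq_dec x z with left _ => l | right _ => (f x - f z) / (x - z) end).
    split; [|split].
    + apply ccont_eps. intros e He.
      assert (He2 : (0 < e/2)%R) by lra.
      apply (filter_imp (F := cnear z)) with (2 := H _ He2).
      intros x Hx. cbv beta.
      destruct (Ceq_dec z z) as [_|N]; [|now elim N].
      destruct (Ceq_dec x z) as [E|N].
      * replace (l - l) with (RtoC 0) by ring. rewrite Cmod_0. lra.
      * assert (Nz : x - z <> 0) by (intro E; apply N; now apply Ceq_minus).
        assert (Hp := proj1 (Cmod_gt_0 _) Nz).
        replace ((f x - f z) / (x - z) - l) with ((f x - f z - l * (x - z)) / (x - z)) by (field; exact Nz).
        rewrite Cmod_div by exact Nz.
        apply Rle_lt_trans with (e / 2)%R; [|lra].
        apply (Rmult_le_reg_r (Cmod (x - z))); [exact Hp|].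
        unfold Rdiv at 1. rewrite Rmult_assoc, Rinv_l, Rmult_1_r by lra.
        exact Hx.
    + destruct (Ceq_dec z z) as [_|N]; [reflexivity|now elim N].
    + intros x. destruct (Ceq_dec x z) as [->|N]; [ring|].
      field. intro E; apply N; now apply Ceq_minus.
  - intros [s [Hs [<- H]]]. apply is_cderive_eps. intros e He.
    apply (filter_imp (F := cnear z)) with (2 := proj1 (ccont_eps s z) Hs e He).
    intros x Hx. rewrite H.
    replace (s x * (x - z) - s z * (x - z)) with ((s x - s z) * (x - z)) by ring.
    rewrite Cmod_mult. apply Rmult_le_compat_r; [apply Cmod_ge_0|now left].
Qed.

Lemma is_cderive_ext_loc (f g : C -> C) (z l : C) :
  cnear z (fun x => f x = g x) -> is_cderive f z l -> is_cderive g z l.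
Proof. apply is_derive_ext_loc. Qed.
Lemma is_cderive_const (c z : C) : is_cderive (fun _ => c) z 0.
Proof. apply is_cderive_slope. exists (fun _ => 0). split; [apply ccont_const|split; [auto|intros; ring]]. Qed.
Lemma is_cderive_id (z : C) : is_cderive (fun x => x) z 1.
Proof. apply is_cderive_slope. exists (fun _ => 1). split; [apply ccont_const|split; [auto|intros; ring]]. Qed.
Lemma is_cderive_cont (f : C -> C) (z l : C) : is_cderive f z l -> ccont f z.
Proof.
  intros [s [Hs [_ H]]]%is_cderive_slope.
  apply (ccont_ext_loc (fun x => s x * (x - z) + f z)).
  - apply filter_forall. intros x. rewrite <- H. ring.
  - apply ccont_plus; [apply ccont_mult; [exact Hs|apply ccont_minus]|];
      auto using ccont_id, ccont_const.
Qed.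
Lemma is_cderive_plus (f g : C -> C) (z a b : C) :
  is_cderive f z a -> is_cderive g z b -> is_cderive (fun x => f x + g x) z (a + b).
Proof.
  intros [s [Hs [<- Es]]]%is_cderive_slope [t [Ht [<- Et]]]%is_cderive_slope.
  apply is_cderive_slope. exists (fun x => s x + t x).
  split; [now apply ccont_plus|split; [reflexivity|]].
  intros x. rewrite Cmult_plus_distr_r, <- Es, <- Et. ring.
Qed.
Lemma is_cderive_mult (f g : C -> C) (z a b : C) :
  is_cderive f z a -> is_cderive g z b ->
  is_cderive (fun x => f x * g x) z (a * g z + f z * b).
Proof.
  intros Df Dg. assert (Cg := is_cderive_cont _ _ _ Dg). revert Df Dg.
  intros [s [Hs [<- Es]]]%is_cderive_slope [t [Ht [<- Et]]]%is_cderive_slope.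
  apply is_cderive_slope. exists (fun x => s x * g x + f z * t x).
  split; [|split; [reflexivity|]].
  - apply ccont_plus; apply ccont_mult; auto using ccont_const.
  - intros x. transitivity ((f x - f z) * g x + f z * (g x - g z)); [ring|].
    rewrite Es, Et. ring.
Qed.
Lemma is_cderive_comp (f g : C -> C) (z a b : C) :
  is_cderive f (g z) a -> is_cderive g z b -> is_cderive (fun x => f (g x)) z (a * b).
Proof.
  intros Df Dg. assert (Cg := is_cderive_cont _ _ _ Dg). revert Df Dg.
  intros [s [Hs [<- Es]]]%is_cderive_slope [t [Ht [<- Et]]]%is_cderive_slope.
  apply is_cderive_slope. exists (fun x => s (g x) * t x).
  split; [|split; [reflexivity|]].
  - apply ccont_mult; auto. now apply (ccont_comp s g).
  - intros x. rewrite Es, Et. ring.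
Qed.
Lemma is_cderive_eq (f : C -> C) (z a b : C) : is_cderive f z a -> a = b -> is_cderive f z b.
Proof. now intros H <-. Qed.
Lemma is_cderive_opp (f : C -> C) (z a : C) :
  is_cderive f z a -> is_cderive (fun x => - f x) z (- a).
Proof.
  intros [s [Hs [<- Es]]]%is_cderive_slope. apply is_cderive_slope. exists (fun x => - s x).
  split; [now apply ccont_opp|split; [reflexivity|]].
  intros x. transitivity (- (f x - f z)); [ring|]. rewrite Es. ring.
Qed.
Lemma is_cderive_scal (c : C) (f : C -> C) (z a : C) :
  is_cderive f z a -> is_cderive (fun x => c * f x) z (c * a).
Proof.
  intros H. eapply is_cderive_eq; [apply is_cderive_mult; [apply is_cderive_const|exact H]|].
  apply (eq_trans (y := 0 * f z + c * a)); [reflexivity|ring].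
Qed.
Lemma is_cderive_affine (a b z : C) : is_cderive (fun x => a + b * x) z b.
Proof.
  apply is_cderive_slope. exists (fun _ => b). split; [apply ccont_const|split; [reflexivity|]].
  intros x. ring.
Qed.
Lemma is_cderive_linear (b z : C) : is_cderive (fun x => b * x) z b.
Proof.
  apply is_cderive_slope. exists (fun _ => b). split; [apply ccont_const|split; [reflexivity|]].
  intros x. ring.
Qed.
Lemma is_cderive_minus (f g : C -> C) (z a b : C) :
  is_cderive f z a -> is_cderive g z b -> is_cderive (fun x => f x - g x) z (a - b).
Proof. intros. apply is_cderive_plus; auto using is_cderive_opp. Qed.
Lemma is_cderive_inv (f : C -> C) (z a : C) :
  is_cderive f z a -> f z <> 0 -> is_cderive (fun x => / f x) z (- a / (f z * f z)).
Proof.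
  intros Df Nz. apply (is_cderive_eq _ _ ((- / (f z * f z)) * a)); [|field; auto].
  apply (is_cderive_comp Cinv f); [|exact Df].
  generalize (f z) Nz. clear. intros w Hw.
  (* At [x = 0] the slope has to match the junk value [/ 0 = 0]. *)
  apply is_cderive_slope.
  exists (fun x => match Ceq_dec x (RtoC 0) with left _ => / w / w | right _ => - / (x * w) end).
  assert (N : cnear w (fun x => x <> RtoC 0)) by (apply (ccont_ne (fun x => x)); auto using ccont_id).
  split; [|split].
  - apply (ccont_ext_loc (fun x => - / (x * w))).
    + apply (filter_imp (F := cnear w)) with (2 := N). intros x Hx.
      destruct (Ceq_dec x (RtoC 0)); [contradiction|reflexivity].
    + apply ccont_opp, ccont_inv; [|now apply Cmult_neq_0].
      apply ccont_mult; auto using ccont_id, ccont_const.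
  - destruct (Ceq_dec w 0); [contradiction|reflexivity].
  - intros x. destruct (Ceq_dec x (RtoC 0)) as [->|Nx].
    + replace (/ 0) with (RtoC 0). field; auto.
      unfold Cinv, RtoC; simpl. unfold Rdiv. now rewrite Ropp_0, !Rmult_0_l.
    + field; auto.
Qed.

(** * Power series *)

Notation cseries a l := (is_series (K := C_AbsRing) (V := C_NormedModule) a (l : C)).
Notation csum a := (sum_n (G := C_AbelianGroup) a%C).

Lemma cseries_eps (a : nat -> C) (l : C) :
  cseries a l <-> forall e, (0 < e)%R -> eventually (fun n => (Cmod (csum a n - l) < e)%R).
Proof.
  split.
  - intros H e He. 
    apply (H (fun x : C => (Cmod (x - l) < e)%R)).
    apply locally_C, cnear_ex. exists e; auto.
  - intros H P HP. apply locally_C, cnear_ex in HP. destruct HP as [d [Hd HP]].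
    destruct (H d Hd) as [N HN]. exists N. intros n Hn. now apply HP, HN.
Qed.

Lemma is_power_series_cseries (a : nat -> C) (z l : C) :
  is_power_series a z l <-> cseries (fun n => a n * z ^ n) l.
Proof.
  unfold is_power_series, is_pseries.
  split; apply is_series_ext; intros n; apply Cmult_comm.
Qed.

Lemma cseries_shift (a : nat -> C) (l : C) :
  cseries a l -> cseries (fun n => a (S n)) (l - a O).
Proof.
  intros H. apply is_series_incr_1.
  change (cseries a ((l - a O) + a O)%C).
  now replace ((l - a O) + a O)%C with l by ring.
Qed.

Lemma cseries_Cmod_le (a : nat -> C) (b : nat -> R) (l : C) (L : R) :
  cseries a l -> is_series b L -> (forall n, (Cmod (a n) <= b n)%R) -> (Cmod l <= L)%R.
Proof.
  intros Ha Hb Hab. apply le_epsilon. intros e He.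
  destruct (proj1 (cseries_eps a l) Ha (e/2)%R) as [N HN]; [lra|].
  assert (Hb' : eventually (fun n => ball L (mkposreal (e/2) ltac:(lra)) (sum_n b n))).
  { apply Hb. apply locally_ball. }
  destruct Hb' as [M HM]. specialize (HN (max N M) (Nat.le_max_l _ _)). specialize (HM (max N M) (Nat.le_max_r _ _)).
  change (Rabs (sum_n b (max N M) - L) < e / 2)%R in HM.
  apply Rabs_def2 in HM.
  assert (Hs : (Cmod (csum a (max N M)) <= sum_n b (max N M))%R).
  { generalize (max N M). intros n. induction n as [|n IH].
    - rewrite !sum_O. apply Hab.
    - rewrite !sum_Sn. eapply Rle_trans; [apply Cmod_triangle|].
      apply Rplus_le_compat; auto. }
  assert (H := Cmod_triangle (csum a (max N M)) (- (csum a (max N M) - l))).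
  rewrite Cmod_opp in H.
  replace (csum a (max N M) + - (csum a (max N M) - l)) with l in H by ring. lra.
Qed.

(** Convergent partial sums are bounded, hence so are the terms, as differences of consecutive ones.
    This passes from the complex series to the real series of moduli and its [CV_radius]. *)
Lemma is_power_series_CV_radius (a : nat -> C) (h l : C) :
  is_power_series a h l -> Rbar_le (Cmod h) (CV_radius (fun n => Cmod (a n))).
Proof.
  intros H%is_power_series_cseries.
  apply (proj1 (CV_radius_bounded (fun n => Cmod (a n)))).
  assert (Hb : exists M, forall n, (Cmod (csum (fun n => a n * h ^ n) n) <= M)%R).
  { destruct (proj1 (cseries_eps _ _) H 1%R Rlt_0_1) as [N HN].
    assert (HF : exists M, forall n, (n <= N)%nat -> (Cmod (csum (fun n => a n * h ^ n) n) <= M)%R).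
    { clear. induction N as [|N [M IH]].
      - exists (Cmod (csum (fun n => a n * h ^ n) 0)). intros n Hn. replace n with 0%nat by lia. lra.
      - exists (Rmax M (Cmod (csum (fun n => a n * h ^ n) (S N)))). intros n Hn.
        destruct (Nat.eq_dec n (S N)) as [->|]; [apply Rmax_r|].
        eapply Rle_trans; [apply IH; lia|apply Rmax_l]. }
    destruct HF as [M HM]. exists (Rmax M (Cmod l + 1)). intros n.
    destruct (Nat.le_ge_cases n N) as [Hn|Hn].
    - eapply Rle_trans; [now apply HM|apply Rmax_l].
    - eapply Rle_trans; [|apply Rmax_r].
      specialize (HN n Hn).
      assert (Ht := Cmod_triangle l (csum (fun n => a n * h ^ n) n - l)).
      assert (E : forall u v : C, u + (v - u) = v) by (intros; ring).
      rewrite E in Ht.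
      lra. }
  destruct Hb as [M HM].
  exists (2 * M)%R. intros n.
  assert (E : a n * h ^ n = match n with O => csum (fun n => a n * h ^ n) 0
     | S m => csum (fun n => a n * h ^ n) n - csum (fun n => a n * h ^ n) m end).
  { destruct n as [|m]; [now rewrite sum_O|]. rewrite sum_Sn.
    change (a (S m) * h ^ S m = (csum (fun n => a n * h ^ n) m + a (S m) * h ^ S m)%C - csum (fun n => a n * h ^ n) m).
    ring. }
  rewrite <- Cmod_pow, <- Cmod_mult, Rabs_pos_eq by apply Cmod_ge_0. rewrite E.
  assert (HM0 := Rle_trans _ _ _ (Cmod_ge_0 _) (HM 0%nat)).
  destruct n as [|m]; [specialize (HM 0%nat); lra|].
  eapply Rle_trans; [apply Cmod_triangle|]. rewrite Cmod_opp.
  generalize (HM m) (HM (S m)). lra.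
Qed.

(** The factor [(n+1)(n+2) rho^n] is the pattern of the second derived series at [rho], so that
    summing over [n] meets a convergent series. The induction multiplies the remainder by [h] and
    adds [(n+2) k^(n+1) (h-k)^2]. *)
Lemma pow_taylor_bound (rho : R) (h k : C) (n : nat) :
  (Cmod h <= rho)%R -> (Cmod k <= rho)%R ->
  (Cmod (h ^ S (S n) - k ^ S (S n) - RtoC (INR (S (S n))) * k ^ S n * (h - k)) <=
     INR (S n) * INR (S (S n)) * rho ^ n * (Cmod (h - k) * Cmod (h - k)))%R.
Proof.
  intros Hh Hk. induction n as [|n IH].
  - simpl. replace (h * (h * 1) - k * (k * 1) - RtoC (1 + 1) * (k * 1) * (h - k)) with ((h - k) * (h - k))
      by (rewrite RtoC_plus; ring).
    rewrite Cmod_mult. generalize (Cmod_ge_0 (h - k)). nra.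
  - replace (h ^ S (S (S n)) - k ^ S (S (S n)) - RtoC (INR (S (S (S n)))) * k ^ S (S n) * (h - k))
      with (h * (h ^ S (S n) - k ^ S (S n) - RtoC (INR (S (S n))) * k ^ S n * (h - k))
            + RtoC (INR (S (S n))) * k ^ S n * ((h - k) * (h - k))).
    2:{ rewrite (S_INR (S (S n))), RtoC_plus. rewrite !Cpow_S. ring. }
    eapply Rle_trans; [apply Cmod_triangle|]. rewrite !Cmod_mult.
    rewrite Cmod_R, Rabs_pos_eq by apply pos_INR.
    assert (H1 : (Cmod (k ^ S n) <= rho ^ S n)%R).
    { rewrite Cmod_pow. apply pow_incr. split; [apply Cmod_ge_0|exact Hk]. }
    assert (H0 : (0 <= rho)%R) by (eapply Rle_trans; [apply Cmod_ge_0|exact Hh]).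
    assert (Hd := Rmult_le_pos _ _ (Cmod_ge_0 (h - k)) (Cmod_ge_0 (h - k))).
    set (D := (Cmod (h - k) * Cmod (h - k))%R) in *.
    assert (Hr := pow_le rho n H0).
    assert (H2 : (Cmod h * Cmod (h ^ S (S n) - k ^ S (S n) - RtoC (INR (S (S n))) * k ^ S n * (h - k))
              <= rho * (INR (S n) * INR (S (S n)) * rho ^ n * D))%R).
    { apply Rmult_le_compat; auto using Cmod_ge_0. }
    assert (H3 : (INR (S (S n)) * Cmod (k ^ S n) * D <= INR (S (S n)) * (rho * rho ^ n) * D)%R).
    { apply Rmult_le_compat_r; auto. apply Rmult_le_compat_l; [apply pos_INR|exact H1]. }
    assert (Hx : (0 <= rho * rho ^ n * D)%R) by (apply Rmult_le_pos; [nra|auto]).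
    rewrite (S_INR (S (S n))) in *. rewrite (S_INR (S n)) in *. rewrite (S_INR n) in *.
    assert (Hn := pos_INR n). simpl pow.
    set (X := (rho * rho ^ n * D)%R) in *. 
    replace (rho * ((INR n + 1) * (INR n + 1 + 1) * rho ^ n * D))%R with ((INR n + 1) * (INR n + 1 + 1) * X)%R in H2 by (unfold X; ring).
    replace ((INR n + 1 + 1) * (rho * rho ^ n) * D)%R with ((INR n + 1 + 1) * X)%R in H3 by (unfold X; ring).
    replace ((INR n + 1 + 1) * (INR n + 1 + 1 + 1) * (rho * rho ^ n) * D)%R with ((INR n + 1 + 1) * (INR n + 1 + 1 + 1) * X)%R by (unfold X; ring).
    nra.
Qed.

Definition cps_derive (a : nat -> C) (n : nat) : C := RtoC (INR (S n)) * a (S n).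

Lemma is_power_series_derive (f : C -> C) (z : C) (r : R) (a : nat -> C) :
  (forall h, (Cmod h < r)%R -> is_power_series a h (f (z + h))) ->
  forall h, (Cmod h < r)%R -> exists l,
    is_power_series (cps_derive a) h l /\ is_cderive f (z + h) l.
Proof.
  intros Hf k Hk.
  set (rho := ((Cmod k + r) / 2)%R).
  assert (Hk0 := Cmod_ge_0 k).
  assert (Hrho : (Cmod k < rho < r)%R) by (unfold rho; lra).
  set (b := fun n => Cmod (a n)).
  (* Convergence at the midpoint of [rho] and [r] puts the radius strictly above [rho];
     differentiating termwise, twice, keeps the radius. *)
  assert (HR : Rbar_lt (Rabs rho) (CV_radius b)).
  { apply Rbar_lt_le_trans with ((rho + r) / 2)%R.
    - simpl. rewrite Rabs_pos_eq; lra.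
    - assert (Hm : Cmod (RtoC ((rho + r) / 2)) = ((rho + r) / 2)%R) by (rewrite Cmod_R; apply Rabs_pos_eq; lra).
      rewrite <- Hm. apply (is_power_series_CV_radius a _ (f (z + RtoC ((rho + r) / 2)))).
      apply Hf. lra. }
  assert (HR1 : Rbar_lt (Rabs rho) (CV_radius (PS_derive b))) by now rewrite CV_radius_derive.
  assert (HR2 : Rbar_lt (Rabs rho) (CV_radius (PS_derive (PS_derive b)))) by now rewrite CV_radius_derive.
  destruct (CV_disk_inside _ _ HR2) as [L2 HL2].
  destruct (ex_series_le (K := C_AbsRing) (V := C_CompleteNormedModule)
     (fun n => cps_derive a n * k ^ n) (fun n => Rabs (PS_derive b n * rho ^ n))) as [l Hl].
  { intros n. change (Cmod (cps_derive a n * k ^ n) <= Rabs (PS_derive b n * rho ^ n))%R.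
    unfold cps_derive, PS_derive. rewrite !Cmod_mult, Cmod_R, Rabs_pos_eq, Cmod_pow by apply pos_INR.
    rewrite Rabs_pos_eq.
    2:{ apply Rmult_le_pos; [apply Rmult_le_pos; [apply pos_INR|apply Cmod_ge_0]|apply pow_le; lra]. }
    apply Rmult_le_compat_l; [apply Rmult_le_pos; [apply pos_INR|apply Cmod_ge_0]|].
    apply pow_incr; lra. }
  { exact (CV_disk_inside _ _ HR1). }
  change (cseries (fun n => cps_derive a n * k ^ n) l) in Hl.
  exists l. split; [now apply is_power_series_cseries|].
  (* The Taylor remainder series is dominated by [|h - k|^2] times the second derived series at [rho]. *)
  assert (Hrem : forall h, (Cmod h <= rho)%R ->
     (Cmod (f (z + h)%C - f (z + k)%C - l * (h - k)) <= L2 * (Cmod (h - k) * Cmod (h - k)))%R).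
  { intros h Hh.
    assert (Sh := proj1 (is_power_series_cseries _ _ _) (Hf h ltac:(lra))).
    assert (Sk := proj1 (is_power_series_cseries _ _ _) (Hf k ltac:(lra))).
    assert (S0 := is_series_minus _ _ _ _ Sh Sk).
    apply cseries_shift in S0.
    assert (S1 := is_series_minus _ _ _ _ S0 (is_series_scal (h - k) _ _ Hl)).
    apply cseries_shift in S1.
    cbv beta in S1.
    assert (S2 := cseries_Cmod_le _ (fun n => (Cmod (h - k) * Cmod (h - k)) * Rabs (PS_derive (PS_derive b) n * rho ^ n))%R
       _ _ S1 (is_series_scal (K := R_AbsRing) (V := R_NormedModule) (Cmod (h - k) * Cmod (h - k))%R _ _ HL2)).
    lapply S2.
    2:{ intros n.
      change (Cmod (a (S (S n)) * h ^ (S (S n)) - a (S (S n)) * k ^ (S (S n)) - (h - k) * (cps_derive a (S n) * k ^ (S n)))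
        <= Cmod (h - k) * Cmod (h - k) * Rabs (PS_derive (PS_derive b) n * rho ^ n))%R.
      unfold cps_derive, PS_derive, b.
      replace (a (S (S n)) * h ^ S (S n) - a (S (S n)) * k ^ S (S n) - (h - k) * (RtoC (INR (S (S n))) * a (S (S n)) * k ^ S n))
       with (a (S (S n)) * (h ^ S (S n) - k ^ S (S n) - RtoC (INR (S (S n))) * k ^ S n * (h - k))) by ring.
      rewrite Cmod_mult. rewrite Rabs_pos_eq.
      2:{ apply Rmult_le_pos; [|apply pow_le; lra].
          apply Rmult_le_pos; [apply pos_INR|]. apply Rmult_le_pos; [apply pos_INR|]. apply Cmod_ge_0. }
      assert (HH := Rmult_le_compat_l _ _ _ (Cmod_ge_0 (a (S (S n)))) (pow_taylor_bound rho h k n ltac:(lra) ltac:(lra))).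
      eapply Rle_trans; [exact HH|]. right. ring. }
    clear S2. intros S2.
    etransitivity; [|etransitivity; [exact S2|right; apply Rmult_comm]].
    right. f_equal. 
    change (f (z + h) - f (z + k) - l * (h - k) =
      (((f (z + h) - f (z + k)) + - (a O * 1 - a O * 1)) - (h - k) * l) + 
       - ((a 1%nat * (h * 1) - a 1%nat * (k * 1)) - (h - k) * (RtoC 1 * a 1%nat * 1))).
    ring. }
  assert (HL20 : (0 <= L2)%R).
  { assert (H := Hrem (k + RtoC (rho - Cmod k))).
    replace (k + RtoC (rho - Cmod k) - k) with (RtoC (rho - Cmod k)) in H by ring.
    assert (Hp : (0 < Cmod (RtoC (rho - Cmod k)))%R) by (rewrite Cmod_R, Rabs_pos_eq; lra).
    set (X := Cmod (RtoC (rho - Cmod k))) in *.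
    apply (Rmult_le_reg_r (X * X)); [nra|]. rewrite Rmult_0_l.
    eapply Rle_trans; [|apply H]. apply Cmod_ge_0.
    eapply Rle_trans; [apply Cmod_triangle|]. rewrite Cmod_R, Rabs_pos_eq; lra. }
  apply is_cderive_eps. intros e He. apply cnear_ex.
  exists (Rmin (rho - Cmod k) (e / (L2 + 1))). split.
  { apply Rmin_pos; [lra|]. apply Rdiv_lt_0_compat; lra. }
  intros x Hx.
  assert (Hx1 := Rlt_le_trans _ _ _ Hx (Rmin_l _ _)).
  assert (Hx2 := Rlt_le_trans _ _ _ Hx (Rmin_r _ _)).
  assert (H := Hrem (x - z)).
  replace (z + (x - z)) with x in H by ring.
  replace (x - z - k) with (x - (z + k)) in H by ring.
  eapply Rle_trans; [apply H|].
  { assert (Ht := Cmod_triangle k (x - (z + k))). replace (k + (x - (z + k))) with (x - z) in Ht by ring. lra. }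
  rewrite <- Rmult_assoc. apply Rmult_le_compat_r; [apply Cmod_ge_0|].
  assert (Hq : (Cmod (x - (z + k)) * (L2 + 1) <= e)%R).
  { apply Rlt_le in Hx2. apply Rmult_le_compat_r with (r := (L2 + 1)%R) in Hx2; [|lra].
    unfold Rdiv in Hx2. rewrite Rmult_assoc, Rinv_l, Rmult_1_r in Hx2; lra. }
  generalize (Cmod_ge_0 (x - (z + k))). nra.
Qed.

(** * Paths and integrals over the circle *)

Lemma analytic_at_cderive (f : C -> C) (z : C) :
  analytic_at f z ->
  cnear z (fun x => is_cderive f x (C_derive f x)) /\ analytic_at (C_derive f) z.
Proof.
  intros [r [a [Hr Ha]]].
  assert (H := is_power_series_derive f z r a Ha).
  split.
  - apply cnear_ex. exists r. split; [exact Hr|]. intros x Hx.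
    destruct (H (x - z) Hx) as [l [_ Hl]].
    replace (z + (x - z)) with x in Hl by ring.
    now rewrite (is_C_derive_unique _ _ _ Hl).
  - exists r, (cps_derive a). split; [exact Hr|]. intros h Hh.
    destruct (H h Hh) as [l [Hl Dl]].
    now rewrite (is_C_derive_unique _ _ _ Dl).
Qed.

Lemma analytic_at_is_cderive (f : C -> C) (z : C) :
  analytic_at f z -> is_cderive f z (C_derive f z).
Proof. intros H. apply (locally_singleton (T := Cuni) z), analytic_at_cderive, H. Qed.

Lemma analytic_at_ccont (f : C -> C) (z : C) : analytic_at f z -> ccont f z.
Proof. intros H. eapply is_cderive_cont, analytic_at_is_cderive, H. Qed.

Lemma analytic_at_near (f : C -> C) (z : C) :
  analytic_at f z -> cnear z (fun x => is_cderive f x (C_derive f x) /\ ccont (C_derive f) x).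
Proof.
  intros H. destruct (analytic_at_cderive f z H) as [H1 H2].
  apply filter_and; [exact H1|].
  apply (filter_imp (F := cnear z)) with (2 := proj1 (analytic_at_cderive _ z H2)).
  intros x Hx. eapply is_cderive_cont, Hx.
Qed.

Notation pcont := (continuous (T := R_UniformSpace) (U := Cuni)).

(** Carathéodory's form again, for a real parameter: composing with a complex differentiable
    function multiplies slopes. *)
Definition pder (g : R -> C) (t : R) (v : C) : Prop :=
  exists s : R -> C, pcont s t /\ s t = v /\ forall x, g x - g t = s x * RtoC (x - t).

Lemma continuous_Cuni (T : UniformSpace) (g : T -> C) (t : T) :
  continuous (U := R_UniformSpace) (fun x => Re (g x)) t ->
  continuous (U := R_UniformSpace) (fun x => Im (g x)) t ->
  continuous (U := Cuni) g t.
Proof.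
  intros H1 H2. apply filterlim_locally. intros e.
  assert (He : (0 < e / 2)%R) by (generalize (cond_pos e); lra).
  generalize (filter_and _ _ (proj1 (filterlim_locally _ _) H1 (mkposreal _ He)) (proj1 (filterlim_locally _ _) H2 (mkposreal _ He))).
  apply filter_imp. intros x [A B].
  change (Rabs (Re (g x) - Re (g t)) < e / 2)%R in A.
  change (Rabs (Im (g x) - Im (g t)) < e / 2)%R in B.
  change (Cmod (g x - g t) < e)%R.
  replace (g x - g t) with (RtoC (Re (g x) - Re (g t)) + Ci * RtoC (Im (g x) - Im (g t))).
  2:{ destruct (g x), (g t). apply injective_projections; unfold Re, Im; simpl; ring. }
  eapply Rle_lt_trans; [apply Cmod_triangle|].
  rewrite Cmod_mult, Cmod_Ci, !Cmod_R. lra.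
Qed.

Lemma continuous_Re_comp (T : UniformSpace) (g : T -> C) (t : T) :
  continuous (U := Cuni) g t -> continuous (U := R_UniformSpace) (fun x => Re (g x)) t.
Proof.
  intros H. apply filterlim_locally. intros e.
  generalize (proj1 (filterlim_locally _ _) H e).
  apply filter_imp. intros x Hx.
  change (Cmod (g x - g t) < e)%R in Hx.
  change (Rabs (Re (g x) - Re (g t)) < e)%R.
  eapply Rle_lt_trans; [|exact Hx].
  replace (Re (g x) - Re (g t))%R with (Re (g x - g t)); [apply re_le_Cmod|].
  unfold Cminus. now rewrite re_plus, re_opp.
Qed.

Lemma continuous_cmult (T : UniformSpace) (f g : T -> C) (t : T) :
  continuous (U := Cuni) f t -> continuous (U := Cuni) g t ->
  continuous (U := Cuni) (fun x => f x * g x) t.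
Proof. apply (continuous_mult (K := C_AbsRing)). Qed.
Lemma continuous_cplus (T : UniformSpace) (f g : T -> C) (t : T) :
  continuous (U := Cuni) f t -> continuous (U := Cuni) g t ->
  continuous (U := Cuni) (fun x => f x + g x) t.
Proof. apply (continuous_plus (V := AbsRing_NormedModule C_AbsRing)). Qed.
Lemma continuous_cminus (T : UniformSpace) (f g : T -> C) (t : T) :
  continuous (U := Cuni) f t -> continuous (U := Cuni) g t ->
  continuous (U := Cuni) (fun x => f x - g x) t.
Proof. apply (continuous_minus (V := AbsRing_NormedModule C_AbsRing)). Qed.
Lemma continuous_cinv (T : UniformSpace) (f : T -> C) (t : T) :
  continuous (U := Cuni) f t -> f t <> 0 -> continuous (U := Cuni) (fun x => / f x) t.
Proof.
  intros H Hn. apply (@continuous_comp T Cuni Cuni f Cinv); [exact H|].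
  apply (ccont_inv (fun x => x)); [apply ccont_id|exact Hn].
Qed.
Lemma continuous_ccomp (T : UniformSpace) (f : C -> C) (g : T -> C) (t : T) :
  continuous (U := Cuni) g t -> ccont f (g t) -> continuous (U := Cuni) (fun x => f (g x)) t.
Proof. apply (@continuous_comp T Cuni Cuni g f). Qed.
Lemma continuous_RtoC (T : UniformSpace) (g : T -> R) (t : T) :
  continuous (U := R_UniformSpace) g t -> continuous (U := Cuni) (fun x => RtoC (g x)) t.
Proof.
  intros H. apply continuous_Cuni; [exact H|].
  apply continuous_const.
Qed.
Lemma continuous_cpow (T : UniformSpace) (f : T -> C) (n : nat) (t : T) :
  continuous (U := Cuni) f t -> continuous (U := Cuni) (fun x => f x ^ n) t.
Proof.
  intros H. induction n as [|n IH]; [apply continuous_const|].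
  now apply continuous_cmult.
Qed.

Lemma is_derive_slope (g : R -> R) (t l : R) :
  is_derive g t l <->
  exists s : R -> R, continuous s t /\ s t = l /\ forall x, (g x - g t = s x * (x - t))%R.
Proof.
  split.
  - intros [_ H]. specialize (H t (fun P HP => HP)).
    exists (fun x => match Req_EM_T x t with left _ => l | right _ => (g x - g t) / (x - t) end)%R.
    split; [|split].
    + apply filterlim_locally. intros e.
      assert (He2 : (0 < e/2)%R) by (generalize (cond_pos e); lra).
      specialize (H (mkposreal _ He2)).
      revert H. apply filter_imp. intros x Hx.
      destruct (Req_EM_T t t) as [_|N]; [|now elim N].
      destruct (Req_EM_T x t) as [E|N]; [apply ball_center|].
      assert (Hp : (0 < Rabs (x - t))%R) by (apply Rabs_pos_lt; lra).
      change (Rabs ((g x - g t) / (x - t) - l) < e)%R.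
      replace ((g x - g t) / (x - t) - l)%R with ((g x - g t - (x - t) * l) / (x - t))%R by (field; lra).
      unfold Rdiv. rewrite Rabs_mult, Rabs_inv.
      apply Rle_lt_trans with (e / 2)%R; [|generalize (cond_pos e); lra].
      apply (Rmult_le_reg_r (Rabs (x - t))); [exact Hp|].
      rewrite Rmult_assoc, Rinv_l, Rmult_1_r by lra. exact Hx.
    + destruct (Req_EM_T t t) as [_|N]; [reflexivity|now elim N].
    + intros x. destruct (Req_EM_T x t) as [->|N]; [ring|]. field. lra.
  - intros [s [Hs [<- H]]]. split.
    + apply (is_linear_scal_l (K := R_AbsRing)).
    + intros y Hy.
      assert (Ey : t = y) by (apply (is_filter_lim_locally_unique (K := R_AbsRing) (V := R_NormedModule)); exact Hy).
      subst y. intros e.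
      generalize (proj1 (filterlim_locally _ _) Hs e). apply filter_imp. intros x Hx.
      change (Rabs (s x - s t) < e)%R in Hx.
      change (Rabs (g x - g t - (x - t) * s t) <= e * Rabs (x - t))%R.
      rewrite H. replace (s x * (x - t) - (x - t) * s t)%R with ((s x - s t) * (x - t))%R by ring.
      rewrite Rabs_mult. apply Rmult_le_compat_r; [apply Rabs_pos|now left].
Qed.

Lemma pder_Re (g : R -> C) (t : R) (v : C) : pder g t v -> is_derive (fun x => Re (g x)) t (Re v).
Proof.
  intros [s [Hs [<- H]]]. apply is_derive_slope. exists (fun x => Re (s x)).
  split; [now apply continuous_Re_comp|split; [reflexivity|]].
  intros x. replace (Re (g x) - Re (g t))%R with (Re (g x - g t)) by (unfold Cminus; now rewrite re_plus, re_opp).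
  rewrite H. apply re_scal_r.
Qed.

Lemma pder_pair (g : R -> C) (t : R) (v : C) :
  is_derive (fun x => Re (g x)) t (Re v) -> is_derive (fun x => Im (g x)) t (Im v) -> pder g t v.
Proof.
  intros [s1 [C1 [E1 H1]]]%is_derive_slope [s2 [C2 [E2 H2]]]%is_derive_slope.
  exists (fun x => (s1 x, s2 x)). split; [now apply continuous_Cuni|split].
  - rewrite E1, E2. now destruct v.
  - intros x. apply injective_projections; unfold Cminus, Cplus, Copp, Cmult, RtoC; simpl;
     [specialize (H1 x)|specialize (H2 x)]; unfold Re, Im in *; simpl in *; nra.
Qed.

Lemma pder_comp (f : C -> C) (g : R -> C) (t : R) (l v : C) :
  is_cderive f (g t) l -> pder g t v -> pder (fun x => f (g x)) t (l * v).
Proof.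
  intros [s [Hs [<- H]]]%is_cderive_slope [k [Hk [<- E]]].
  exists (fun x => s (g x) * k x). split; [|split; [reflexivity|]].
  - apply continuous_cmult; [|exact Hk].
    apply continuous_ccomp; [|exact Hs].
    assert (E' : forall x, k x * RtoC (x - t) + g t = g x) by (intros x; rewrite <- E; ring).
    apply (continuous_ext (U := Cuni) (fun x => k x * RtoC (x - t) + g t)).
    + exact E'.
    + apply continuous_cplus; [apply continuous_cmult; [exact Hk|]|apply continuous_const].
      apply continuous_RtoC. apply (continuous_minus (fun x : R => x) (fun _ : R => t)); [apply continuous_id|apply continuous_const].
  - intros x. rewrite H, E. ring.
Qed.

Lemma Ci_sqr : Ci * Ci = - (1).
Proof. apply injective_projections; simpl; ring. Qed.

Definition cis (t : R) : C := (cos t, sin t).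

Lemma cis_pder (t : R) : pder cis t (Ci * cis t).
Proof.
  apply pder_pair; unfold cis, Ci, Cmult, Re, Im; simpl.
  - evar_last; [apply is_derive_Reals, derivable_pt_lim_cos|ring].
  - evar_last; [apply is_derive_Reals, derivable_pt_lim_sin|ring].
Qed.
Lemma cis_pcont (t : R) : pcont cis t.
Proof.
  apply continuous_Cuni; unfold cis, Re, Im; simpl.
  - apply continuity_pt_filterlim, continuity_cos.
  - apply continuity_pt_filterlim, continuity_sin.
Qed.
Lemma Cmod_cis (t : R) : Cmod (cis t) = 1%R.
Proof.
  unfold Cmod, cis. rewrite <- sqrt_1. f_equal. generalize (sin2_cos2 t). unfold Rsqr. simpl. intros H.
  rewrite !Rmult_1_r, Rplus_comm. exact H.
Qed.

(** Taken by components, so that the real theory of [RInt] applies to each of them. *)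
Definition cint (g : R -> C) : C :=
  (RInt (fun t => Re (g t)) 0 (2 * PI), RInt (fun t => Im (g t)) 0 (2 * PI)).

Definition pcontinuous (g : R -> C) : Prop := forall t, pcont g t.

Lemma continuous_Im_comp (T : UniformSpace) (g : T -> C) (t : T) :
  continuous (U := Cuni) g t -> continuous (U := R_UniformSpace) (fun x => Im (g x)) t.
Proof.
  intros H. apply (continuous_ext (U := R_UniformSpace) (fun x => Re (- Ci * g x))).
  - intros x. destruct (g x). unfold Re, Im, Ci; simpl. ring.
  - apply continuous_Re_comp, continuous_cmult; [apply continuous_const|exact H].
Qed.

Lemma ex_RInt_Re (g : R -> C) (a b : R) : pcontinuous g -> ex_RInt (fun t => Re (g t)) a b.
Proof. intros H. apply (ex_RInt_continuous (V := R_CompleteNormedModule)). intros. apply continuous_Re_comp, H. Qed.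
Lemma ex_RInt_Im (g : R -> C) (a b : R) : pcontinuous g -> ex_RInt (fun t => Im (g t)) a b.
Proof. intros H. apply (ex_RInt_continuous (V := R_CompleteNormedModule)). intros. apply continuous_Im_comp, H. Qed.

Lemma cint_plus (g h : R -> C) : pcontinuous g -> pcontinuous h ->
  cint (fun t => g t + h t) = cint g + cint h.
Proof.
  intros Hg Hh. unfold cint. apply injective_projections; simpl fst; simpl snd.
  - rewrite <- (RInt_plus (V := R_CompleteNormedModule)) by now apply ex_RInt_Re. reflexivity.
  - rewrite <- (RInt_plus (V := R_CompleteNormedModule)) by now apply ex_RInt_Im. reflexivity.
Qed.

Lemma cint_scal (c : C) (g : R -> C) : pcontinuous g -> cint (fun t => c * g t) = c * cint g.
Proof.
  intros Hg. unfold cint. apply injective_projections; simpl fst; simpl snd.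
  - etransitivity. 
    + apply RInt_ext. intros x _. apply re_mult.
    + rewrite (RInt_minus (V := R_CompleteNormedModule) (fun t => Re c * Re (g t)) (fun t => Im c * Im (g t)))%R.
      * rewrite (RInt_scal (V := R_CompleteNormedModule) (fun t => Re (g t))) by now apply ex_RInt_Re.
        rewrite (RInt_scal (V := R_CompleteNormedModule) (fun t => Im (g t))) by now apply ex_RInt_Im. reflexivity.
      * apply (ex_RInt_scal (V := R_CompleteNormedModule) (fun t => Re (g t))). now apply ex_RInt_Re.
      * apply (ex_RInt_scal (V := R_CompleteNormedModule) (fun t => Im (g t))). now apply ex_RInt_Im.
  - etransitivity. 
    + apply RInt_ext. intros x _. apply im_mult.
    + rewrite (RInt_plus (V := R_CompleteNormedModule) (fun t => Re c * Im (g t)) (fun t => Im c * Re (g t)))%R.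
      * rewrite (RInt_scal (V := R_CompleteNormedModule) (fun t => Re (g t))) by now apply ex_RInt_Re.
        rewrite (RInt_scal (V := R_CompleteNormedModule) (fun t => Im (g t))) by now apply ex_RInt_Im. reflexivity.
      * apply (ex_RInt_scal (V := R_CompleteNormedModule) (fun t => Im (g t))). now apply ex_RInt_Im.
      * apply (ex_RInt_scal (V := R_CompleteNormedModule) (fun t => Re (g t))). now apply ex_RInt_Re.
Qed.

Lemma cint_ext (g h : R -> C) : (forall t, g t = h t) -> cint g = cint h.
Proof. intros H. unfold cint. f_equal; apply RInt_ext; intros; now rewrite H. Qed.

(** The constant is [4 PI] instead of [2 PI] because the two components are bounded separately; only
    its finiteness matters later. *)
Lemma cint_bound (g : R -> C) (M : R) :
  pcontinuous g -> (forall t, (0 <= t <= 2 * PI)%R -> (Cmod (g t) <= M)%R) -> (Cmod (cint g) <= 4 * PI * M)%R.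
Proof.
  intros Hg HM. assert (HP := PI_RGT_0).
  assert (Hc : forall w, w = RtoC (fst w) + Ci * RtoC (snd w)).
  { intros [u v]. apply injective_projections; simpl; ring. }
  rewrite (Hc (cint g)). eapply Rle_trans; [apply Cmod_triangle|].
  rewrite Cmod_mult, Cmod_Ci, !Cmod_R. unfold cint; simpl fst; simpl snd.
  assert (H1 : (Rabs (RInt (fun t => Re (g t)) 0 (2 * PI)) <= (2 * PI - 0) * M)%R).
  { apply abs_RInt_le_const; [lra|now apply ex_RInt_Re|].
    intros t Ht. eapply Rle_trans; [apply re_le_Cmod|now apply HM]. }
  assert (H2 : (Rabs (RInt (fun t => Im (g t)) 0 (2 * PI)) <= (2 * PI - 0) * M)%R).
  { apply abs_RInt_le_const; [lra|now apply ex_RInt_Im|].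
    intros t Ht. eapply Rle_trans; [|apply (HM t Ht)].
    assert (Rm := Rmax_Cmod (g t)). eapply Rle_trans; [apply Rmax_r|exact Rm]. }
  lra.
Qed.

(** An exact integrand over a closed path. Real parts suffice: imaginary parts are reached by
    multiplying the integrand by [- Ci]. *)
Lemma RInt_Re_pder (G g : R -> C) :
  (forall t, pder G t (g t)) -> pcontinuous g -> G (2 * PI)%R = G 0%R ->
  RInt (fun t => Re (g t)) 0 (2 * PI) = 0%R.
Proof.
  intros HG Hg E. apply is_RInt_unique.
  evar_last.
  - apply (is_RInt_derive (V := R_CompleteNormedModule) (fun t => Re (G t))).
    + intros t _. apply pder_Re, HG.
    + intros t _. apply continuous_Re_comp, Hg.
  - rewrite E. apply (minus_eq_zero (G := R_AbelianGroup)).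
Qed.

Lemma cis_2PI : cis (2 * PI) = cis 0.
Proof. unfold cis. now rewrite cos_2PI, sin_2PI, cos_0, sin_0. Qed.

(** * Cauchy's formula *)

Lemma cis_circle_ne (rho t : R) (z : C) : (Cmod z < rho)%R -> RtoC rho * cis t - z <> 0.
Proof.
  intros Hz E. assert (H : z = RtoC rho * cis t) by (symmetry; apply Ceq_minus; exact E).
  assert (H1 : (0 < rho)%R) by (generalize (Cmod_ge_0 z); lra).
  rewrite H, Cmod_mult, Cmod_cis, Cmod_R, Rabs_pos_eq in Hz; lra.
Qed.

(** The parameter [x] may leave [[0, 1]], hence the absolute values: the derivative in [x] is also
    taken at the endpoints and needs room on both sides. *)
Lemma Cmod_homotopy (rho t x : R) (z : C) : (Cmod z <= rho)%R ->
  (Cmod (z + RtoC x * (RtoC rho * cis t - z)) <= (Rabs (1 - x) + Rabs x) * rho)%R.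
Proof.
  intros Hz. assert (H0 := Cmod_ge_0 z).
  replace (z + RtoC x * (RtoC rho * cis t - z)) with (RtoC (1 - x) * z + RtoC x * (RtoC rho * cis t))
    by (rewrite RtoC_minus; ring).
  eapply Rle_trans; [apply Cmod_triangle|].
  rewrite !Cmod_mult, Cmod_cis, !Cmod_R, (Rabs_pos_eq rho) by lra.
  generalize (Rabs_pos (1 - x)) (Rabs_pos x). nra.
Qed.

Lemma pcont_circle (rho t : R) (z : C) : pcont (fun t => RtoC rho * cis t - z) t.
Proof.
  apply continuous_cminus; [|apply continuous_const].
  apply continuous_cmult; [apply continuous_const|apply cis_pcont].
Qed.

Lemma pder_circle (f : C -> C) (a b l : C) (t : R) :
  is_cderive f (a + b * cis t) l -> pder (fun t => f (a + b * cis t)) t (l * (b * (Ci * cis t))).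
Proof.
  intros Hf. apply (pder_comp f (fun t => a + b * cis t)); [exact Hf|].
  apply (pder_comp (fun x => a + b * x) cis); [|apply cis_pder].
  apply is_cderive_affine.
Qed.

(** [f (z + x (zeta - z)) zeta / (zeta - z)] is [f] at [x = 1] and constant [f z] at [x = 0], up to the
    kernel; the [x]-derivative of its integral over the circle is the integral of an exact form. *)
Lemma cauchy_homotopy (f f' : C -> C) (r rho : R) (z : C) :
  (forall x, (Cmod x < r)%R -> is_cderive f x (f' x) /\ ccont f' x) ->
  (Cmod z < rho)%R -> (rho < r)%R ->
  RInt (fun t => Re (f (RtoC rho * cis t) * (RtoC rho * cis t / (RtoC rho * cis t - z)))) 0 (2 * PI) =
  RInt (fun t => Re (f z * (RtoC rho * cis t / (RtoC rho * cis t - z)))) 0 (2 * PI).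
Proof.
  intros Hf Hz Hrho. assert (Hz0 := Cmod_ge_0 z).
  set (zeta := fun t => RtoC rho * cis t).
  set (w := fun x t => z + RtoC x * (zeta t - z)).
  set (u := fun x t => Re (f (w x t) * (zeta t / (zeta t - z)))).
  set (du := fun x t => Re (f' (w x t) * zeta t)).
  assert (Hne : forall t, zeta t - z <> 0) by (intros; now apply cis_circle_ne).
  (* With this margin [(1 + 2 eta) rho] is the midpoint of [rho] and [r], so the homotopy stays
     inside the ball for [x] in [[- eta, 1 + eta]]. *)
  set (eta := ((r - rho) / (4 * rho))%R).
  assert (Heta : (0 < eta)%R) by (apply Rdiv_lt_0_compat; lra).
  assert (Hw : forall x t, (- eta <= x <= 1 + eta)%R -> (Cmod (w x t) < r)%R).
  { intros x t Hx. eapply Rle_lt_trans; [apply Cmod_homotopy; lra|].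
    apply Rle_lt_trans with ((1 + 2 * eta) * rho)%R.
    - apply Rmult_le_compat_r; [lra|].
      unfold Rabs; destruct (Rcase_abs (1 - x)), (Rcase_abs x); lra.
    - unfold eta. replace ((1 + 2 * ((r - rho) / (4 * rho))) * rho)%R with (rho + (r - rho) / 2)%R by (field; lra). lra. }
  assert (Hdu : forall x t, (- eta <= x <= 1 + eta)%R -> is_derive (fun x => u x t) x (du x t)).
  { intros x t Hx. unfold u, du.
    replace (f' (w x t) * zeta t) with (f' (w x t) * (zeta t - z) * (zeta t / (zeta t - z))) by (field; auto).
    apply (pder_Re (fun x => f (w x t) * (zeta t / (zeta t - z)))).
    assert (Hp : pder (fun x => w x t) x (zeta t - z)).
    { exists (fun _ => zeta t - z). split; [apply continuous_const|split; [reflexivity|]].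
      intros y. unfold w. rewrite RtoC_minus. ring. }
    rewrite Cmult_comm.
    replace (zeta t / (zeta t - z) * (f' (w x t) * (zeta t - z))) with
      ((f' (w x t) * (zeta t / (zeta t - z)) + f (w x t) * 0) * (zeta t - z)) by ring.
    apply (pder_comp (fun y => f y * (zeta t / (zeta t - z))) (fun x => w x t)) with (2 := Hp).
    apply (is_cderive_mult f (fun _ => zeta t / (zeta t - z))); [|apply is_cderive_const].
    now apply Hf, Hw. }
  assert (Hloc : forall x, (0 <= x <= 1)%R -> locally x (fun y => (- eta <= y <= 1 + eta)%R)).
  { intros x Hx. exists (mkposreal eta Heta). intros y Hy.
    change (Rabs (y - x) < eta)%R in Hy. apply Rabs_def2 in Hy. lra. }
  assert (Hcz : forall t, pcont zeta t).
  { intros t. apply continuous_cmult; [apply continuous_const|apply cis_pcont]. }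
  assert (Hcw : forall x t, pcont (w x) t).
  { intros x t. apply continuous_cplus; [apply continuous_const|].
    apply continuous_cmult; [apply continuous_const|]. apply pcont_circle. }
  assert (Hcu : forall x, (- eta <= x <= 1 + eta)%R -> pcontinuous (fun t => f (w x t) * (zeta t / (zeta t - z)))).
  { intros x Hx t. apply continuous_cmult.
    - apply continuous_ccomp; [apply Hcw|]. eapply is_cderive_cont. now apply Hf, Hw.
    - apply continuous_cmult; [apply Hcz|]. apply continuous_cinv; [apply pcont_circle|apply Hne]. }
  assert (HD : forall x, (0 <= x <= 1)%R ->
     is_derive (fun x => RInt (fun t => u x t) 0 (2 * PI)) x 0%R).
  { intros x Hx.
    evar_last.
    - apply (is_derive_RInt_param u).
      + generalize (Hloc x Hx). apply filter_imp. intros y Hy t _. exists (du y t). now apply Hdu.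
      + intros t _.
        apply (continuity_2d_pt_ext_loc du).
        { destruct (Hloc x Hx) as [d Hd]. exists d. intros p q Hp _. symmetry. apply is_derive_unique, Hdu, Hd, Hp. }
        apply continuity_2d_pt_filterlim.
        apply (continuous_Re_comp (prod_UniformSpace R_UniformSpace R_UniformSpace) (fun p => f' (w (fst p) (snd p)) * zeta (snd p)) (x, t)).
        assert (Hz2 : continuous (T := prod_UniformSpace R_UniformSpace R_UniformSpace) (U := Cuni) (fun p => zeta (snd p)) (x, t)).
        { apply (@continuous_comp _ _ Cuni (fun p : prod_UniformSpace R_UniformSpace R_UniformSpace => snd p) zeta); [apply continuous_snd|apply Hcz]. }
        apply continuous_cmult; [|exact Hz2].
        apply (continuous_ccomp _ f' (fun p => w (fst p) (snd p))).
        * unfold w. apply continuous_cplus; [apply continuous_const|].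
          apply continuous_cmult; [apply continuous_RtoC, continuous_fst|].
          apply continuous_cminus; [exact Hz2|apply continuous_const].
        * simpl. apply Hf, Hw. lra.
      + generalize (Hloc x Hx). apply filter_imp. intros y Hy. apply ex_RInt_Re. now apply Hcu.
    - rewrite (RInt_ext _ (fun t => du x t)).
      2:{ intros t _. apply is_derive_unique, Hdu. lra. }
      (* In the variable [t], [f' (w x t) * zeta t] has the antiderivative [- Ci / x * f (w x t)].
         This fails at [x = 0], where [w] is constant and [- Ci * f' z * zeta t] serves. *)
      destruct (Req_dec x 0) as [->|Nx].
      + apply (RInt_Re_pder (fun t => f' z * (- Ci * zeta t))).
        * intros t. replace (w 0 t) with z by (unfold w; ring).
          assert (H := pder_circle (fun y => f' z * y) 0 (- Ci * RtoC rho) (f' z) t).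
          replace (f' z * zeta t) with (f' z * (- Ci * RtoC rho * (Ci * cis t))).
          2:{ replace (f' z * (- Ci * RtoC rho * (Ci * cis t))) with ((- (Ci * Ci)) * (f' z * (RtoC rho * cis t))) by ring.
              rewrite Ci_sqr. unfold zeta. ring. }
          assert (E : (fun t => f' z * (0 + - Ci * RtoC rho * cis t)) = (fun t => f' z * (- Ci * zeta t))).
          { apply functional_extensionality. intros s. unfold zeta. ring. }
          rewrite <- E. apply H.
          apply is_cderive_linear.
        * intros t. replace (fun t => f' (w 0 t) * zeta t) with (fun t => f' z * zeta t).
          -- apply continuous_cmult; [apply continuous_const|apply Hcz].
          -- apply functional_extensionality. intros s. f_equal. f_equal. unfold w. ring.
        * unfold zeta. now rewrite cis_2PI.
      + assert (Nx' : RtoC x <> 0) by (intro E; apply Nx, RtoC_inj, E).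
        apply (RInt_Re_pder (fun t => - Ci / RtoC x * f ((1 - RtoC x) * z + RtoC x * RtoC rho * cis t))).
        * intros t.
          assert (Ew : w x t = (1 - RtoC x) * z + RtoC x * RtoC rho * cis t) by (unfold w, zeta; ring).
          replace (f' (w x t) * zeta t) with (- Ci / RtoC x * f' (w x t) * (RtoC x * RtoC rho * (Ci * cis t))).
          2:{ replace (- Ci / RtoC x * f' (w x t) * (RtoC x * RtoC rho * (Ci * cis t)))
                with ((- (Ci * Ci)) * (f' (w x t) * (RtoC rho * cis t))) by (field; exact Nx').
              rewrite Ci_sqr. unfold zeta. ring. }
          apply (pder_circle (fun y => - Ci / RtoC x * f y)). rewrite <- Ew.
          apply is_cderive_scal; apply Hf, Hw; lra.
        * intros t. apply continuous_cmult; [|apply Hcz].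
          apply continuous_ccomp; [apply Hcw|]. apply Hf, Hw. lra.
        * now rewrite cis_2PI. }
  assert (H := eq_is_derive (fun x => RInt (fun t => u x t) 0 (2 * PI)) 0 1 HD Rlt_0_1).
  simpl in H. transitivity (RInt (fun t => u 1%R t) 0 (2 * PI)); [|rewrite <- H]; apply RInt_ext; intros t _; unfold u.
  - replace (w 1%R t) with (zeta t) by (unfold w; ring). reflexivity.
  - replace (w 0%R t) with z by (unfold w; ring). reflexivity.
Qed.

Lemma continuous_Cmod_comp (T : UniformSpace) (g : T -> C) (t : T) :
  continuous (U := Cuni) g t -> continuous (U := R_UniformSpace) (fun x => Cmod (g x)) t.
Proof.
  intros H. apply (filterlim_comp _ _ _ g Cmod _ _ _ H).
  apply (filterlim_norm (K := C_AbsRing) (V := AbsRing_NormedModule C_AbsRing)).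
Qed.

Lemma pcontinuous_bounded (g : R -> C) :
  pcontinuous g -> exists M, forall t, (0 <= t <= 2 * PI)%R -> (Cmod (g t) <= M)%R.
Proof.
  intros Hg.
  destruct (bounded_continuity (V := R_NormedModule) (fun t => Cmod (g t)) 0 (2 * PI)) as [M HM].
  { intros t _. apply continuous_Cmod_comp, Hg. }
  exists M. intros t Ht. specialize (HM t Ht). left.
  eapply Rle_lt_trans; [apply Rle_abs|exact HM].
Qed.

(** The kernel [K = zeta / (zeta - z)] satisfies [K = 1 + (z / zeta) K]. Iterating this under the
    integral gives the geometric series with the explicit remainder [z^(n+1) J (n+1)], which tends
    to 0 since [|z| < rho]; this replaces an interchange of sum and integral. *)
Lemma cint_kernel_series (G : R -> C) (rho : R) (z : C) :
  pcontinuous G -> (Cmod z < rho)%R ->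
  cseries (fun n => z ^ n * cint (fun t => G t * (/ (RtoC rho * cis t)) ^ n))
    (cint (fun t => G t * (RtoC rho * cis t / (RtoC rho * cis t - z)))).
Proof.
  intros HG Hz. assert (Hz0 := Cmod_ge_0 z).
  set (zeta := fun t => RtoC rho * cis t).
  set (K := fun t => zeta t / (zeta t - z)).
  assert (Hne : forall t, zeta t - z <> 0) by (intros; now apply cis_circle_ne).
  assert (Mz : forall t, Cmod (zeta t) = rho).
  { intros t. unfold zeta. rewrite Cmod_mult, Cmod_cis, Cmod_R, Rabs_pos_eq; lra. }
  assert (Hz1 : forall t, zeta t <> 0).
  { intros t E. generalize (Mz t). rewrite E, Cmod_0. lra. }
  assert (Hcz : forall t, pcont zeta t).
  { intros t. apply continuous_cmult; [apply continuous_const|apply cis_pcont]. }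
  assert (HK : forall t, pcont K t).
  { intros t. apply continuous_cmult; [apply Hcz|]. apply continuous_cinv; [apply pcont_circle|apply Hne]. }
  assert (Hpow : forall n t, pcont (fun t => (/ zeta t) ^ n) t).
  { intros n t. apply continuous_cpow, continuous_cinv; auto. }
  assert (HGn : forall n, pcontinuous (fun t => G t * (/ zeta t) ^ n)).
  { intros n t. apply continuous_cmult; [apply HG|apply Hpow]. }
  assert (HGK : forall n, pcontinuous (fun t => G t * (/ zeta t) ^ n * K t)).
  { intros n t. apply continuous_cmult; [apply HGn|apply HK]. }
  set (I := fun n => cint (fun t => G t * (/ zeta t) ^ n)).
  set (J := fun n => cint (fun t => G t * (/ zeta t) ^ n * K t)).
  assert (Hstep : forall n, J n = I n + z * J (S n)).
  { intros n. unfold I, J. rewrite <- cint_scal.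
    2:{ apply HGK. }
    rewrite <- cint_plus.
    - apply cint_ext. intros t. unfold K. rewrite Cpow_S. field. auto.
    - apply HGn.
    - intros t. apply continuous_cmult; [apply continuous_const|apply HGK]. }
  assert (Hsum : forall n, csum (fun n => z ^ n * I n) n - J 0%nat = - (z ^ S n * J (S n))).
  { intros n. induction n as [|n IH].
    - rewrite sum_O, (Hstep 0%nat). apply (eq_trans (y := z ^ 0 * I 0%nat - (I 0%nat + z * J 1%nat))); [reflexivity|simpl; ring].
    - rewrite sum_Sn.
      transitivity ((csum (fun n => z ^ n * I n) n - J 0%nat) + z ^ S n * I (S n)).
      + generalize (csum (fun n => z ^ n * I n) n). intros s.
        apply (eq_trans (y := (s + z ^ S n * I (S n))%C - J 0%nat)); [reflexivity|ring].
      + rewrite IH, (Hstep (S n)). rewrite !Cpow_S. ring. }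
  destruct (pcontinuous_bounded (fun t => G t * K t)) as [M HM].
  { intros t. apply continuous_cmult; auto. }
  assert (HM0 : (0 <= M)%R).
  { eapply Rle_trans; [apply Cmod_ge_0|]. apply (HM 0%R). generalize PI_RGT_0. lra. }
  assert (HJ : forall n, (Cmod (z ^ n * J n) <= 4 * PI * M * (Cmod z / rho) ^ n)%R).
  { intros n. rewrite Cmod_mult, Cmod_pow.
    assert (Hb : (Cmod (J n) <= 4 * PI * (M * (/ rho) ^ n))%R).
    { apply cint_bound.
      - apply HGK.
      - intros t Ht. replace (G t * (/ zeta t) ^ n * K t) with (G t * K t * (/ zeta t) ^ n) by ring.
        rewrite Cmod_mult, Cmod_pow, Cmod_inv, Mz by auto.
        apply Rmult_le_compat_r; [apply pow_le; left; apply Rinv_0_lt_compat; lra|now apply HM]. }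
    unfold Rdiv. rewrite Rpow_mult_distr.
    assert (Hp := pow_le (Cmod z) n Hz0). nra. }
  assert (EJ : cint (fun t => G t * (RtoC rho * cis t / (RtoC rho * cis t - z))) = J 0%nat).
  { apply cint_ext. intros t. unfold K, zeta. simpl. ring. }
  rewrite EJ.
  apply cseries_eps. intros e He.
  assert (Hq : is_lim_seq (fun n => 4 * PI * M * (Cmod z / rho) ^ n)%R 0%R).
  { replace (Finite 0) with (Rbar_mult (4 * PI * M)%R 0%R) by (simpl; f_equal; ring).
    apply is_lim_seq_scal_l, is_lim_seq_geom.
    rewrite Rabs_pos_eq by (apply Rdiv_le_0_compat; lra).
    apply (Rmult_lt_reg_r rho); [lra|]. unfold Rdiv. rewrite Rmult_assoc, Rinv_l; lra. }
  destruct (proj2 (is_lim_seq_spec _ _) Hq (mkposreal e He)) as [N HN].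
  exists N. intros n Hn. change (Cmod (csum (fun n => z ^ n * I n) n - J 0%nat) < e)%R. rewrite Hsum, Cmod_opp.
  eapply Rle_lt_trans; [apply HJ|].
  specialize (HN (S n) ltac:(lia)). simpl in HN. rewrite Rminus_0_r in HN.
  eapply Rle_lt_trans; [apply Rle_abs|exact HN].
Qed.

(** Multiplication by [- Ci] turns imaginary parts into real ones, so a real-part identity applied
    to both [f] and [- Ci * f] yields the complex one. *)
Lemma cint_eq_Re (g h : R -> C) :
  RInt (fun t => Re (g t)) 0 (2 * PI) = RInt (fun t => Re (h t)) 0 (2 * PI) ->
  RInt (fun t => Re (- Ci * g t)) 0 (2 * PI) = RInt (fun t => Re (- Ci * h t)) 0 (2 * PI) ->
  cint g = cint h.
Proof.
  intros H1 H2.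
  assert (E : forall w, Re (- Ci * w) = Im w) by (intros w; unfold Re, Im, Ci; simpl; ring).
  unfold cint. f_equal; [exact H1|].
  rewrite (RInt_ext _ (fun t => Im (g t))) in H2 by (intros; apply E).
  rewrite (RInt_ext (fun t => Re _) (fun t => Im (h t))) in H2 by (intros; apply E).
  exact H2.
Qed.

(** The integrand is exact: [Ci / (n+1) * zeta^-(n+1)] is an antiderivative in [t]. A spare factor
    [c], taken to be [1] and [- Ci], yields the two components. *)
Lemma cint_inv_pow (rho : R) (n : nat) : (0 < rho)%R -> cint (fun t => (/ (RtoC rho * cis t)) ^ S n) = 0.
Proof.
  intros Hrho.
  assert (Hz1 : forall t, RtoC rho * cis t <> 0).
  { intros t E. assert (H : Cmod (RtoC rho * cis t) = rho) by (rewrite Cmod_mult, Cmod_cis, Cmod_R, Rabs_pos_eq; lra).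
    rewrite E, Cmod_0 in H. lra. }
  assert (Hc : forall c, pcontinuous (fun t => c * (/ (RtoC rho * cis t)) ^ S n)).
  { intros c t. apply continuous_cmult; [apply continuous_const|]. apply continuous_cpow, continuous_cinv; auto.
    apply continuous_cmult; [apply continuous_const|apply cis_pcont]. }
  assert (Hd : forall (k : nat) (x : C), x <> 0 -> is_cderive (fun y => (/ y) ^ k) x (- RtoC (INR k) * (/ x) ^ S k)).
  { intros k x Hx. induction k as [|k IH].
    - eapply is_cderive_eq; [apply (is_cderive_const 1)|]. simpl. ring.
    - eapply is_cderive_eq; [apply (is_cderive_mult (fun y => / y)); [apply (is_cderive_inv (fun y => y)); [apply is_cderive_id|exact Hx]|exact IH]|].
      apply (eq_trans (y := - (1) / (x * x) * (/ x) ^ k + / x * (- RtoC (INR k) * (/ x) ^ S k))); [reflexivity|].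
      rewrite S_INR, RtoC_plus, !Cpow_S. field. exact Hx. }
  assert (HI : RtoC (INR (S n)) <> 0).
  { intro E. apply RtoC_inj in E. generalize (lt_0_INR (S n) ltac:(lia)). lra. }
  assert (H : forall c, RInt (fun t => Re (c * (/ (RtoC rho * cis t)) ^ S n)) 0 (2 * PI) = 0%R).
  { intros c. 
    apply (RInt_Re_pder (fun t => c * Ci / RtoC (INR (S n)) * (/ (0 + RtoC rho * cis t)) ^ S n)).
    - intros t.
      assert (E0 : 0 + RtoC rho * cis t = RtoC rho * cis t) by ring.
      replace (c * (/ (RtoC rho * cis t)) ^ S n) with
       (c * Ci / RtoC (INR (S n)) * (- RtoC (INR (S n)) * (/ (0 + RtoC rho * cis t)) ^ S (S n)) * (RtoC rho * (Ci * cis t))).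
      + apply (pder_circle (fun y => c * Ci / RtoC (INR (S n)) * (/ y) ^ S n)).
        apply is_cderive_scal; apply Hd; rewrite E0; apply Hz1.
      + rewrite E0, (Cpow_S _ (S n)).
        assert (Hr : RtoC rho <> 0) by (intro E; apply RtoC_inj in E; lra).
        assert (Hs : cis t <> 0) by (intro E; apply (Hz1 t); rewrite E; ring).
        replace (c * Ci / RtoC (INR (S n)) * (- RtoC (INR (S n)) * (/ (RtoC rho * cis t) * (/ (RtoC rho * cis t)) ^ S n)) * (RtoC rho * (Ci * cis t)))
          with (- (Ci * Ci) * (c * (/ (RtoC rho * cis t)) ^ S n)) by (field; auto).
        rewrite Ci_sqr. ring.
    - apply Hc.
    - now rewrite cis_2PI. }
  assert (H1 := H 1). assert (H2 := H (- Ci)).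
  assert (E : forall w, Im w = Re (- Ci * w)) by (intros w; unfold Re, Im, Ci; simpl; ring).
  assert (E1 : RInt (fun t => Re ((/ (RtoC rho * cis t)) ^ S n)) 0 (2 * PI) = 0%R).
  { etransitivity; [|exact H1]. apply RInt_ext. intros t _. now rewrite Cmult_1_l. }
  assert (E2 : RInt (fun t => Im ((/ (RtoC rho * cis t)) ^ S n)) 0 (2 * PI) = 0%R).
  { etransitivity; [|exact H2]. apply RInt_ext. intros t _. apply E. }
  unfold cint. rewrite E1, E2. reflexivity.
Qed.

(** The kernel series is applied to both sides of Cauchy's identity. On the left it gives the
    coefficients; on the right, where [f z] is constant in [t], all terms of positive index vanish
    and the sum is [2 PI f z]. The coefficients may depend on [rho] at this stage. *)
Lemma holomorphic_power_series (f f' : C -> C) (r rho : R) :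
  (forall x, (Cmod x < r)%R -> is_cderive f x (f' x) /\ ccont f' x) ->
  (0 < rho)%R -> (rho < r)%R ->
  exists a, forall z, (Cmod z < rho)%R -> is_power_series a z (f z).
Proof.
  intros Hf Hrho0 Hrho. assert (HPI := PI_RGT_0).
  set (zeta := fun t => RtoC rho * cis t).
  assert (Hcz : forall t, pcont zeta t).
  { intros t. apply continuous_cmult; [apply continuous_const|apply cis_pcont]. }
  assert (Mz : forall t, Cmod (zeta t) = rho).
  { intros t. unfold zeta. rewrite Cmod_mult, Cmod_cis, Cmod_R, Rabs_pos_eq; lra. }
  assert (HfG : pcontinuous (fun t => f (zeta t))).
  { intros t. apply continuous_ccomp; [apply Hcz|]. eapply is_cderive_cont, Hf. rewrite Mz. lra. }
  assert (H2PI : RtoC (2 * PI) <> 0) by (intro E; apply RtoC_inj in E; lra).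
  exists (fun n => cint (fun t => f (zeta t) * (/ zeta t) ^ n) / RtoC (2 * PI)).
  intros z Hz.
  assert (S1 := cint_kernel_series (fun t => f (zeta t)) rho z HfG Hz).
  assert (S2 := cint_kernel_series (fun t => f z) rho z (fun t => continuous_const _ _) Hz).
  assert (E : cint (fun t => f (RtoC rho * cis t) * (RtoC rho * cis t / (RtoC rho * cis t - z))) =
    cint (fun t => f z * (RtoC rho * cis t / (RtoC rho * cis t - z)))).
  { apply cint_eq_Re.
    - exact (cauchy_homotopy f f' r rho z Hf Hz Hrho).
    - assert (Hf2 : forall x, (Cmod x < r)%R -> is_cderive (fun x => - Ci * f x) x (- Ci * f' x) /\ ccont (fun x => - Ci * f' x) x).
      { intros x Hx. destruct (Hf x Hx) as [A B]. split.
        - apply is_cderive_scal; exact A.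
        - apply ccont_mult; [apply ccont_const|exact B]. }
      assert (H := cauchy_homotopy _ _ r rho z Hf2 Hz Hrho).
      etransitivity; [|etransitivity; [exact H|]]; apply RInt_ext; intros t _; cbv beta; now rewrite <- Cmult_assoc. }
  unfold zeta in S1. cbv beta in S1, S2.
  rewrite E in S1.
  assert (E2 : cint (fun t => f z * (RtoC rho * cis t / (RtoC rho * cis t - z))) = f z * RtoC (2 * PI)).
  { set (l := cint _) in *. clearbody l. clear S1 E.
    assert (HP : forall n, pcontinuous (fun t => (/ (RtoC rho * cis t)) ^ n)).
    { intros n t. apply continuous_cpow, continuous_cinv; [apply Hcz|].
      intro E. generalize (Mz t). unfold zeta. rewrite E, Cmod_0. lra. }
    assert (Hs : forall n, csum (fun n => z ^ n * cint (fun t => f z * (/ (RtoC rho * cis t)) ^ n)) n = f z * RtoC (2 * PI)).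
    { intros n. induction n as [|n IH].
      - rewrite sum_O. simpl. unfold cint.
        rewrite (RInt_ext _ (fun _ => Re (f z))) by (intros; f_equal; ring).
        rewrite (RInt_ext (fun t => Im _) (fun _ => Im (f z))) by (intros; f_equal; ring).
        rewrite !RInt_const. 
        apply injective_projections; unfold Re, Im; simpl; unfold scal; simpl; unfold mult; simpl; ring.
      - rewrite sum_Sn, IH.
        rewrite (cint_scal (f z)) by apply HP. rewrite cint_inv_pow by exact Hrho0.
        apply (eq_trans (y := f z * RtoC (2 * PI) + z ^ S n * (f z * 0))); [reflexivity|ring]. }
    apply Ceq_minus. apply Cmod_eq_0. apply Rle_antisym; [|apply Cmod_ge_0].
    apply le_epsilon. intros e He. destruct (proj1 (cseries_eps _ _) S2 e He) as [N HN].
    specialize (HN N (le_n _)). rewrite Hs in HN.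
    replace (l - f z * RtoC (2 * PI)) with (- (f z * RtoC (2 * PI) - l)) by ring.
    rewrite Cmod_opp. lra. }
  rewrite E2 in S1.
  apply is_power_series_cseries.
  assert (S3 := is_series_scal (K := C_AbsRing) (V := C_NormedModule) (/ RtoC (2 * PI)) _ _ S1).
  assert (El : scal (K := C_AbsRing) (V := C_NormedModule) (/ RtoC (2 * PI)) (f z * RtoC (2 * PI)) = f z).
  { apply (eq_trans (y := / RtoC (2 * PI) * (f z * RtoC (2 * PI)))); [reflexivity|field; exact H2PI]. }
  rewrite El in S3. revert S3. apply is_series_ext. intros n. cbv beta. unfold zeta.
  apply (eq_trans (y := / RtoC (2 * PI) * (z ^ n * cint (fun t => f (RtoC rho * cis t) * (/ (RtoC rho * cis t)) ^ n)))); [reflexivity|].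
  apply (eq_trans (y := cint (fun t => f (RtoC rho * cis t) * (/ (RtoC rho * cis t)) ^ n) / RtoC (2 * PI) * z ^ n)); [field; exact H2PI|reflexivity].
Qed.

(** * Analytic functions *)

Lemma is_cderive_shift (f : C -> C) (z x l : C) :
  is_cderive f (z + x) l -> is_cderive (fun y => f (z + y)) x l.
Proof.
  intros H. eapply is_cderive_eq; [apply (is_cderive_comp f (fun y => z + y)); [exact H|]|].
  - apply is_cderive_plus; [apply is_cderive_const|apply is_cderive_id].
  - apply (eq_trans (y := l * (0 + 1))); [reflexivity|ring].
Qed.

Lemma ccont_shift (f : C -> C) (z x : C) : ccont f (z + x) -> ccont (fun y => f (z + y)) x.
Proof.
  intros H. apply (ccont_comp f (fun y => z + y)); [|exact H].
  apply ccont_plus; [apply ccont_const|apply ccont_id].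
Qed.

Lemma analytic_at_of_near (f f' : C -> C) (z : C) :
  cnear z (fun x => is_cderive f x (f' x) /\ ccont f' x) -> analytic_at f z.
Proof.
  intros [d [Hd H]]%cnear_ex.
  destruct (holomorphic_power_series (fun h => f (z + h)) (fun h => f' (z + h)) d (d / 2)) as [a Ha].
  - intros x Hx. destruct (H (z + x)) as [A B].
    { now replace (z + x - z) with x by ring. }
    split; [now apply is_cderive_shift|now apply ccont_shift].
  - lra.
  - lra.
  - exists (d / 2)%R, a. split; [lra|exact Ha].
Qed.

Lemma analytic_at_locally (f : C -> C) (z : C) : analytic_at f z -> cnear z (analytic_at f).
Proof.
  intros H. generalize (locally_locally (T := Cuni) z _ (analytic_at_near f z H)).
  apply filter_imp. intros x. apply analytic_at_of_near.
Qed.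

Lemma analytic_at_ext_loc (f g : C -> C) (z : C) :
  cnear z (fun x => f x = g x) -> analytic_at f z -> analytic_at g z.
Proof.
  intros E H. apply (analytic_at_of_near g (C_derive f)).
  generalize (filter_and _ _ (locally_locally (T := Cuni) z _ E) (analytic_at_near f z H)).
  apply filter_imp. intros x [A [B D]]. split; [|exact D].
  now apply (is_cderive_ext_loc f).
Qed.

Lemma analytic_at_const (c z : C) : analytic_at (fun _ => c) z.
Proof.
  apply (analytic_at_of_near _ (fun _ => RtoC 0)). apply filter_forall. intros x.
  split; [apply is_cderive_const|apply ccont_const].
Qed.
Lemma analytic_at_id (z : C) : analytic_at (fun x => x) z.
Proof.
  apply (analytic_at_of_near _ (fun _ => RtoC 1)). apply filter_forall. intros x.
  split; [apply is_cderive_id|apply ccont_const].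
Qed.
Lemma analytic_at_plus (f g : C -> C) (z : C) :
  analytic_at f z -> analytic_at g z -> analytic_at (fun x => f x + g x) z.
Proof.
  intros Hf Hg. apply (analytic_at_of_near _ (fun x => C_derive f x + C_derive g x)).
  generalize (filter_and _ _ (analytic_at_near f z Hf) (analytic_at_near g z Hg)).
  apply filter_imp. intros x [[A B] [D E]].
  split; [now apply is_cderive_plus|now apply ccont_plus].
Qed.
Lemma analytic_at_mult (f g : C -> C) (z : C) :
  analytic_at f z -> analytic_at g z -> analytic_at (fun x => f x * g x) z.
Proof.
  intros Hf Hg. apply (analytic_at_of_near _ (fun x => C_derive f x * g x + f x * C_derive g x)).
  generalize (filter_and _ _ (analytic_at_near f z Hf) (analytic_at_near g z Hg)).
  apply filter_imp. intros x [[A B] [D E]].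
  split; [now apply is_cderive_mult|].
  apply ccont_plus; apply ccont_mult; eauto using is_cderive_cont.
Qed.
Lemma analytic_at_opp (f : C -> C) (z : C) : analytic_at f z -> analytic_at (fun x => - f x) z.
Proof.
  intros Hf. apply (analytic_at_of_near _ (fun x => - C_derive f x)).
  generalize (analytic_at_near f z Hf).
  apply filter_imp. intros x [A B]. split; [now apply is_cderive_opp|now apply ccont_opp].
Qed.
Lemma analytic_at_minus (f g : C -> C) (z : C) :
  analytic_at f z -> analytic_at g z -> analytic_at (fun x => f x - g x) z.
Proof. intros Hf Hg. apply analytic_at_plus; [exact Hf|now apply analytic_at_opp]. Qed.
Lemma analytic_at_inv (f : C -> C) (z : C) :
  analytic_at f z -> f z <> 0 -> analytic_at (fun x => / f x) z.
Proof.
  intros Hf Hz. apply (analytic_at_of_near _ (fun x => - C_derive f x / (f x * f x))).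
  generalize (filter_and _ _ (analytic_at_near f z Hf) (ccont_ne f z 0 (analytic_at_ccont f z Hf) Hz)).
  apply filter_imp. intros x [[A B] D].
  split; [now apply is_cderive_inv|].
  assert (Cf := is_cderive_cont _ _ _ A).
  apply ccont_mult; [now apply ccont_opp|]. apply ccont_inv; [now apply ccont_mult|now apply Cmult_neq_0].
Qed.
Lemma analytic_at_div (f g : C -> C) (z : C) :
  analytic_at f z -> analytic_at g z -> g z <> 0 -> analytic_at (fun x => f x / g x) z.
Proof. intros Hf Hg Hz. apply analytic_at_mult; [exact Hf|now apply analytic_at_inv]. Qed.
Lemma analytic_at_comp (f g : C -> C) (z : C) :
  analytic_at f (g z) -> analytic_at g z -> analytic_at (fun x => f (g x)) z.
Proof.
  intros Hf Hg. apply (analytic_at_of_near _ (fun x => C_derive f (g x) * C_derive g x)).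
  assert (Cg := analytic_at_ccont g z Hg).
  assert (Hfg : cnear z (fun x => is_cderive f (g x) (C_derive f (g x)) /\ ccont (C_derive f) (g x)))
    by exact (Cg _ (analytic_at_near f (g z) Hf)).
  generalize (filter_and _ _ Hfg (analytic_at_near g z Hg)).
  apply filter_imp. intros x [[A B] [D E]].
  split; [now apply is_cderive_comp|].
  apply ccont_mult; [|exact E]. apply (ccont_comp (C_derive f) g); [eapply is_cderive_cont, D|exact B].
Qed.
Lemma analytic_at_C_derive (f : C -> C) (z : C) : analytic_at f z -> analytic_at (C_derive f) z.
Proof. intros H. now apply analytic_at_cderive. Qed.

Lemma C_derive_ext_loc (f g : C -> C) (z : C) :
  cnear z (fun x => f x = g x) -> analytic_at f z -> C_derive g z = C_derive f z.
Proof.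
  intros E H. apply is_C_derive_unique, (is_cderive_ext_loc f); [exact E|now apply analytic_at_is_cderive].
Qed.

Lemma disk_open (z : C) : disk z -> cnear z disk.
Proof.
  intros Hz. unfold disk in *. apply cnear_ex. exists (1 - Cmod z)%R. split; [lra|].
  intros x Hx. assert (H := Cmod_triangle z (x - z)). replace (z + (x - z)) with x in H by ring. lra.
Qed.
Lemma disk_0 : disk 0.
Proof. unfold disk. rewrite Cmod_0. lra. Qed.
Lemma cseries_unique (a : nat -> C) (l l' : C) : cseries a l -> cseries a l' -> l = l'.
Proof.
  intros H H'. apply Ceq_minus, Cmod_eq_0, Rle_antisym; [|apply Cmod_ge_0].
  apply le_epsilon. intros e He. rewrite Rplus_0_l.
  destruct (proj1 (cseries_eps a l) H (e/2)%R) as [N HN]; [lra|].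
  destruct (proj1 (cseries_eps a l') H' (e/2)%R) as [M HM]; [lra|].
  specialize (HN (max N M) (Nat.le_max_l _ _)). specialize (HM (max N M) (Nat.le_max_r _ _)).
  revert HN HM. generalize (csum a (max N M)). intros s HN HM. change C in s.
  replace (l - l') with ((s - l') + - (s - l)) by ring.
  eapply Rle_trans; [apply Cmod_triangle|]. rewrite Cmod_opp. lra.
Qed.

Lemma is_power_series_unique (a : nat -> C) (z l l' : C) :
  is_power_series a z l -> is_power_series a z l' -> l = l'.
Proof.
  intros H%is_power_series_cseries H'%is_power_series_cseries. exact (cseries_unique _ _ _ H H').
Qed.

Lemma is_power_series_0 (a : nat -> C) : is_power_series a 0 (a O).
Proof.
  apply is_power_series_cseries, cseries_eps. intros e He. exists O. intros n _.
  assert (E : csum (fun n => a n * 0 ^ n) n = a O).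
  { induction n as [|n IH]; [rewrite sum_O; simpl; ring|].
    rewrite sum_Sn, IH. apply (eq_trans (y := a O + a (S n) * (0 * 0 ^ n))); [reflexivity|ring]. }
  rewrite E. replace (a O - a O) with (RtoC 0) by ring. now rewrite Cmod_0.
Qed.

Lemma is_power_series_at_0 (a : nat -> C) (l : C) : is_power_series a 0 l -> l = a O.
Proof.
  intros H. exact (is_power_series_unique a 0 _ _ H (is_power_series_0 a)).
Qed.

Lemma power_series_coef_unique (f : C -> C) (r : R) (a b : nat -> C) : (0 < r)%R ->
  (forall h, (Cmod h < r)%R -> is_power_series a h (f h)) ->
  (forall h, (Cmod h < r)%R -> is_power_series b h (f h)) -> forall n, a n = b n.
Proof.
  intros Hr Ha Hb n. revert f a b Ha Hb. induction n as [|n IH]; intros f a b Ha Hb.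
  - assert (H0 : (Cmod 0 < r)%R) by now rewrite Cmod_0.
    rewrite <- (is_power_series_at_0 a _ (Ha _ H0)). apply is_power_series_at_0, Hb, H0.
  - assert (H : cps_derive a n = cps_derive b n).
    { apply (IH (C_derive (fun h => f (0 + h)))); intros h Hh.
      - destruct (is_power_series_derive (fun h => f (0 + h)) 0 r a) with (h := h) as [l [Hl Dl]]; auto.
        { intros k Hk. replace (0 + (0 + k)) with k by ring. now apply Ha. }
        replace (0 + h) with h in Dl by ring. now rewrite (is_C_derive_unique _ _ _ Dl).
      - destruct (is_power_series_derive (fun h => f (0 + h)) 0 r b) with (h := h) as [l [Hl Dl]]; auto.
        { intros k Hk. replace (0 + (0 + k)) with k by ring. now apply Hb. }
        replace (0 + h) with h in Dl by ring. now rewrite (is_C_derive_unique _ _ _ Dl). }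
    unfold cps_derive in H.
    assert (HI : RtoC (INR (S n)) <> 0).
    { intro E. apply RtoC_inj in E. generalize (lt_0_INR (S n) ltac:(lia)). lra. }
    replace (a (S n)) with (/ RtoC (INR (S n)) * (RtoC (INR (S n)) * a (S n))) by (field; exact HI).
    rewrite H. field. exact HI.
Qed.

(** The coefficients found on the ball of radius [1/2] serve everywhere: a ball reaching [z] has its
    own series, and the coefficients coincide because both series represent [f] near 0. *)
Lemma analytic_on_disk_power_series (f : C -> C) :
  analytic_on disk f -> exists a, forall z, disk z -> is_power_series a z (f z).
Proof.
  intros Hf.
  assert (Hr : forall rho, (0 < rho < 1)%R -> exists a, forall z, (Cmod z < rho)%R -> is_power_series a z (f z)).
  { intros rho Hrho. apply (holomorphic_power_series f (C_derive f) 1); try lra.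
    intros x Hx. apply (locally_singleton (T := Cuni) x), analytic_at_near, Hf, Hx. }
  destruct (Hr (1/2)%R ltac:(lra)) as [a Ha]. exists a. intros z Hz.
  unfold disk in Hz. assert (Hz0 := Cmod_ge_0 z).
  destruct (Hr ((1 + Rmax (1/2) (Cmod z)) / 2)%R) as [b Hb].
  { assert (Rmax (1/2) (Cmod z) < 1)%R by (apply Rmax_lub_lt; lra). generalize (Rmax_l (1/2) (Cmod z)). lra. }
  assert (Hm1 := Rmax_l (1/2) (Cmod z)). assert (Hm2 := Rmax_r (1/2) (Cmod z)).
  assert (Hm3 : (Rmax (1/2) (Cmod z) < 1)%R) by (apply Rmax_lub_lt; lra).
  apply is_power_series_cseries.
  apply (is_series_ext (fun n => b n * z ^ n)).
  - intros n. f_equal. symmetry. apply (power_series_coef_unique f (1/2)%R); try lra; auto.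
    intros h Hh. apply Hb. lra.
  - apply is_power_series_cseries, Hb. lra.
Qed.

(** * Difference quotients and isolated zeros *)

Definition slope (f : C -> C) (z x : C) : C :=
  match Ceq_dec x z with left _ => C_derive f z | right _ => (f x - f z) / (x - z) end.

Lemma slope_diag (f : C -> C) (z : C) : slope f z z = C_derive f z.
Proof. unfold slope. destruct (Ceq_dec z z) as [_|N]; [reflexivity|now elim N]. Qed.
Lemma slope_ne (f : C -> C) (z x : C) : x <> z -> slope f z x = (f x - f z) / (x - z).
Proof. unfold slope. destruct (Ceq_dec x z) as [E|_]; [contradiction|reflexivity]. Qed.
Lemma slope_spec (f : C -> C) (z x : C) : f x - f z = slope f z x * (x - z).
Proof.
  unfold slope. destruct (Ceq_dec x z) as [->|N]; [ring|]. field. intro E; apply N; now apply Ceq_minus.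
Qed.

Lemma slope_power_series (f : C -> C) (z : C) (r : R) (a : nat -> C) : (0 < r)%R ->
  (forall h, (Cmod h < r)%R -> is_power_series a h (f (z + h))) ->
  forall h, (Cmod h < r)%R -> is_power_series (fun n => a (S n)) h (slope f z (z + h)).
Proof.
  intros Hr Ha h Hh.
  assert (H0 : (Cmod 0 < r)%R) by now rewrite Cmod_0.
  destruct (Ceq_dec h 0) as [->|Nh].
  - replace (z + 0) with z by ring. rewrite slope_diag.
    destruct (is_power_series_derive f z r a Ha 0 H0) as [l [Hl Dl]].
    replace (z + 0) with z in Dl by ring. rewrite (is_C_derive_unique _ _ _ Dl).
    rewrite (is_power_series_at_0 _ _ Hl). 
    replace (cps_derive a 0) with (a 1%nat) by (unfold cps_derive; simpl; ring).
    apply (is_power_series_0 (fun n => a (S n))).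
  - assert (S1 := cseries_shift _ _ (proj1 (is_power_series_cseries _ _ _) (Ha h Hh))). cbv beta in S1.
    assert (E0 : f z = a O).
    { apply is_power_series_at_0. replace z with (z + 0) at 1 by ring. now apply Ha. }
    apply is_power_series_cseries.
    assert (S2 := is_series_scal (K := C_AbsRing) (V := C_NormedModule) (/ h) _ _ S1).
    assert (El : slope f z (z + h) = scal (K := C_AbsRing) (V := C_NormedModule) (/ h) (f (z + h) - a O * h ^ 0)).
    { rewrite slope_ne.
      - rewrite E0. apply (eq_trans (y := / h * (f (z + h) - a O * h ^ 0))); [|reflexivity].
        replace (z + h - z) with h by ring. simpl. field. exact Nh.
      - intro E. apply Nh. replace h with (z + h - z) by ring. rewrite E. ring. }
    rewrite El. revert S2. apply is_series_ext. intros n. cbv beta.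
    apply (eq_trans (y := / h * (a (S n) * (h * h ^ n)))); [reflexivity|].
    apply (eq_trans (y := a (S n) * h ^ n)); [field; exact Nh|reflexivity].
Qed.

(** Dividing by [x - z] shifts the series of [f] at [z] by one index, which removes the singularity
    on the diagonal. Schwarz's lemma, the four point mean and the convexity arguments all divide out
    zeros in this way. *)
Lemma analytic_at_slope (f : C -> C) (z x : C) :
  analytic_at f z -> analytic_at f x -> analytic_at (slope f z) x.
Proof.
  intros Hz Hx. destruct (Ceq_dec x z) as [->|N].
  - destruct Hz as [r [a [Hr Ha]]]. exists r, (fun n => a (S n)).
    split; [exact Hr|]. now apply slope_power_series.
  - apply (analytic_at_ext_loc (fun y => (f y - f z) / (y - z))).
    + generalize (ccont_ne (fun y => y) x z (ccont_id x) N).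
      apply filter_imp. intros y Hy. now rewrite slope_ne.
    + apply analytic_at_div.
      * apply analytic_at_minus; [exact Hx|apply analytic_at_const].
      * apply analytic_at_minus; [apply analytic_at_id|apply analytic_at_const].
      * intro E; apply N; now apply Ceq_minus.
Qed.

(** If the first nonzero coefficient has index [k], replacing [f] by its slope at [z] lowers [k] by
    one, down to a function that does not vanish at [z]. *)
Lemma analytic_at_isolated_zero (f : C -> C) (z : C) :
  analytic_at f z -> cnear z (fun x => f x = 0) \/ cnear z (fun x => x <> z -> f x <> 0).
Proof.
  intros [r [a [Hr Ha]]].
  destruct (classic (forall n, a n = 0)) as [H0|H0].
  - left. apply cnear_ex. exists r. split; [exact Hr|]. intros x Hx.
    assert (H := Ha (x - z) Hx). replace (z + (x - z)) with x in H by ring.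
    apply is_power_series_cseries in H. eapply cseries_unique; [exact H|].
    apply cseries_eps. intros e He. exists O. intros n _.
    assert (E : csum (fun n => a n * (x - z) ^ n) n = RtoC 0).
    { induction n as [|n IH]; [rewrite sum_O, H0; simpl; ring|].
      rewrite sum_Sn, IH, H0. apply (eq_trans (y := 0 + 0 * (x - z) ^ S n)); [reflexivity|ring]. }
    rewrite E. replace (0 - 0) with (RtoC 0) by ring. now rewrite Cmod_0.
  - right.
    assert (Hk : exists k, a k <> 0 /\ forall j, (j < k)%nat -> a j = 0).
    { apply not_all_ex_not in H0. destruct H0 as [n Hn].
      revert Hn. induction n as [n IH] using (well_founded_induction Wf_nat.lt_wf). intros Hn.
      destruct (classic (exists j, (j < n)%nat /\ a j <> 0)) as [[j [Hj Nj]]|N].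
      - exact (IH j Hj Nj).
      - exists n. split; [exact Hn|]. intros j Hj. apply NNPP. intros Nj. apply N. now exists j. }
    destruct Hk as [k [Hk Hj]]. clear H0. revert f a Ha Hk Hj.
    induction k as [|k IH]; intros f a Ha Hk Hj.
    + assert (E0 : f z = a O).
      { apply is_power_series_at_0. replace z with (z + 0) at 1 by ring. apply Ha. now rewrite Cmod_0. }
      assert (Hc : ccont f z) by (apply analytic_at_ccont; now exists r, a).
      assert (Hn : f z <> 0) by now rewrite E0.
      generalize (ccont_ne f z 0 Hc Hn). apply filter_imp. auto.
    + assert (E0 : f z = 0).
      { rewrite <- (Hj O) by lia. apply is_power_series_at_0. replace z with (z + 0) at 1 by ring. apply Ha. now rewrite Cmod_0. }
      assert (Hs := slope_power_series f z r a Hr Ha).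
      specialize (IH (slope f z) (fun n => a (S n)) Hs Hk).
      generalize (IH (fun j Hj' => Hj (S j) ltac:(lia))).
      apply filter_imp. intros x Hx Nx.
      replace (f x) with (f x - f z) by (rewrite E0; ring). rewrite slope_spec.
      apply Cmult_neq_0; [now apply Hx|]. intro E; apply Nx; now apply Ceq_minus.
Qed.

(** * Compactness, the maximum principle and Schwarz's lemma *)

Lemma real_bounded_cluster (u : nat -> R) (M : R) :
  (forall n, Rabs (u n) <= M)%R ->
  exists x, forall e, (0 < e)%R -> forall N, exists n, (N <= n)%nat /\ (Rabs (u n - x) < e)%R.
Proof.
  intros H.
  destruct (Bolzano_Weierstrass u _ (compact_P3 (- M) M)) as [x Hx].
  { intros n. specialize (H n). apply Rabs_le_between in H. exact H. }
  exists x. intros e He N.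
  destruct (Hx (disc x (mkposreal e He)) N) as [p [Hp Hd]].
  { exists (mkposreal e He). intros y Hy. exact Hy. }
  exists p. split; [exact Hp|]. exact Hd.
Qed.

Lemma Cmod_le_Re_Im (z : C) : (Cmod z <= Rabs (Re z) + Rabs (Im z))%R.
Proof.
  replace z with (RtoC (Re z) + Ci * RtoC (Im z)) at 1 by (apply injective_projections; unfold Re, Im; simpl; ring).
  eapply Rle_trans; [apply Cmod_triangle|]. rewrite Cmod_mult, Cmod_Ci, !Cmod_R. lra.
Qed.
Lemma im_le_Cmod (z : C) : (Rabs (Im z) <= Cmod z)%R.
Proof. eapply Rle_trans; [apply Rmax_r|apply (Rmax_Cmod z)]. Qed.
Lemma re_minus (a b : C) : Re (a - b) = (Re a - Re b)%R.
Proof. unfold Cminus. now rewrite re_plus, re_opp. Qed.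
Lemma im_minus (a b : C) : Im (a - b) = (Im a - Im b)%R.
Proof. unfold Cminus. now rewrite im_plus, im_opp. Qed.

(** Real parts come first: [phi] selects indices along which they converge to [x], and the imaginary
    parts are clustered along [phi]. *)
Lemma bounded_cluster (u : nat -> C) (M : R) :
  (forall n, Cmod (u n) <= M)%R ->
  exists z, forall e, (0 < e)%R -> forall N, exists n, (N <= n)%nat /\ (Cmod (u n - z) < e)%R.
Proof.
  intros H.
  destruct (real_bounded_cluster (fun n => Re (u n)) M) as [x Hx].
  { intros n. eapply Rle_trans; [apply re_le_Cmod|apply H]. }
  assert (Hphi : forall k, exists n, (k <= n)%nat /\ (Rabs (Re (u n) - x) < / (INR k + 1))%R).
  { intros k. apply Hx. apply Rinv_0_lt_compat. generalize (pos_INR k). lra. }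
  set (phi := fun k => proj1_sig (constructive_indefinite_description _ (Hphi k))).
  assert (Hp : forall k, (k <= phi k)%nat /\ (Rabs (Re (u (phi k)) - x) < / (INR k + 1))%R).
  { intros k. unfold phi. now destruct (constructive_indefinite_description _ (Hphi k)). }
  destruct (real_bounded_cluster (fun n => Im (u (phi n))) M) as [y Hy].
  { intros n. eapply Rle_trans; [apply im_le_Cmod|apply H]. }
  exists (x, y). intros e He N.
  destruct (archimed_cor1 (e / 2) ltac:(lra)) as [K [HK1 HK2]].
  destruct (Hy (e / 2)%R ltac:(lra) (max N K)) as [k [Hk Dk]].
  exists (phi k). destruct (Hp k) as [H1 H2]. split; [lia|].
  eapply Rle_lt_trans; [apply Cmod_le_Re_Im|].
  rewrite re_minus, im_minus. change (Re (x, y)) with x. change (Im (x, y)) with y.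
  assert (/ (INR k + 1) <= / INR K)%R.
  { apply Rinv_le_contravar; [now apply lt_0_INR|]. assert (INR K <= INR k)%R by (apply le_INR; lia). lra. }
  lra.
Qed.

Definition closed_in (S : C -> Prop) : Prop :=
  forall z, (forall e, (0 < e)%R -> exists x, S x /\ (Cmod (x - z) < e)%R) -> S z.

Lemma compact_min (S : C -> Prop) (g : C -> R) (M : R) :
  (exists z, S z) -> (forall z, S z -> (Cmod z <= M)%R) -> closed_in S ->
  (forall z, S z -> forall e, (0 < e)%R -> cnear z (fun x => S x -> (Rabs (g x - g z) < e)%R)) ->
  exists z, S z /\ forall x, S x -> (g z <= g x)%R.
Proof.
  intros [z0 Hz0] HM Hcl Hg.
  (* Used twice: with [m n = - n] it shows that [g] is bounded below, and with [m n] decreasing to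
     the infimum the cluster point is a minimum. *)
  assert (Hclu : forall m : nat -> R, (forall n, exists z, S z /\ (g z < m n)%R) -> 
    exists z, S z /\ forall e, (0 < e)%R -> forall N, exists n, (N <= n)%nat /\ (g z < m n + e)%R).
  { intros m Hm.
    set (u := fun n => proj1_sig (constructive_indefinite_description _ (Hm n))).
    assert (Hu : forall n, S (u n) /\ (g (u n) < m n)%R).
    { intros n. unfold u. now destruct (constructive_indefinite_description _ (Hm n)). }
    destruct (bounded_cluster u M) as [z Hz].
    { intros n. apply HM, Hu. }
    assert (Sz : S z).
    { apply Hcl. intros e He. destruct (Hz e He O) as [n [_ Hn]]. exists (u n). split; [apply Hu|exact Hn]. }
    exists z. split; [exact Sz|]. intros e He N.
    destruct (proj1 (cnear_ex _ _) (Hg z Sz e He)) as [d [Hd Hd']].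
    destruct (Hz d Hd N) as [n [Hn Dn]]. exists n. split; [exact Hn|].
    specialize (Hd' (u n) Dn (proj1 (Hu n))). apply Rabs_def2 in Hd'. generalize (proj2 (Hu n)). lra. }
  assert (Hb : bound (fun y => exists z, S z /\ y = (- g z)%R)).
  { apply NNPP. intros Hb.
    destruct (Hclu (fun n => - INR n)%R) as [z [_ Hz]].
    - intros n. apply NNPP. intros Hn. apply Hb. exists (INR n). intros y [z [Sz ->]].
      destruct (Rlt_le_dec (g z) (- INR n)) as [Hl|Hl]; [|lra]. elim Hn. now exists z.
    - destruct (INR_unbounded (1 - g z)) as [N HN]. 
      destruct (Hz 1%R Rlt_0_1 N) as [n [Hn Hlt]].
      assert (INR N <= INR n)%R by now apply le_INR. lra. }
  destruct (completeness _ Hb) as [m [Hm1 Hm2]].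
  { exists (- g z0)%R. now exists z0. }
  destruct (Hclu (fun n => - m + / (INR n + 1))%R) as [z [Sz Hz]].
  - intros n. apply NNPP. intros Hn.
    assert (Hi : (0 < / (INR n + 1))%R) by (apply Rinv_0_lt_compat; generalize (pos_INR n); lra).
    assert (m <= m - / (INR n + 1))%R; [|lra].
    apply Hm2. intros y [z [Sz ->]].
    destruct (Rlt_le_dec (g z) (- m + / (INR n + 1))) as [Hl|Hl]; [|lra]. elim Hn. now exists z.
  - exists z. split; [exact Sz|]. intros x Sx.
    assert (Hx : (- g x <= m)%R) by (apply Hm1; now exists x).
    apply le_epsilon. intros e He.
    destruct (archimed_cor1 (e / 2) ltac:(lra)) as [K [HK1 HK2]].
    destruct (Hz (e / 2)%R ltac:(lra) K) as [n [Hn Hlt]].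
    assert (/ (INR n + 1) <= / INR K)%R.
    { apply Rinv_le_contravar; [now apply lt_0_INR|]. assert (INR K <= INR n)%R by (apply le_INR; lia). lra. }
    lra.
Qed.

Lemma closed_ball_closed (r : R) : closed_in (fun z => (Cmod z <= r)%R).
Proof.
  intros z H. apply le_epsilon. intros e He. destruct (H e He) as [x [Hx Dx]].
  assert (Ht := Cmod_triangle x (- (x - z))). rewrite Cmod_opp in Ht.
  replace (x + - (x - z)) with z in Ht by ring. lra.
Qed.

Lemma Cmod_sub_le (x z : C) : (Rabs (Cmod x - Cmod z) <= Cmod (x - z))%R.
Proof.
  assert (H1 := Cmod_triangle z (x - z)). replace (z + (x - z)) with x in H1 by ring.
  assert (H2 := Cmod_triangle x (- (x - z))). rewrite Cmod_opp in H2. replace (x + - (x - z)) with z in H2 by ring.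
  apply Rabs_le. lra.
Qed.

Lemma Cmod_sqr (z : C) : (Cmod z * Cmod z = Re z * Re z + Im z * Im z)%R.
Proof. generalize (Cmod2_alt z). simpl. rewrite !Rmult_1_r. auto. Qed.

(** Over the four points [z + i^k t] the Taylor terms of degree 1 and 2 of [f] cancel. *)
Lemma four_point_mean (f : C -> C) (z : C) (e : R) : analytic_at f z -> (0 < e)%R ->
  exists d, (0 < d)%R /\ forall t, (0 < t < d)%R ->
   (Rabs (Re (f (z + RtoC t)%C) + Re (f (z - RtoC t)%C) + Re (f (z + Ci * RtoC t)%C)
      + Re (f (z - Ci * RtoC t)%C) - 4 * Re (f z)) <= e * (t * t))%R.
Proof.
  intros Hf He.
  assert (Hs := analytic_at_slope f z z Hf Hf).
  assert (Hs2 := analytic_at_slope _ z z Hs Hs).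
  assert (Hc := analytic_at_ccont _ _ Hs2).
  destruct (proj1 (cnear_ex _ _) (proj1 (ccont_eps _ _) Hc (e / 4)%R ltac:(lra))) as [d [Hd Hd']].
  exists d. split; [exact Hd|]. intros t Ht.
  set (s2 := slope (slope f z) z) in *.
  assert (Hexp : forall h, f (z + h) = f z + slope f z z * h + h * h * s2 (z + h)).
  { intros h. assert (E1 := slope_spec f z (z + h)). assert (E2 := slope_spec (slope f z) z (z + h)).
    fold s2 in E2. replace (z + h - z) with h in E1, E2 by ring.
    replace (f (z + h)) with (f z + (f (z + h) - f z)) by ring. rewrite E1.
    replace (slope f z (z + h)) with (slope f z z + (slope f z (z + h) - slope f z z)) by ring. rewrite E2. ring. }
  assert (Hb : forall h, Cmod h = t -> (Cmod (s2 (z + h)%C - s2 z) <= e / 4)%R).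
  { intros h Hh. left. apply Hd'. replace (z + h - z) with h by ring. lra. }
  assert (M1 : Cmod (RtoC t) = t) by (rewrite Cmod_R; apply Rabs_pos_eq; lra).
  assert (M2 : Cmod (Ci * RtoC t) = t) by (rewrite Cmod_mult, Cmod_Ci, M1; ring).
  assert (B1 := Hb (RtoC t) M1). assert (B2 := Hb (- RtoC t) ltac:(now rewrite Cmod_opp)).
  assert (B3 := Hb (Ci * RtoC t) M2). assert (B4 := Hb (- (Ci * RtoC t)) ltac:(now rewrite Cmod_opp)).
  assert (E : f (z + RtoC t) + f (z - RtoC t) + f (z + Ci * RtoC t) + f (z - Ci * RtoC t) - 4 * f z =
     RtoC t * RtoC t * ((s2 (z + RtoC t) - s2 z) + (s2 (z + - RtoC t) - s2 z) - (s2 (z + Ci * RtoC t) - s2 z) - (s2 (z + - (Ci * RtoC t)) - s2 z))).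
  { unfold Cminus at 1 2. change (z - Ci * RtoC t) with (z + - (Ci * RtoC t)).
    rewrite (Hexp (RtoC t)), (Hexp (- RtoC t)), (Hexp (Ci * RtoC t)), (Hexp (- (Ci * RtoC t))).
    replace (- (Ci * RtoC t) * - (Ci * RtoC t)) with (Ci * Ci * (RtoC t * RtoC t)) by ring.
    replace (Ci * RtoC t * (Ci * RtoC t)) with (Ci * Ci * (RtoC t * RtoC t)) by ring.
    rewrite Ci_sqr. ring. }
  replace (Re (f (z + RtoC t)%C) + Re (f (z - RtoC t)%C) + Re (f (z + Ci * RtoC t)%C) + Re (f (z - Ci * RtoC t)%C) - 4 * Re (f z))%R
    with (Re (f (z + RtoC t) + f (z - RtoC t) + f (z + Ci * RtoC t) + f (z - Ci * RtoC t) - 4 * f z)).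
  2:{ rewrite re_minus, !re_plus, re_scal_l. ring. }
  rewrite E. eapply Rle_trans; [apply re_le_Cmod|].
  rewrite Cmod_mult, Cmod_mult, M1, (Rmult_comm e). apply Rmult_le_compat_l; [nra|].
  unfold Cminus at 1 2.
  eapply Rle_trans; [apply Cmod_triangle|]. rewrite Cmod_opp.
  eapply Rle_trans; [apply Rplus_le_compat_r, Cmod_triangle|]. rewrite Cmod_opp.
  eapply Rle_trans; [apply Rplus_le_compat_r, Rplus_le_compat_r, Cmod_triangle|]. lra.
Qed.

(** Minimum principle: [Re f - e |z|^2] has no interior minimum, by the four point mean. *)
Lemma re_min_principle (f : C -> C) (r : R) :
  (forall z, (Cmod z <= r)%R -> analytic_at f z) ->
  (forall z, Cmod z = r -> (0 <= Re (f z))%R) ->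
  forall z, (Cmod z <= r)%R -> (0 <= Re (f z))%R.
Proof.
  intros Hf Hb z1 Hz1. destruct (Rle_lt_dec 0 (Re (f z1))) as [H|H]; [exact H|exfalso].
  assert (Hr : (0 <= r)%R) by (generalize (Cmod_ge_0 z1); lra).
  (* The penalty [e |z|^2] stays below [- Re (f z1)] on the ball, so [g z1] is smaller than every
     boundary value of [g] and the minimum is interior. *)
  set (e := (- Re (f z1) / (r * r + 1))%R).
  assert (He : (0 < e)%R) by (apply Rdiv_lt_0_compat; nra).
  assert (Her : (e * (r * r) < - Re (f z1))%R).
  { assert (E : (e * (r * r + 1) = - Re (f z1))%R) by (unfold e; field; nra). nra. }
  set (g := fun z => (Re (f z) - e * (Cmod z * Cmod z))%R).
  destruct (compact_min (fun z => (Cmod z <= r)%R) g r) as [z0 [Hz0 Hmin]].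
  - now exists z1.
  - auto.
  - apply closed_ball_closed.
  - intros z Hz e' He'.
    assert (Hc : continuous (T := Cuni) (U := R_UniformSpace) g z).
    { apply (continuous_minus (U := Cuni) (V := R_NormedModule) (fun x => Re (f x)) (fun x => (e * (Cmod x * Cmod x))%R)).
      - apply (continuous_Re_comp Cuni f). now apply analytic_at_ccont, Hf.
      - apply (continuous_mult (U := Cuni) (K := R_AbsRing) (fun _ => e) (fun x => (Cmod x * Cmod x)%R)); [apply continuous_const|].
        apply (continuous_mult (U := Cuni) (K := R_AbsRing) Cmod Cmod); apply (continuous_Cmod_comp Cuni (fun x => x)), ccont_id. }
    generalize (proj1 (filterlim_locally _ _) Hc (mkposreal e' He')). apply filter_imp.
    intros x Hx _. exact Hx.
  - assert (Hlt : (Cmod z0 < r)%R).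
    { destruct Hz0 as [Hl|E]; [exact Hl|exfalso].
      specialize (Hmin z1 Hz1). unfold g in Hmin. specialize (Hb z0 E). rewrite E in Hmin.
      generalize (Rmult_le_pos _ _ (Cmod_ge_0 z1) (Cmod_ge_0 z1)). intros Hp.
      assert (0 <= e * (Cmod z1 * Cmod z1))%R by nra. lra. }
    destruct (four_point_mean f z0 e (Hf z0 Hz0) He) as [d [Hd Hd']].
    set (t := (Rmin d (r - Cmod z0) / 2)%R).
    assert (Hmm : (0 < Rmin d (r - Cmod z0))%R) by (apply Rmin_pos; lra).
    assert (Ht : (0 < t < d)%R) by (unfold t; generalize (Rmin_l d (r - Cmod z0)); lra).
    assert (Ht2 : (t < r - Cmod z0)%R) by (unfold t; generalize (Rmin_r d (r - Cmod z0)); lra).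
    assert (M1 : Cmod (RtoC t) = t) by (rewrite Cmod_R; apply Rabs_pos_eq; lra).
    assert (M2 : Cmod (Ci * RtoC t) = t) by (rewrite Cmod_mult, Cmod_Ci, M1; ring).
    assert (Hin : forall h, Cmod h = t -> (g z0 <= g (z0 + h)%C)%R).
    { intros h Hh. apply Hmin. eapply Rle_trans; [apply Cmod_triangle|]. lra. }
    assert (B1 := Hin (RtoC t) M1). assert (B2 := Hin (- RtoC t) ltac:(now rewrite Cmod_opp)).
    assert (B3 := Hin (Ci * RtoC t) M2). assert (B4 := Hin (- (Ci * RtoC t)) ltac:(now rewrite Cmod_opp)).
    specialize (Hd' t Ht). apply Rabs_le_between in Hd'.
    unfold g in *. 
    (* The four points raise [|z|^2] by [4 t^2] in total, so at a minimum of [g] the sum of [Re f]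
       would rise by at least [4 e t^2], more than the allowed [e t^2]. *)
    assert (Hsq : (Cmod (z0 + RtoC t) * Cmod (z0 + RtoC t) + Cmod (z0 + - RtoC t) * Cmod (z0 + - RtoC t)
      + Cmod (z0 + Ci * RtoC t) * Cmod (z0 + Ci * RtoC t) + Cmod (z0 + - (Ci * RtoC t)) * Cmod (z0 + - (Ci * RtoC t))
      = 4 * (Cmod z0 * Cmod z0) + 4 * (t * t))%R).
    { rewrite !Cmod_sqr. unfold Re, Im; simpl. ring. }
    unfold Cminus in Hd'.
    assert (e * (t * t) > 0)%R by (apply Rmult_gt_0_compat; nra).
    nra.
Qed.

Lemma exists_unit_factor (w : C) : exists c, Cmod c = 1%R /\ c * w = RtoC (Cmod w).
Proof.
  destruct (Ceq_dec w 0) as [->|N0].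
  - exists 1. split; [apply Cmod_1|]. rewrite Cmod_0. ring.
  - assert (Hm := proj1 (Cmod_gt_0 _) N0).
    assert (Nm : RtoC (Cmod w) <> 0) by (intro E; apply RtoC_inj in E; lra).
    exists (Cconj w / RtoC (Cmod w)). split.
    + rewrite Cmod_div, Cmod_conj, Cmod_R, Rabs_pos_eq by (auto; lra). field. lra.
    + replace (Cconj w / RtoC (Cmod w) * w) with ((w * Cconj w) / RtoC (Cmod w)) by (field; exact Nm).
      rewrite <- Cmod2_conj. simpl. rewrite Rmult_1_r, RtoC_mult. field. exact Nm.
Qed.

(** A unit factor [c] makes [c * f z1] equal to [|f z1|]; the minimum principle for [M - c f] then
    bounds this number. *)
Lemma max_modulus (f : C -> C) (r M : R) :
  (forall z, (Cmod z <= r)%R -> analytic_at f z) ->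
  (forall z, Cmod z = r -> (Cmod (f z) <= M)%R) ->
  forall z, (Cmod z <= r)%R -> (Cmod (f z) <= M)%R.
Proof.
  intros Hf Hb z1 Hz1. destruct (exists_unit_factor (f z1)) as [c [Mc Ec]].
  assert (Hz : (0 <= Re (RtoC M - c * f z1))%R).
  { apply (re_min_principle (fun z => RtoC M - c * f z) r); [| |exact Hz1].
    - intros z Hz. apply analytic_at_minus; [apply analytic_at_const|].
      apply analytic_at_mult; [apply analytic_at_const|now apply Hf].
    - intros z Hz. rewrite re_minus, re_RtoC.
      assert (Hre := re_le_Cmod (c * f z)). rewrite Cmod_mult, Mc in Hre.
      generalize (Hb z Hz) (Rle_abs (Re (c * f z))). lra. }
  rewrite re_minus, re_RtoC, Ec, re_RtoC in Hz. lra.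
Qed.

(** In the absence of a zero, the maximum principle for [1 / f] would forbid a smaller modulus at
    the centre than on the circle. The lemma plays the part of Rouché's theorem in producing
    preimages. *)
Lemma min_modulus_zero (f : C -> C) (r m : R) : (0 < r)%R ->
  (forall z, (Cmod z <= r)%R -> analytic_at f z) ->
  (forall z, Cmod z = r -> (m <= Cmod (f z))%R) ->
  (Cmod (f 0) < m)%R ->
  exists z, (Cmod z < r)%R /\ f z = 0.
Proof.
  intros Hr Hf Hb H0. apply NNPP. intros Hn.
  assert (Hm : (0 < m)%R) by (generalize (Cmod_ge_0 (f 0)); lra).
  assert (Hnz : forall z, (Cmod z <= r)%R -> f z <> 0).
  { intros z [Hz|Hz] E; [apply Hn; now exists z|]. specialize (Hb z Hz). rewrite E, Cmod_0 in Hb. lra. }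
  assert (H0r : (Cmod 0 <= r)%R) by (rewrite Cmod_0; lra).
  assert (H := max_modulus (fun z => / f z) r (/ m)).
  assert (Hi : (Cmod (/ f 0) <= / m)%R).
  { apply H; [| |exact H0r].
    - intros z Hz. apply analytic_at_inv; auto.
    - intros z Hz. rewrite Cmod_inv by (apply Hnz; lra).
      apply Rinv_le_contravar; auto. }
  rewrite Cmod_inv in Hi by auto.
  assert (Hp := proj1 (Cmod_gt_0 _) (Hnz 0 H0r)).
  apply Rinv_le_contravar in Hi; [|now apply Rinv_0_lt_compat].
  rewrite !Rinv_inv in Hi. lra.
Qed.

Lemma schwarz (f : C -> C) (r M : R) :
  (forall z, (Cmod z < r)%R -> analytic_at f z) -> f 0 = 0 ->
  (forall z, (Cmod z < r)%R -> (Cmod (f z) <= M)%R) ->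
  forall z, (Cmod z < r)%R -> (r * Cmod (f z) <= M * Cmod z)%R.
Proof.
  intros Hf H0 HM z Hz. assert (Hz0 := Cmod_ge_0 z).
  assert (Hs : forall rho, (Cmod z < rho < r)%R -> (rho * Cmod (f z) <= M * Cmod z)%R).
  { intros rho Hrho.
    assert (H00 : (Cmod 0 < r)%R) by (rewrite Cmod_0; lra).
    assert (H := max_modulus (slope f 0) rho (M / rho)).
    assert (Hb : (Cmod (slope f 0 z) <= M / rho)%R).
    { apply H; [| |lra].
      - intros x Hx. apply analytic_at_slope; apply Hf; lra.
      - intros x Hx. rewrite slope_ne, H0.
        + replace ((f x - 0) / (x - 0)) with (f x / x).
          2:{ f_equal; [ring|f_equal; ring]. }
          rewrite Cmod_div, Hx.
          * apply Rmult_le_compat_r; [left; apply Rinv_0_lt_compat; lra|]. apply HM. lra.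
          * intro E; rewrite E, Cmod_0 in Hx. lra.
        + intro E; rewrite E, Cmod_0 in Hx. lra. }
    replace (f z) with (slope f 0 z * z).
    2:{ rewrite <- (Cplus_0_r z) at 2. replace (z + 0) with (z - 0) by ring. rewrite <- slope_spec, H0. ring. }
    rewrite Cmod_mult. rewrite <- Rmult_assoc. apply Rmult_le_compat_r; [exact Hz0|].
    apply (Rmult_le_compat_l rho) in Hb; [|lra].
    replace (rho * (M / rho))%R with M in Hb by (field; lra). exact Hb. }
  destruct (Rle_lt_dec (r * Cmod (f z)) (M * Cmod z)) as [H|H]; [exact H|exfalso].
  assert (Hfz := Cmod_ge_0 (f z)).
  assert (Hpos : (0 < Cmod (f z))%R).
  { destruct Hfz as [Hp|E]; [exact Hp|]. rewrite <- E in H.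
    specialize (Hs ((Cmod z + r) / 2)%R ltac:(lra)). rewrite <- E in Hs. lra. }
  (* The bound on the circle of radius [rho] fails once [rho > M |z| / |f z|]. Both entries of the
     maximum are midpoints with [r], so [rho] exceeds this quotient and [|z|] while staying below
     [r]. *)
  set (rho := Rmax ((Cmod z + r) / 2) ((r + M * Cmod z / Cmod (f z)) / 2)).
  assert (Hq : (M * Cmod z / Cmod (f z) < r)%R).
  { apply (Rmult_lt_reg_r (Cmod (f z))); [exact Hpos|]. unfold Rdiv. rewrite Rmult_assoc, Rinv_l; lra. }
  assert (H1 := Rmax_l ((Cmod z + r) / 2) ((r + M * Cmod z / Cmod (f z)) / 2)).
  assert (H2 := Rmax_r ((Cmod z + r) / 2) ((r + M * Cmod z / Cmod (f z)) / 2)).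
  fold rho in H1, H2.
  assert (H3 : (rho < r)%R) by (apply Rmax_lub_lt; lra).
  specialize (Hs rho ltac:(lra)).
  assert (H4 : (M * Cmod z / Cmod (f z) < rho)%R) by lra.
  apply (Rmult_lt_compat_r (Cmod (f z))) in H4; [|exact Hpos].
  unfold Rdiv in H4. rewrite Rmult_assoc, Rinv_l in H4; lra.
Qed.

(** Schwarz's lemma for the Cayley transform [(F - F 0) / (F + conj (F 0))]. *)
Lemma re_pos_interior (F : C -> C) (r : R) :
  (forall z, (Cmod z < r)%R -> analytic_at F z) ->
  (forall z, (Cmod z < r)%R -> (0 <= Re (F z))%R) -> (0 < Re (F 0))%R ->
  forall z, (Cmod z < r)%R -> (0 < Re (F z))%R.
Proof.
  intros HF Hge H0 z Hz.
  destruct (Hge z Hz) as [H|H]; [exact H|exfalso].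
  set (c := Cconj (F 0)).
  assert (Hd : forall x, (Cmod x < r)%R -> F x + c <> 0).
  { intros x Hx E. assert (E2 : Re (F x + c) = 0%R) by (rewrite E; apply re_RtoC).
    rewrite re_plus in E2. unfold c in E2. rewrite re_conj in E2. generalize (Hge x Hx). lra. }
  assert (Hm : forall x, (Cmod (F x - F 0) * Cmod (F x - F 0) = Cmod (F x + c) * Cmod (F x + c) - 4 * Re (F x) * Re (F 0))%R).
  { intros x. rewrite !Cmod_sqr. unfold c. rewrite re_minus, im_minus, re_plus, im_plus, re_conj, im_conj. ring. }
  assert (Hr : (0 < r)%R) by (generalize (Cmod_ge_0 z); lra).
  assert (S := schwarz (fun x => (F x - F 0) / (F x + c)) r 1).
  assert (Hs : (r * Cmod ((F z - F 0) / (F z + c)) <= 1 * Cmod z)%R).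
  { apply S; [| | |exact Hz].
    - intros x Hx. apply analytic_at_div; [| |now apply Hd].
      + apply analytic_at_minus; [now apply HF|apply analytic_at_const].
      + apply analytic_at_plus; [now apply HF|apply analytic_at_const].
    - unfold Cdiv. replace (F 0 - F 0) with (RtoC 0) by ring. ring.
    - intros x Hx. rewrite Cmod_div by now apply Hd.
      assert (Hp := proj1 (Cmod_gt_0 _) (Hd x Hx)).
      apply (Rmult_le_reg_r (Cmod (F x + c))); [exact Hp|].
      unfold Rdiv. rewrite Rmult_assoc, Rinv_l, Rmult_1_r, Rmult_1_l by lra.
      apply Rsqr_incr_0; [|apply Cmod_ge_0|lra]. unfold Rsqr. rewrite Hm.
      generalize (Rmult_le_pos _ _ (Hge x Hx) (Rlt_le _ _ H0)). lra. }
  rewrite Cmod_div in Hs by now apply Hd.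
  (* Where [Re F = 0] the transform has modulus 1, while Schwarz's lemma bounds it by
     [|z| / r < 1]. *)
  assert (E : Cmod (F z - F 0) = Cmod (F z + c)).
  { apply Rsqr_inj; [apply Cmod_ge_0|apply Cmod_ge_0|]. unfold Rsqr. rewrite Hm, <- H. ring. }
  rewrite E in Hs. assert (Hp := proj1 (Cmod_gt_0 _) (Hd z Hz)).
  unfold Rdiv in Hs. rewrite Rinv_r in Hs; lra.
Qed.

(** * Open mapping and inverse functions *)

Lemma Cmod_convex (x y z : C) (d t : R) : (0 <= t <= 1)%R ->
  (Cmod (x - z) < d)%R -> (Cmod (y - z) < d)%R -> (Cmod (y + RtoC t * (x - y) - z) < d)%R.
Proof.
  intros Ht Hx Hy.
  replace (y + RtoC t * (x - y) - z) with (RtoC t * (x - z) + RtoC (1 - t) * (y - z)) by (rewrite RtoC_minus; ring).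
  eapply Rle_lt_trans; [apply Cmod_triangle|]. rewrite !Cmod_mult, !Cmod_R, !Rabs_pos_eq by lra.
  destruct (Req_dec t 0) as [->|Nt]; [lra|]. nra.
Qed.

(** After a rotation making [g x - g y] a nonnegative real, the real mean value theorem applies to
    the real part along the segment. *)
Lemma lipschitz_of_cderive (g g' : C -> C) (x y : C) (K : R) :
  (forall t, (0 <= t <= 1)%R -> is_cderive g (y + RtoC t * (x - y)) (g' (y + RtoC t * (x - y))) /\
     (Cmod (g' (y + RtoC t * (x - y))%C) <= K)%R) ->
  (Cmod (g x - g y) <= K * Cmod (x - y))%R.
Proof.
  intros H. destruct (exists_unit_factor (g x - g y)) as [c [Mc Ec]].
  set (w := fun t : R => y + RtoC t * (x - y)).
  destruct (MVT_gen (fun t => Re (c * g (w t))) 0 1 (fun t => Re (c * (g' (w t) * (x - y))))) as [t [Ht Et]].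
  - intros t Ht. rewrite Rmin_left, Rmax_right in Ht by lra.
    apply (pder_Re (fun t => c * g (w t))).
    assert (Hw : pder w t (x - y)).
    { exists (fun _ => x - y). split; [apply continuous_const|split; [reflexivity|]].
      intros s. unfold w. rewrite RtoC_minus. ring. }
    rewrite Cmult_assoc.
    apply (pder_comp (fun z => c * g z) w); [|exact Hw].
    apply is_cderive_scal; apply H; lra.
  - intros t Ht. rewrite Rmin_left, Rmax_right in Ht by lra.
    apply continuity_pt_filterlim, (continuous_Re_comp _ (fun t => c * g (w t))).
    apply continuous_cmult; [apply continuous_const|].
    apply continuous_ccomp.
    + apply continuous_cplus; [apply continuous_const|].
      apply continuous_cmult; [apply continuous_RtoC, continuous_id|apply continuous_const].
    + eapply is_cderive_cont, H, Ht.
  - rewrite Rmin_left, Rmax_right in Ht by lra.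
    replace (w 1%R) with x in Et by (unfold w; ring).
    replace (w 0%R) with y in Et by (unfold w; ring).
    rewrite <- re_minus in Et. replace (c * g x - c * g y) with (c * (g x - g y)) in Et by ring.
    rewrite Ec, re_RtoC in Et. rewrite Et.
    assert (Hre := re_le_Cmod (c * (g' (w t) * (x - y)))).
    rewrite !Cmod_mult, Mc in Hre.
    assert (Hk := Rmult_le_compat_r _ _ _ (Cmod_ge_0 (x - y)) (proj2 (H t Ht))).
    fold (w t) in Hk.
    generalize (Rle_abs (Re (c * (g' (w t) * (x - y))))). lra.
Qed.

Lemma cderive_zero_const (f : C -> C) (z x : C) (d : R) :
  (forall y, (Cmod (y - z) < d)%R -> is_cderive f y 0) -> (Cmod (x - z) < d)%R -> f x = f z.
Proof.
  intros H Hx. apply Ceq_minus, Cmod_eq_0, Rle_antisym; [|apply Cmod_ge_0].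
  replace 0%R with (0 * Cmod (x - z))%R by ring.
  apply (lipschitz_of_cderive f (fun _ => RtoC 0)). intros t Ht. split.
  - apply H. apply Cmod_convex; auto. replace (z - z) with (RtoC 0) by ring.
    rewrite Cmod_0. generalize (Cmod_ge_0 (x - z)). lra.
  - rewrite Cmod_0. lra.
Qed.

(** Where [|f' - l| < |l| / 2] with [l = f' z], the function [f - l x] is Lipschitz with constant
    [|l| / 2], so it cannot cancel the difference [l (x - y)]. *)
Lemma locally_injective (f : C -> C) (z : C) :
  analytic_at f z -> C_derive f z <> 0 ->
  exists d, (0 < d)%R /\ forall x y, (Cmod (x - z) < d)%R -> (Cmod (y - z) < d)%R -> f x = f y -> x = y.
Proof.
  intros Hf Hz. assert (Hm := proj1 (Cmod_gt_0 _) Hz). set (l := C_derive f z) in *.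
  assert (Hn : cnear z (fun x => is_cderive f x (C_derive f x) /\ (Cmod (C_derive f x - l) < Cmod l / 2)%R)).
  { apply filter_and; [now apply analytic_at_cderive|].
    apply (proj1 (ccont_eps (C_derive f) z)); [|lra].
    now apply analytic_at_ccont, analytic_at_C_derive. }
  destruct (proj1 (cnear_ex _ _) Hn) as [d [Hd H]]. exists d. split; [exact Hd|].
  intros x y Hx Hy E.
  assert (HL := lipschitz_of_cderive (fun w => f w - l * w) (fun w => C_derive f w - l) x y (Cmod l / 2)).
  assert (HL' : (Cmod (f x - l * x - (f y - l * y)) <= Cmod l / 2 * Cmod (x - y))%R).
  { apply HL. intros t Ht. destruct (H (y + RtoC t * (x - y))) as [A B]; [now apply Cmod_convex|].
    split; [|lra]. apply is_cderive_minus; [exact A|].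
    apply is_cderive_linear. }
  rewrite E in HL'. replace (f y - l * x - (f y - l * y)) with (- (l * (x - y))) in HL' by ring.
  rewrite Cmod_opp, Cmod_mult in HL'.
  apply Ceq_minus, Cmod_eq_0. generalize (Cmod_ge_0 (x - y)). nra.
Qed.

Lemma circle_bound_below (f : C -> C) (z w : C) (r : R) : (0 < r)%R ->
  (forall x, Cmod (x - z) = r -> ccont f x /\ f x <> w) ->
  exists m, (0 < m)%R /\ forall x, Cmod (x - z) = r -> (m <= Cmod (f x - w))%R.
Proof.
  intros Hr H.
  destruct (compact_min (fun x => Cmod (x - z) = r) (fun x => Cmod (f x - w)) (Cmod z + r)) as [x0 [Hx0 Hmin]].
  - exists (z + RtoC r). replace (z + RtoC r - z) with (RtoC r) by ring. rewrite Cmod_R; apply Rabs_pos_eq; lra.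
  - intros x Hx. assert (Ht := Cmod_triangle z (x - z)). replace (z + (x - z)) with x in Ht by ring. lra.
  - intros x Hx. apply cond_eq. intros e He. destruct (Hx e He) as [y [Hy Dy]].
    rewrite <- Hy. eapply Rle_lt_trans; [apply Cmod_sub_le|].
    replace (x - z - (y - z)) with (- (y - x)) by ring. now rewrite Cmod_opp.
  - intros x Hx e He. generalize (proj1 (ccont_eps f x) (proj1 (H x Hx)) e He).
    apply filter_imp. intros y Hy _. eapply Rle_lt_trans; [apply Cmod_sub_le|].
    now replace (f y - w - (f x - w)) with (f y - f x) by ring.
  - exists (Cmod (f x0 - w)). split; [|exact Hmin].
    apply Cmod_gt_0. intro E. apply (proj2 (H x0 Hx0)). now apply Ceq_minus.
Qed.

(** On the circle of radius [d / 2] the values of [f] keep a distance [m] from [f z]. For [y] within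
    [m / 2] of [f z], the function [f - y] is smaller at the centre than on the circle, so it has a
    zero. *)
Lemma open_map_at (f : C -> C) (z : C) (d : R) : (0 < d)%R ->
  (forall x, (Cmod (x - z) < d)%R -> analytic_at f x) ->
  (forall x, (Cmod (x - z) < d)%R -> f x = f z -> x = z) ->
  exists e, (0 < e)%R /\ forall y, (Cmod (y - f z) < e)%R -> exists x, (Cmod (x - z) < d)%R /\ f x = y.
Proof.
  intros Hd Hf Hi. set (r := (d / 2)%R).
  destruct (circle_bound_below f z (f z) r) as [m [Hm Hc]].
  - unfold r; lra.
  - intros x Hx. split; [apply analytic_at_ccont, Hf; unfold r in Hx; lra|].
    intros E. apply Hi in E; [|unfold r in Hx; lra]. rewrite E in Hx.
    replace (z - z) with (RtoC 0) in Hx by ring. rewrite Cmod_0 in Hx. unfold r in Hx; lra.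
  - exists (m / 2)%R. split; [lra|]. intros y Hy.
    destruct (min_modulus_zero (fun h => f (z + h) - y) r (m / 2)) as [h [Hh Eh]].
    + unfold r; lra.
    + intros h Hh. apply analytic_at_minus; [|apply analytic_at_const].
      apply (analytic_at_comp f (fun h => z + h)).
      * apply Hf. replace (z + h - z) with h by ring. unfold r in Hh; lra.
      * apply analytic_at_plus; [apply analytic_at_const|apply analytic_at_id].
    + intros h Hh. specialize (Hc (z + h)). replace (z + h - z) with h in Hc by ring. specialize (Hc Hh).
      assert (Ht := Cmod_triangle (f (z + h) - y) (y - f z)).
      replace (f (z + h) - y + (y - f z)) with (f (z + h) - f z) in Ht by ring. lra.
    + replace (z + 0) with z by ring. replace (f z - y) with (- (y - f z)) by ring. now rewrite Cmod_opp.
    + exists (z + h). split; [replace (z + h - z) with h by ring; unfold r in Hh; lra|].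
      now apply Ceq_minus.
Qed.

(** If [f' z = 0] then, for [x] near [z], the slope function of [f] at [x] has a zero near [z]
    (minimum modulus); by injectivity it can only be at [x] itself, so [f'] vanishes near [z]. *)
Lemma injective_C_derive_ne (f : C -> C) (z : C) (d : R) : (0 < d)%R ->
  (forall x, (Cmod (x - z) < d)%R -> analytic_at f x) ->
  (forall x y, (Cmod (x - z) < d)%R -> (Cmod (y - z) < d)%R -> f x = f y -> x = y) ->
  C_derive f z <> 0.
Proof.
  intros Hd Hf Hi E0.
  assert (Hzz : (Cmod (z - z) < d)%R) by (replace (z - z) with (RtoC 0) by ring; now rewrite Cmod_0).
  set (r := (d / 2)%R).
  destruct (circle_bound_below f z (f z) r) as [m [Hm Hc]].
  - unfold r; lra.
  - intros x Hx. split; [apply analytic_at_ccont, Hf; unfold r in Hx; lra|].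
    intros E. apply Hi in E; [|unfold r in Hx; lra|exact Hzz]. rewrite E in Hx.
    replace (z - z) with (RtoC 0) in Hx by ring. rewrite Cmod_0 in Hx. unfold r in Hx; lra.
  (* On the circle the numerator of the slope at [x] is at least [m / 2] and the denominator at most
     [2 r], whence the threshold [m / (4 r)]. At the centre the slope is controlled by symmetry,
     [slope f x z = slope f z x]. *)
  - assert (Hn : cnear z (fun x => (Cmod (slope f z x - slope f z z) < m / (4 * r))%R /\ (Cmod (f x - f z) < m / 2)%R)).
    { apply filter_and.
      - apply (proj1 (ccont_eps (slope f z) z)); [|apply Rdiv_lt_0_compat; unfold r; lra].
        apply analytic_at_ccont, analytic_at_slope; now apply Hf.
      - apply (proj1 (ccont_eps f z)); [|lra]. now apply analytic_at_ccont, Hf. }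
    destruct (proj1 (cnear_ex _ _) Hn) as [d1 [Hd1 H1]].
    set (d2 := Rmin d1 r).
    assert (Hd2 : (0 < d2)%R) by (apply Rmin_pos; unfold r; lra).
    assert (Hzero : forall x, (Cmod (x - z) < d2)%R -> is_cderive f x 0).
    { intros x Hx.
      assert (Hx1 : (Cmod (x - z) < d1)%R) by (eapply Rlt_le_trans; [exact Hx|apply Rmin_l]).
      assert (Hx2 : (Cmod (x - z) < r)%R) by (eapply Rlt_le_trans; [exact Hx|apply Rmin_r]).
      assert (Hxd : (Cmod (x - z) < d)%R) by (unfold r in Hx2; lra).
      cut (C_derive f x = 0).
      { intros <-. now apply analytic_at_is_cderive, Hf. }
      destruct (Ceq_dec x z) as [->|Nx]; [exact E0|].
      destruct (H1 x Hx1) as [A B].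
      destruct (min_modulus_zero (fun h => slope f x (z + h)) r (m / (4 * r))) as [h [Hh Eh]].
      + unfold r; lra.
      + intros h Hh. apply (analytic_at_comp (slope f x) (fun h => z + h)).
        * apply analytic_at_slope; apply Hf; [exact Hxd|]. replace (z + h - z) with h by ring. unfold r in Hh; lra.
        * apply analytic_at_plus; [apply analytic_at_const|apply analytic_at_id].
      + intros h Hh. specialize (Hc (z + h)). replace (z + h - z) with h in Hc by ring. specialize (Hc Hh).
        assert (Ny : z + h <> x).
        { intro E. rewrite <- E in Hx2. replace (z + h - z) with h in Hx2 by ring. lra. }
        rewrite slope_ne by exact Ny.
        assert (Nd : z + h - x <> 0) by (intro E; apply Ny; now apply Ceq_minus).
        rewrite Cmod_div by exact Nd.
        assert (Hp := proj1 (Cmod_gt_0 _) Nd).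
        assert (Hnum : (m / 2 <= Cmod (f (z + h)%C - f x))%R).
        { assert (Ht := Cmod_triangle (f (z + h) - f x) (f x - f z)).
          replace (f (z + h) - f x + (f x - f z)) with (f (z + h) - f z) in Ht by ring. lra. }
        assert (Hden : (Cmod (z + h - x) <= 2 * r)%R).
        { replace (z + h - x) with (h + - (x - z)) by ring.
          eapply Rle_trans; [apply Cmod_triangle|]. rewrite Cmod_opp. lra. }
        apply (Rmult_le_reg_r (Cmod (z + h - x))); [exact Hp|].
        unfold Rdiv at 2. rewrite Rmult_assoc, Rinv_l, Rmult_1_r by lra.
        apply Rle_trans with (m / (4 * r) * (2 * r))%R.
        * apply Rmult_le_compat_l; [|exact Hden]. left. apply Rdiv_lt_0_compat; unfold r; lra.
        * replace (m / (4 * r) * (2 * r))%R with (m / 2)%R by (field; unfold r; lra). exact Hnum.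
      + replace (z + 0) with z by ring.
        rewrite slope_diag, E0 in A. replace (slope f z x - 0) with (slope f z x) in A by ring.
        replace (slope f x z) with (slope f z x); [exact A|].
        rewrite !slope_ne by auto. field.
        split; intro E; apply Nx; [symmetry|]; now apply Ceq_minus.
      + destruct (Ceq_dec (z + h) x) as [Ex|Ny]; [rewrite <- slope_diag; congruence|].
        exfalso. apply Ny. apply Hi; [|exact Hxd|].
        * replace (z + h - z) with h by ring. unfold r in Hh; lra.
        * apply Ceq_minus. rewrite slope_spec, Eh. ring. }
    assert (Hx : (Cmod (z + RtoC (d2 / 2) - z) < d2)%R).
    { replace (z + RtoC (d2 / 2) - z) with (RtoC (d2 / 2)) by ring. rewrite Cmod_R, Rabs_pos_eq; lra. }
    assert (Ec := cderive_zero_const f z (z + RtoC (d2 / 2)) d2 Hzero Hx).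
    apply Hi in Ec; [| |exact Hzz].
    + assert (E : RtoC (d2 / 2) = 0).
      { replace (RtoC (d2 / 2)) with (z + RtoC (d2 / 2) - z) by ring. rewrite Ec. ring. }
      apply RtoC_inj in E. lra.
    + eapply Rlt_trans; [exact Hx|]. assert (d2 <= r)%R by apply Rmin_r. unfold r in *; lra.
Qed.

Definition copen (U : C -> Prop) : Prop := forall z, U z -> cnear z U.

Lemma injective_on_C_derive_ne (U : C -> Prop) (q : C -> C) (z : C) :
  copen U -> analytic_on U q -> injective_on U q -> U z -> C_derive q z <> 0.
Proof.
  intros HU Hq Hi Hz. destruct (proj1 (cnear_ex _ _) (HU z Hz)) as [d [Hd H]].
  apply (injective_C_derive_ne q z d Hd); auto.
Qed.

(** The branch of [q^-1 o k] with values in [U], by choice. The domain is a parameter because two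
    branches are compared later: one into the disk, and one into a small ball about a boundary
    point. *)
Definition lift (U : C -> Prop) (q k : C -> C) (z : C) : C :=
  epsilon (inhabits (RtoC 0)) (fun x => U x /\ q x = k z).

Lemma lift_spec (U : C -> Prop) (q k : C -> C) (z : C) :
  image U q (k z) -> U (lift U q k z) /\ q (lift U q k z) = k z.
Proof. apply (epsilon_spec (inhabits (RtoC 0)) (fun x => U x /\ q x = k z)). Qed.

Lemma lift_eq (U : C -> Prop) (q k : C -> C) (z x : C) :
  injective_on U q -> U x -> q x = k z -> lift U q k z = x.
Proof.
  intros Hi Ux Ex. destruct (lift_spec U q k z) as [A B]; [now exists x|].
  apply Hi; auto. congruence.
Qed.

(** One statement for two purposes: being liftable is an open condition, and the lift is
    continuous. *)
Lemma image_open (U : C -> Prop) (q k : C -> C) (z x : C) :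
  copen U -> analytic_on U q -> injective_on U q -> U x -> q x = k z -> ccont k z ->
  forall e, (0 < e)%R -> cnear z (fun y => exists x', U x' /\ q x' = k y /\ (Cmod (x' - x) < e)%R).
Proof.
  intros HU Hq Hi Hx Ex Hk e He.
  destruct (proj1 (cnear_ex _ _) (HU x Hx)) as [d [Hd H]].
  destruct (open_map_at q x (Rmin d e)) as [m [Hm Hm']].
  - now apply Rmin_pos.
  - intros y Hy. apply Hq, H. eapply Rlt_le_trans; [exact Hy|apply Rmin_l].
  - intros y Hy. apply Hi; [|exact Hx]. apply H. eapply Rlt_le_trans; [exact Hy|apply Rmin_l].
  - generalize (proj1 (ccont_eps k z) Hk m Hm). apply filter_imp. intros y Hy.
    rewrite <- Ex in Hy. destruct (Hm' _ Hy) as [x' [Hx' Ex']].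
    exists x'. split; [apply H; eapply Rlt_le_trans; [exact Hx'|apply Rmin_l]|].
    split; [exact Ex'|]. eapply Rlt_le_trans; [exact Hx'|apply Rmin_r].
Qed.

Lemma lift_ccont (U : C -> Prop) (q k : C -> C) (z : C) :
  copen U -> analytic_on U q -> injective_on U q -> image U q (k z) -> ccont k z ->
  ccont (lift U q k) z.
Proof.
  intros HU Hq Hi Hz Hk. destruct (lift_spec U q k z Hz) as [A B].
  apply ccont_eps. intros e He.
  generalize (image_open U q k z _ HU Hq Hi A B Hk e He). apply filter_imp.
  intros y [x' [Ux' [Ex' Dx']]]. now rewrite (lift_eq U q k y x' Hi Ux' Ex').
Qed.

(** Near [z] the increment of the lift is [x - z] times the slope of [k] over the slope of [q]; the
    denominator is nonzero because an injective analytic [q] has no critical point. *)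
Lemma lift_is_cderive (U : C -> Prop) (q k : C -> C) (z : C) :
  copen U -> analytic_on U q -> injective_on U q -> image U q (k z) -> analytic_at k z ->
  is_cderive (lift U q k) z (C_derive k z / C_derive q (lift U q k z)).
Proof.
  intros HU Hq Hi Hz Hk. destruct (lift_spec U q k z Hz) as [A B].
  assert (Hkc := analytic_at_ccont k z Hk).
  assert (Hc := lift_ccont U q k z HU Hq Hi Hz Hkc).
  set (W := lift U q k) in *.
  assert (Hd := injective_on_C_derive_ne U q _ HU Hq Hi A).
  assert (Hs : ccont (slope q (W z)) (W z)) by (apply analytic_at_ccont, analytic_at_slope; now apply Hq).
  assert (Hs2 : ccont (fun x => slope q (W z) (W x)) z) by now apply (ccont_comp (slope q (W z)) W).
  apply (is_cderive_ext_loc (fun x => W z + slope k z x / slope q (W z) (W x) * (x - z))).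
  - assert (Hn : cnear z (fun x => slope q (W z) (W x) <> 0)).
    { apply (ccont_ne (fun x => slope q (W z) (W x))); [exact Hs2|]. now rewrite slope_diag. }
    generalize (filter_and _ _ Hn (image_open U q k z _ HU Hq Hi A B Hkc 1%R Rlt_0_1)).
    apply filter_imp. intros x [Nx [x' [Ux' [Ex' _]]]].
    assert (EW : W x = x') by now apply lift_eq.
    assert (E1 := slope_spec q (W z) (W x)). assert (E2 := slope_spec k z x).
    rewrite B in E1. rewrite EW in E1 at 1. rewrite Ex' in E1. rewrite E1 in E2.
    replace (slope k z x / slope q (W z) (W x) * (x - z)) with ((slope k z x * (x - z)) / slope q (W z) (W x)) by (field; exact Nx).
    rewrite <- E2. field. exact Nx.
  - apply is_cderive_slope. exists (fun x => slope k z x / slope q (W z) (W x)). split; [|split].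
    + apply ccont_mult; [now apply analytic_at_ccont, analytic_at_slope|].
      apply ccont_inv; [exact Hs2|]. now rewrite slope_diag.
    + now rewrite !slope_diag.
    + intros x. ring.
Qed.

Lemma lift_analytic (U A : C -> Prop) (q k : C -> C) :
  copen U -> analytic_on U q -> injective_on U q ->
  copen A -> analytic_on A k -> (forall z, A z -> image U q (k z)) ->
  analytic_on A (lift U q k).
Proof.
  intros HU Hq Hi HA Hk Him z Az.
  apply (analytic_at_of_near _ (fun z => C_derive k z / C_derive q (lift U q k z))).
  apply (filter_imp (F := cnear z)) with (2 := HA z Az). intros x Ax. 
  assert (Hx := Him x Ax). destruct (lift_spec U q k x Hx) as [B _].
  split; [apply lift_is_cderive; auto|].
  assert (Hc := lift_ccont U q k x HU Hq Hi Hx (analytic_at_ccont _ _ (Hk x Ax))).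
  apply ccont_mult; [now apply analytic_at_ccont, analytic_at_C_derive, Hk|].
  apply ccont_inv.
  - apply (ccont_comp (C_derive q) (lift U q k)); [exact Hc|].
    now apply analytic_at_ccont, analytic_at_C_derive, Hq.
  - now apply (injective_on_C_derive_ne U).
Qed.

Lemma ball_open (z : C) (r : R) : copen (fun x => (Cmod (x - z) < r)%R).
Proof.
  intros x Hx. apply cnear_ex. exists (r - Cmod (x - z))%R. split; [lra|].
  intros y Hy. replace (y - z) with ((x - z) + (y - x)) by ring.
  eapply Rle_lt_trans; [apply Cmod_triangle|]. lra.
Qed.

Lemma ball0_open (r : R) : copen (fun x => (Cmod x < r)%R).
Proof.
  intros x Hx. assert (E : forall u : C, u - 0 = u) by (intros; ring).
  apply (filter_imp (F := cnear x)) with (fun x => (Cmod (x - 0) < r)%R).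
  - intros y Hy. now rewrite E in Hy.
  - apply ball_open. now rewrite E.
Qed.

Lemma lift_schwarz (q k : C -> C) (r : R) (z : C) :
  univalent q -> k 0 = q 0 ->
  (forall x, (Cmod x < r)%R -> analytic_at k x /\ image disk q (k x)) ->
  (Cmod z < r)%R -> (r * Cmod (lift disk q k z) <= Cmod z)%R.
Proof.
  intros [Hq Hi] H0 Hk Hz.
  replace (Cmod z) with (1 * Cmod z)%R by ring.
  apply (schwarz (lift disk q k)); [| | |exact Hz].
  - apply (lift_analytic disk (fun x => (Cmod x < r)%R)); auto.
    + exact disk_open.
    + apply ball0_open.
    + intros x Hx. now apply Hk.
    + intros x Hx. now apply Hk.
  - apply lift_eq; auto. apply disk_0.
  - intros x Hx. destruct (lift_spec disk q k x) as [B _]; [now apply Hk|]. left; exact B.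
Qed.

Lemma subordinate_of_image (q k : C -> C) :
  univalent q -> analytic_on disk k -> k 0 = q 0 ->
  (forall z, disk z -> image disk q (k z)) -> subordinate k q.
Proof.
  intros Hq Hk H0 Him. exists (lift disk q k). split; [|split].
  - destruct Hq as [Hq Hi]. apply (lift_analytic disk disk); auto; exact disk_open.
  - intros z Hz. replace (Cmod (lift disk q k z)) with (1 * Cmod (lift disk q k z))%R by ring.
    apply (lift_schwarz q k 1 z); auto.
  - intros z Hz. symmetry. now apply lift_spec, Him.
Qed.

(** * Convex univalent functions *)

(** One-sided differentiation of [|W|^2] at [t = 0] along the direction [v]. The slack [t^2 c2]
    vanishes in the limit; it accommodates bounds such as [|1 + t u|^2]. *)
Lemma cderive_Cmod_growth (W : C -> C) (a l v : C) (c c2 d : R) :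
  is_cderive W a l -> (0 < d)%R ->
  (forall t, (0 < t < d)%R ->
    (Cmod (W (a + RtoC t * v)%C) * Cmod (W (a + RtoC t * v)%C) <= Cmod (W a) * Cmod (W a) + t * c + t * t * c2)%R) ->
  (2 * Re (Cconj (W a) * (l * v)) <= c)%R.
Proof.
  intros [s [Hs [<- E]]]%is_cderive_slope Hd H.
  assert (Hc : pcont (fun t => s (a + RtoC t * v)) 0).
  { apply continuous_ccomp.
    - apply continuous_cplus; [apply continuous_const|].
      apply continuous_cmult; [apply continuous_RtoC, continuous_id|apply continuous_const].
    - now replace (a + 0 * v) with a by ring. }
  assert (Hr : continuous (T := R_UniformSpace) (U := R_UniformSpace) (fun t => (2 * Re (Cconj (W a) * (s (a + RtoC t * v)%C * v)) - t * c2)%R) 0%R).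
  { apply (continuous_minus (V := R_NormedModule) (fun t => (2 * Re (Cconj (W a) * (s (a + RtoC t * v)%C * v)))%R) (fun t => (t * c2)%R)).
    - apply (continuous_mult (K := R_AbsRing) (fun _ => 2%R)); [apply continuous_const|].
      apply (continuous_Re_comp _ (fun t => Cconj (W a) * (s (a + RtoC t * v) * v))).
      apply continuous_cmult; [apply continuous_const|]. apply continuous_cmult; [exact Hc|apply continuous_const].
    - apply (continuous_mult (K := R_AbsRing) (fun t : R => t) (fun _ => c2)); [apply continuous_id|apply continuous_const]. }
  apply le_epsilon. intros e He.
  destruct (proj1 (filterlim_locally _ _) Hr (mkposreal e He)) as [d' Hd'].
  set (t := (Rmin d d' / 2)%R).
  assert (Hm : (0 < Rmin d d')%R) by (apply Rmin_pos; [lra|apply cond_pos]).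
  assert (Ht1 : (0 < t < d)%R) by (unfold t; generalize (Rmin_l d d'); lra).
  assert (Ht2 : (t < d')%R) by (unfold t; generalize (Rmin_r d d'); lra).
  assert (Hb : ball 0%R d' t) by (change (Rabs (t - 0) < d')%R; rewrite Rminus_0_r, Rabs_pos_eq; lra).
  specialize (Hd' t Hb).
  match type of Hd' with ball ?x _ ?y => change (Rabs (y - x) < e)%R in Hd' end.
  replace (a + 0 * v) with a in Hd' by ring. apply Rabs_def2 in Hd'.
  specialize (H t Ht1). specialize (E (a + RtoC t * v)).
  replace (a + RtoC t * v - a) with (RtoC t * v) in E by ring.
  replace (W (a + RtoC t * v)) with (W a + RtoC t * (s (a + RtoC t * v) * v)) in H.
  2:{ transitivity (W a + (W (a + RtoC t * v) - W a)); [rewrite E; ring|ring]. }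
  set (p := s (a + RtoC t * v) * v) in *.
  rewrite !Cmod_sqr in H. rewrite re_plus, im_plus, re_scal_l, im_scal_l in H.
  rewrite re_mult, re_conj, im_conj in Hd'.
  assert (Hq : (2 * (Re (W a) * Re p + Im (W a) * Im p) <= c + t * c2)%R).
  { apply (Rmult_le_reg_l t); [lra|].
    generalize (Rle_0_sqr (t * Re p)) (Rle_0_sqr (t * Im p)). unfold Rsqr. nra. }
  lra.
Qed.

Lemma re_inv_scale (w : C) : w <> 0 -> Re w = (Re (/ w) * (Cmod w * Cmod w))%R.
Proof.
  intros Hw. assert (Hm := proj1 (Cmod_gt_0 _) Hw).
  assert (Hs : (Re w * Re w + Im w * Im w <> 0)%R) by (rewrite <- Cmod_sqr; nra).
  rewrite Cmod_sqr. destruct w as [x y]. unfold Re, Im in *. simpl in *. field. lra.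
Qed.
Lemma re_inv_le (w : C) : w <> 0 -> (Re (/ w) <= 0)%R -> (Re w <= 0)%R.
Proof.
  intros Hw H. rewrite re_inv_scale by exact Hw. assert (Hm := proj1 (Cmod_gt_0 _) Hw). nra.
Qed.
Lemma re_inv_lt (w : C) : w <> 0 -> (Re (/ w) < 0)%R -> (Re w < 0)%R.
Proof.
  intros Hw H. rewrite re_inv_scale by exact Hw. assert (Hm := proj1 (Cmod_gt_0 _) Hw).
  assert (0 < Cmod w * Cmod w)%R by nra. nra.
Qed.

Lemma disk_le (z w : C) : (Cmod z <= Cmod w)%R -> disk w -> disk z.
Proof. unfold disk. lra. Qed.

(** Schwarz's lemma for [psi^-1 ((1 - t) psi z + t psi (c z))], [c = z1 / z2], differentiated at [t = 0]. *)
Lemma convex_re_le (psi : C -> C) (z1 z2 : C) :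
  convex_univalent psi -> disk z2 -> z2 <> 0 -> (Cmod z1 <= Cmod z2)%R ->
  (Re ((psi z1 - psi z2) / (z2 * C_derive psi z2)) <= 0)%R.
Proof.
  intros [Hu Hconv] Hz2 N2 H12. destruct (Hu) as [Ha Hi].
  assert (Hm := proj1 (Cmod_gt_0 _) N2).
  set (d := psi z1 - psi z2). set (c := z1 / z2).
  assert (Mc : (Cmod c <= 1)%R).
  { unfold c. rewrite Cmod_div by exact N2. apply (Rmult_le_reg_r (Cmod z2)); [exact Hm|].
    unfold Rdiv. rewrite Rmult_assoc, Rinv_l; lra. }
  assert (Hcd : forall x, disk x -> disk (c * x)).
  { intros x Hx. apply (disk_le _ x); [|exact Hx]. rewrite Cmod_mult. generalize (Cmod_ge_0 x). nra. }
  set (k := fun s : C => psi z2 + d * s).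
  (* [kt] fixes [t] and moves the point, so Schwarz's lemma bounds its lift; [k] fixes the point
     [z2] and moves [t]. They meet in [kt z2 = k t], so the lift of [k] is a curve from [z2] that
     never leaves [|z| <= |z2|]. *)
  assert (Hlift : forall t, (0 <= t <= 1)%R -> image disk psi (k (RtoC t)) /\ (Cmod (lift disk psi k (RtoC t)) <= Cmod z2)%R).
  { intros t Ht.
    set (kt := fun x => RtoC (1 - t) * psi x + RtoC t * psi (c * x)).
    assert (Him : forall x, disk x -> image disk psi (kt x)).
    { intros x Hx. apply Hconv; [now exists x|now exists (c * x); split; [apply Hcd|]|exact Ht]. }
    assert (Ek : kt z2 = k (RtoC t)).
    { unfold kt, k, d, c. replace (z1 / z2 * z2) with z1 by (field; exact N2). rewrite RtoC_minus. ring. }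
    split; [rewrite <- Ek; now apply Him|].
    replace (lift disk psi k (RtoC t)) with (lift disk psi kt z2) by (unfold lift; now rewrite Ek).
    replace (Cmod (lift disk psi kt z2)) with (1 * Cmod (lift disk psi kt z2))%R by ring.
    apply (lift_schwarz psi kt 1); auto.
    - unfold kt. replace (c * 0) with (RtoC 0) by ring. rewrite RtoC_minus. ring.
    - intros x Hx. split; [|now apply Him].
      apply analytic_at_plus; apply analytic_at_mult; try apply analytic_at_const.
      + now apply Ha.
      + apply (analytic_at_comp psi (fun x => c * x)); [now apply Ha, Hcd|].
        apply analytic_at_mult; [apply analytic_at_const|apply analytic_at_id]. }
  assert (E0 : k 0 = psi z2) by (unfold k; ring).
  assert (L0 : lift disk psi k 0 = z2) by (apply lift_eq; auto).
  assert (Hka : analytic_at k 0).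
  { apply analytic_at_plus; [apply analytic_at_const|]. apply analytic_at_mult; [apply analytic_at_const|apply analytic_at_id]. }
  assert (Hd := lift_is_cderive disk psi k 0 disk_open Ha Hi (proj1 (Hlift 0%R ltac:(lra))) Hka).
  assert (Ed : C_derive k 0 = d).
  { apply is_C_derive_unique, is_cderive_affine. }
  rewrite L0, Ed in Hd.
  assert (Hg := cderive_Cmod_growth (lift disk psi k) 0 _ 1 0 0 1 Hd Rlt_0_1).
  rewrite L0 in Hg.
  assert (Hre : (2 * Re (Cconj z2 * (d / C_derive psi z2 * 1)) <= 0)%R).
  { apply Hg. intros t Ht. replace (0 + RtoC t * 1) with (RtoC t) by ring.
    destruct (Hlift t ltac:(lra)) as [_ B].
    generalize (Cmod_ge_0 (lift disk psi k (RtoC t))). nra. }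
  assert (Np : C_derive psi z2 <> 0) by (apply (injective_on_C_derive_ne disk); auto; exact disk_open).
  assert (Nc : Cconj z2 <> 0) by (apply Cmod_gt_0; now rewrite Cmod_conj).
  assert (Nm : RtoC (Cmod z2 ^ 2) <> 0) by (intro E; apply RtoC_inj in E; simpl in E; nra).
  replace (d / (z2 * C_derive psi z2)) with (RtoC (/ Cmod z2 ^ 2) * (Cconj z2 * (d / C_derive psi z2 * 1))).
  - rewrite re_scal_l. assert (0 < / Cmod z2 ^ 2)%R by (apply Rinv_0_lt_compat; simpl; nra). nra.
  - rewrite RtoC_inv by (simpl; nra). rewrite Cmod2_conj. field. auto.
Qed.

(** The weak inequality is applied to a nearby [x] with [psi x = psi z1 + s B], where
    [B = z2 psi'(z2)]; such an [x] exists by open mapping, and it raises the real part by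
    [s > 0]. *)
Lemma convex_re_lt (psi : C -> C) (z1 z2 : C) :
  convex_univalent psi -> disk z2 -> (Cmod z1 < Cmod z2)%R ->
  (Re ((psi z1 - psi z2) / (z2 * C_derive psi z2)) < 0)%R.
Proof.
  intros Hc Hz2 H12. destruct (Hc) as [[Ha Hi] _].
  assert (N2 : z2 <> 0) by (intros ->; rewrite Cmod_0 in H12; generalize (Cmod_ge_0 z1); lra).
  assert (Np : C_derive psi z2 <> 0) by (apply (injective_on_C_derive_ne disk); auto; exact disk_open).
  set (B := z2 * C_derive psi z2).
  assert (NB : B <> 0) by now apply Cmult_neq_0.
  assert (HB := proj1 (Cmod_gt_0 _) NB).
  assert (Hin : forall x, (Cmod (x - z1) < Cmod z2 - Cmod z1)%R -> (Cmod x <= Cmod z2)%R).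
  { intros x Hx. generalize (Rle_abs (Cmod x - Cmod z1)) (Cmod_sub_le x z1). lra. }
  destruct (open_map_at psi z1 (Cmod z2 - Cmod z1)) as [e [He Hopen]].
  - lra.
  - intros x Hx. apply Ha. apply (disk_le x z2); auto.
  - intros x Hx. apply Hi; apply (disk_le _ z2); auto. lra.
  - set (s := (e / (2 * Cmod B))%R).
    assert (Hs : (0 < s)%R) by (apply Rdiv_lt_0_compat; lra).
    destruct (Hopen (psi z1 + RtoC s * B)) as [x [Hx Ex]].
    + replace (psi z1 + RtoC s * B - psi z1) with (RtoC s * B) by ring.
      rewrite Cmod_mult, Cmod_R, Rabs_pos_eq by lra. unfold s.
      replace (e / (2 * Cmod B) * Cmod B)%R with (e / 2)%R by (field; lra). lra.
    + assert (H := convex_re_le psi x z2 Hc Hz2 N2 (Hin x Hx)). fold B in H. rewrite Ex in H.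
      replace ((psi z1 + RtoC s * B - psi z2) / B) with ((psi z1 - psi z2) / B + RtoC s) in H by (field; exact NB).
      rewrite re_plus, re_RtoC in H. lra.
Qed.

Definition zder (psi : C -> C) (z : C) : C := z * C_derive psi z.

Lemma convex_zder_ne_0 (psi : C -> C) (Hpsi : convex_univalent psi) (z : C) : disk z -> z <> 0 -> zder psi z <> 0.
Proof.
  intros Hz Nz. apply Cmult_neq_0; [exact Nz|].
  destruct (Hpsi) as [[Ha Hi] _]. apply (injective_on_C_derive_ne disk); auto; exact disk_open.
Qed.

Lemma analytic_at_zder (psi : C -> C) (Hpsi : convex_univalent psi) (z : C) : disk z -> analytic_at (zder psi) z.
Proof.
  intros Hz. apply analytic_at_mult; [apply analytic_at_id|]. now apply analytic_at_C_derive, Hpsi.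
Qed.

Lemma convex_zder_div_le (psi : C -> C) (Hpsi : convex_univalent psi) (z zeta : C) :
  disk zeta -> zeta <> 0 -> z <> zeta -> (Cmod z <= Cmod zeta)%R ->
  (Re (zder psi zeta / (psi z - psi zeta)) <= 0)%R.
Proof.
  intros Hz Nz Ne Hle.
  assert (Nd : psi z - psi zeta <> 0).
  { intro E. apply Ne. apply (proj2 (proj1 Hpsi)); [now apply (disk_le _ zeta)|exact Hz|now apply Ceq_minus]. }
  assert (NA := convex_zder_ne_0 psi Hpsi zeta Hz Nz).
  apply re_inv_le.
  - apply Cmult_neq_0; [exact NA|]. intro E. apply (f_equal Cmod) in E. rewrite Cmod_inv, Cmod_0 in E by exact Nd.
    generalize (Rinv_0_lt_compat _ (proj1 (Cmod_gt_0 _) Nd)). lra.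
  - replace (/ (zder psi zeta / (psi z - psi zeta))) with ((psi z - psi zeta) / zder psi zeta) by (field; auto).
    now apply convex_re_le.
Qed.

(** The previous inequality with [z] and [zeta] exchanged, which the equality of moduli permits. *)
Lemma convex_zder_div_ge (psi : C -> C) (Hpsi : convex_univalent psi) (z zeta : C) :
  disk zeta -> zeta <> 0 -> z <> zeta -> Cmod z = Cmod zeta ->
  (0 <= Re (zder psi z / (psi z - psi zeta)))%R.
Proof.
  intros Hz Nz Ne Heq.
  assert (Hz' : disk z) by (unfold disk in *; lra).
  assert (Nz' : z <> 0) by (apply Cmod_gt_0; rewrite Heq; now apply Cmod_gt_0).
  assert (H := convex_zder_div_le psi Hpsi zeta z Hz' Nz' (not_eq_sym Ne) ltac:(lra)).
  assert (Nd : psi z - psi zeta <> 0).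
  { intro E. apply Ne. apply (proj2 (proj1 Hpsi)); auto. now apply Ceq_minus. }
  assert (Nd' : psi zeta - psi z <> 0) by (intro E; apply Nd; replace (psi z - psi zeta) with (- (psi zeta - psi z)) by ring; rewrite E; ring).
  replace (zder psi z / (psi z - psi zeta)) with (- (zder psi z / (psi zeta - psi z))) by (field; auto).
  rewrite re_opp. lra.
Qed.

(** The real part of [(zder psi z - zder psi zeta) / (psi z - psi zeta)] is nonnegative on [|z| = |zeta|]
    by [convex_re_le] applied twice, hence positive inside by the minimum principle. *)
Lemma convex_avoid (psi : C -> C) (Hpsi : convex_univalent psi) (gam : C)
  (Hgam : (0 <= Re gam)%R) (z zeta : C) (m : R) :
  disk zeta -> (Cmod z < Cmod zeta)%R -> (1 <= m)%R ->
  gam * psi z + zder psi z <> gam * psi zeta + RtoC m * zder psi zeta.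
Proof.
  intros Hz Hlt Hm E.
  assert (Nz : zeta <> 0) by (intros ->; rewrite Cmod_0 in Hlt; generalize (Cmod_ge_0 z); lra).
  assert (Hzp := proj1 (Cmod_gt_0 _) Nz).
  destruct (Hpsi) as [[Ha Hi] _].
  assert (Hsl : forall x, disk x -> slope psi zeta x <> 0).
  { intros x Hx. destruct (Ceq_dec x zeta) as [->|Nx].
    - rewrite slope_diag. apply (injective_on_C_derive_ne disk); auto; exact disk_open.
    - intros Es. apply Nx, Hi; auto. apply Ceq_minus. rewrite slope_spec, Es. ring. }
  assert (Hnd : forall x, disk x -> x <> zeta -> psi x - psi zeta <> 0).
  { intros x Hx Nx Es. apply Nx, Hi; auto. now apply Ceq_minus. }
  (* A quotient of slopes has no singularity at [zeta], so the minimum principle can be used on the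
     whole closed ball. *)
  set (F := fun x => slope (zder psi) zeta x / slope psi zeta x).
  assert (HF : forall x, (Cmod x <= Cmod zeta)%R -> analytic_at F x).
  { intros x Hx. assert (Dx : disk x) by now apply (disk_le _ zeta).
    apply analytic_at_div; [| |now apply Hsl]; apply analytic_at_slope; auto using analytic_at_zder. }
  assert (HFne : forall x, disk x -> x <> zeta -> F x = zder psi x / (psi x - psi zeta) - zder psi zeta / (psi x - psi zeta)).
  { intros x Hx Nx. unfold F. rewrite !slope_ne by exact Nx. field. split; [now apply Hnd|].
    intro Es; apply Nx; now apply Ceq_minus. }
  assert (HFcirc : forall x, Cmod x = Cmod zeta -> x <> zeta -> (0 <= Re (F x))%R).
  { intros x Hx Nx. assert (Dx : disk x) by (unfold disk in *; lra).
    rewrite HFne, re_minus by auto.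
    generalize (convex_zder_div_ge psi Hpsi x zeta Hz Nz Nx Hx) (convex_zder_div_le psi Hpsi x zeta Hz Nz Nx ltac:(lra)). lra. }
  (* The sign at [zeta] itself is inherited from the points [zeta * cis t] as [t] tends to 0;
     [t <= 1] keeps [sin t > 0], so that these points differ from [zeta]. *)
  assert (HFz : (0 <= Re (F zeta))%R).
  { destruct (Rle_lt_dec 0 (Re (F zeta))) as [H|H]; [exact H|exfalso].
    assert (Hc : pcont (fun t => F (zeta * cis t)) 0).
    { assert (E0 : zeta * cis 0 = zeta) by (unfold cis; rewrite cos_0, sin_0; apply injective_projections; simpl; ring).
      apply continuous_ccomp; [apply continuous_cmult; [apply continuous_const|apply cis_pcont]|].
      rewrite E0. apply analytic_at_ccont, HF. lra. }
    apply continuous_Re_comp in Hc.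
    destruct (proj1 (filterlim_locally _ _) Hc (mkposreal (- Re (F zeta)) ltac:(lra))) as [d Hd].
    set (t := Rmin (d / 2) 1).
    assert (Ht : (0 < t)%R) by (apply Rmin_pos; [generalize (cond_pos d); lra|lra]).
    assert (Ht1 : (t <= 1)%R) by apply Rmin_r.
    assert (Ht2 : (t < d)%R) by (generalize (Rmin_l (d / 2) 1) (cond_pos d); unfold t; lra).
    assert (Hb : ball 0%R d t) by (change (Rabs (t - 0) < d)%R; rewrite Rminus_0_r, Rabs_pos_eq; lra).
    specialize (Hd t Hb).
    match type of Hd with ball ?x _ ?y => change (Rabs (y - x) < - Re (F zeta))%R in Hd end.
    replace (zeta * cis 0) with zeta in Hd
      by (unfold cis; rewrite cos_0, sin_0; apply injective_projections; simpl; ring).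
    apply Rabs_def2 in Hd.
    assert (Hge : (0 <= Re (F (zeta * cis t)%C))%R); [|lra].
    apply HFcirc; [rewrite Cmod_mult, Cmod_cis; ring|].
    intros Ec. assert (E1 : cis t = 1).
    { replace (cis t) with (zeta * cis t / zeta) by (field; exact Nz). rewrite Ec. field. exact Nz. }
    apply (f_equal snd) in E1. unfold cis in E1. simpl in E1.
    assert (0 < sin t)%R; [|lra]. apply sin_gt_0; [exact Ht|]. generalize PI2_1 PI_RGT_0. lra. }
  assert (HFge : forall x, (Cmod x <= Cmod zeta)%R -> (0 <= Re (F x))%R).
  { apply re_min_principle; [exact HF|]. intros x Hx.
    destruct (Ceq_dec x zeta) as [->|Nx]; [exact HFz|now apply HFcirc]. }
  assert (H0d : disk 0) by apply disk_0.
  (* At 0 the term with [zder psi 0] vanishes, and the strict form of the convexity inequality makes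
     the other contribution positive. *)
  assert (H0 : (0 < Re (F 0))%R).
  { assert (N0 : RtoC 0 <> zeta) by auto.
    rewrite HFne, re_minus by auto.
    assert (E0 : zder psi 0 / (psi 0 - psi zeta) = 0) by (unfold zder, Cdiv; ring).
    rewrite E0. 
    assert (HB : (Re (zder psi zeta / (psi 0 - psi zeta)) < 0)%R).
    { assert (NA := convex_zder_ne_0 psi Hpsi zeta Hz Nz). assert (Nd := Hnd 0 H0d N0).
      apply re_inv_lt.
      - apply Cmult_neq_0; [exact NA|]. intro E1. apply (f_equal Cmod) in E1. rewrite Cmod_inv, Cmod_0 in E1 by exact Nd.
        generalize (Rinv_0_lt_compat _ (proj1 (Cmod_gt_0 _) Nd)). lra.
      - replace (/ (zder psi zeta / (psi 0 - psi zeta))) with ((psi 0 - psi zeta) / zder psi zeta) by (field; auto).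
        apply convex_re_lt; auto. rewrite Cmod_0. exact Hzp. }
    change (Re 0) with 0%R. lra. }
  assert (HFgt := re_pos_interior F (Cmod zeta) (fun x Hx => HF x (Rlt_le _ _ Hx)) (fun x Hx => HFge x (Rlt_le _ _ Hx)) H0 z Hlt).
  assert (Dz : disk z) by (apply (disk_le _ zeta); [lra|exact Hz]).
  assert (Ne : z <> zeta) by (intros ->; lra).
  assert (Nd := Hnd z Dz Ne).
  (* Divided by [psi z - psi zeta], the assumed equality expresses [gam + F z], of positive real
     part, as [m - 1 >= 0] times a quantity of nonpositive real part. *)
  assert (EF : gam + F z = RtoC (m - 1) * (zder psi zeta / (psi z - psi zeta))).
  { rewrite HFne by auto. rewrite RtoC_minus.
    assert (E2 : zder psi z = gam * psi zeta + RtoC m * zder psi zeta - gam * psi z) by (rewrite <- E; ring).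
    rewrite E2. field. exact Nd. }
  apply (f_equal Re) in EF. rewrite re_plus, re_scal_l in EF.
  assert (HB := convex_zder_div_le psi Hpsi z zeta Hz Nz Ne ltac:(lra)).
  nra.
Qed.

(** If the value [c] on the right were omitted, [(psi z - psi z0) / (gam psi z + zder psi z - c)] would have
    nonnegative real part on [|z| <= |z0|], whereas it behaves like [(z - z0) / ((1 - t) z0)] at [z0]. *)
Lemma convex_attain (psi : C -> C) (Hpsi : convex_univalent psi) (gam : C)
  (Hgam : (0 <= Re gam)%R) (z0 : C) (t : R) :
  disk z0 -> z0 <> 0 -> (0 < t <= 1)%R ->
  exists z, (Cmod z <= Cmod z0)%R /\ gam * psi z + zder psi z = gam * psi z0 + RtoC t * zder psi z0.
Proof.
  intros Hz Nz Ht.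
  destruct (Req_dec t 1) as [->|Nt].
  { exists z0. split; [lra|]. ring. }
  apply NNPP. intros Hno.
  set (c := gam * psi z0 + RtoC t * zder psi z0).
  set (h := fun z => gam * psi z + zder psi z).
  destruct (Hpsi) as [[Ha Hi] _].
  assert (Hne : forall z, (Cmod z <= Cmod z0)%R -> h z - c <> 0).
  { intros z Hle E. apply Hno. exists z. split; [exact Hle|]. now apply Ceq_minus. }
  assert (Hh : forall z, disk z -> analytic_at h z).
  { intros z Dz. apply analytic_at_plus; [|now apply analytic_at_zder].
    apply analytic_at_mult; [apply analytic_at_const|now apply Ha]. }
  assert (HG : forall z, (Cmod z <= Cmod z0)%R -> (0 <= Re ((psi z - psi z0) / (h z - c)))%R).
  { apply (re_min_principle (fun z => (psi z - psi z0) / (h z - c))).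
    - intros z Hle. assert (Dz : disk z) by now apply (disk_le _ z0).
      apply analytic_at_div; [| |now apply Hne]; apply analytic_at_minus; auto using analytic_at_const.
    - intros z Heq. destruct (Ceq_dec z z0) as [->|Ne].
      + replace ((psi z0 - psi z0) / (h z0 - c)) with (RtoC 0).
        * change (Re 0) with 0%R. lra.
        * unfold Cdiv. ring.
      + assert (Dz : disk z) by (unfold disk in *; lra).
        assert (Nd : psi z - psi z0 <> 0) by (intro E; apply Ne, Hi; auto; now apply Ceq_minus).
        assert (Nh := Hne z ltac:(lra)).
        set (w := (psi z - psi z0) / (h z - c)).
        assert (Nw : w <> 0).
        { apply Cmult_neq_0; [exact Nd|]. intro E. apply (f_equal Cmod) in E. rewrite Cmod_inv, Cmod_0 in E by exact Nh.
          generalize (Rinv_0_lt_compat _ (proj1 (Cmod_gt_0 _) Nh)). lra. }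
        rewrite re_inv_scale by exact Nw.
        apply Rmult_le_pos; [|apply Rmult_le_pos; apply Cmod_ge_0].
        (* Each of the three contributions to [/ w] has nonnegative real part: [gam] by hypothesis,
           the others by convexity on the circle. *)
        replace (/ w) with (gam + zder psi z / (psi z - psi z0) - RtoC t * (zder psi z0 / (psi z - psi z0))).
        * rewrite re_minus, re_plus, re_scal_l.
          generalize (convex_zder_div_ge psi Hpsi z z0 Hz Nz Ne Heq) (convex_zder_div_le psi Hpsi z z0 Hz Nz Ne ltac:(lra)). nra.
        * unfold w. unfold h, c in *. field. split; auto. }
  (* At [z0 - s z0] the quotient equals [s] times [P], and [P] takes the value [- 1 / (1 - t) < 0]
     at [s = 0]; moving inward from [z0] thus makes the real part negative. *)
  set (P := fun z => - (slope psi z0 z * z0) / (h z - c)).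
  assert (HcP : pcont (fun s => P (z0 - RtoC s * z0)) 0).
  { apply continuous_ccomp.
    - apply continuous_cminus; [apply continuous_const|].
      apply continuous_cmult; [apply continuous_RtoC, continuous_id|apply continuous_const].
    - replace (z0 - 0 * z0) with z0 by ring.
      apply ccont_mult.
      + apply ccont_opp, ccont_mult; [|apply ccont_const]. now apply analytic_at_ccont, analytic_at_slope; apply Ha.
      + apply ccont_inv; [|apply Hne; lra]. apply ccont_minus; [now apply analytic_at_ccont, Hh|apply ccont_const]. }
  assert (NA := convex_zder_ne_0 psi Hpsi z0 Hz Nz).
  assert (N1t : RtoC (1 - t) <> 0) by (intro E; apply RtoC_inj in E; lra).
  assert (EP : P (z0 - 0 * z0) = RtoC (- / (1 - t))).
  { replace (z0 - 0 * z0) with z0 by ring. unfold P. rewrite slope_diag.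
    replace (h z0 - c) with (RtoC (1 - t) * zder psi z0) by (unfold h, c; rewrite RtoC_minus; ring).
    rewrite RtoC_opp, RtoC_inv by lra.
    replace (C_derive psi z0 * z0) with (zder psi z0) by (unfold zder; ring). field. auto. }
  apply continuous_Re_comp in HcP.
  assert (Hinv : (0 < / (1 - t))%R) by (apply Rinv_0_lt_compat; lra).
  destruct (proj1 (filterlim_locally _ _) HcP (mkposreal _ Hinv)) as [d Hd].
  set (s := Rmin (d / 2) (1 / 2)).
  assert (Hs : (0 < s)%R) by (apply Rmin_pos; [generalize (cond_pos d); lra|lra]).
  assert (Hs1 : (s <= 1 / 2)%R) by apply Rmin_r.
  assert (Hs2 : (s < d)%R) by (generalize (Rmin_l (d / 2) (1 / 2)) (cond_pos d); unfold s; lra).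
  assert (Hb : ball 0%R d s) by (change (Rabs (s - 0) < d)%R; rewrite Rminus_0_r, Rabs_pos_eq; lra).
  specialize (Hd s Hb).
  match type of Hd with ball ?x _ ?y => change (Rabs (y - x) < / (1 - t))%R in Hd end.
  rewrite EP, re_RtoC in Hd. apply Rabs_def2 in Hd.
  set (zs := z0 - RtoC s * z0) in *.
  assert (Hzs : (Cmod zs <= Cmod z0)%R).
  { unfold zs. replace (z0 - RtoC s * z0) with (RtoC (1 - s) * z0) by (rewrite RtoC_minus; ring).
    rewrite Cmod_mult, Cmod_R, Rabs_pos_eq by lra. generalize (Cmod_ge_0 z0). nra. }
  specialize (HG zs Hzs).
  rewrite slope_spec in HG.
  replace (slope psi z0 zs * (zs - z0) / (h zs - c)) with (RtoC s * P zs) in HG.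
  2:{ unfold P. replace (zs - z0) with (- (RtoC s * z0)) by (unfold zs; ring). field. now apply Hne. }
  rewrite re_scal_l in HG. nra.
Qed.

(** * Differential subordination and superordination *)

(** A gap argument: [|W - V|] is continuous along the segment and is either 0 or at least [d / 2],
    so it cannot pass through [d / 4] and stays 0. This continues the equality of two branches from
    one point to another. *)
Lemma segment_eq (V W : C -> C) (c x y : C) (d : R) :
  (0 < d)%R -> W x = V x ->
  (forall s, (0 <= s <= 1)%R -> ccont W (x + RtoC s * (y - x)) /\ ccont V (x + RtoC s * (y - x)) /\
     (Cmod (V (x + RtoC s * (y - x))%C - c) < d / 2)%R /\
     ((Cmod (W (x + RtoC s * (y - x))%C - c) < d)%R -> W (x + RtoC s * (y - x)) = V (x + RtoC s * (y - x)))) ->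
  W y = V y.
Proof.
  intros Hd E0 H.
  set (p := fun s => x + RtoC s * (y - x)).
  set (e := fun s => Cmod (W (p s) - V (p s))).
  assert (Hdi : forall s, (0 <= s <= 1)%R -> e s = 0%R \/ (d / 2 <= e s)%R).
  { intros s Hs. destruct (H s Hs) as [_ [_ [B D]]]. fold (p s) in B, D. unfold e.
    destruct (Rlt_le_dec (Cmod (W (p s) - c)) d) as [Hl|Hl].
    - left. rewrite D by exact Hl. replace (V (p s) - V (p s)) with (RtoC 0) by ring. apply Cmod_0.
    - right. assert (Ht := Cmod_triangle (W (p s) - V (p s)) (V (p s) - c)).
      replace (W (p s) - V (p s) + (V (p s) - c)) with (W (p s) - c) in Ht by ring. lra. }
  assert (p0 : p 0%R = x) by (unfold p; ring).
  assert (p1 : p 1%R = y) by (unfold p; ring).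
  apply Ceq_minus, Cmod_eq_0. rewrite <- p1. change (e 1%R = 0%R).
  destruct (Hdi 1%R ltac:(lra)) as [E1|E1]; [exact E1|exfalso].
  destruct (Ranalysis5.IVT_interv (fun s => e s - d / 4)%R 0 1) as [s [Hs Es]].
  - intros s Hs. apply continuity_pt_filterlim.
    destruct (H s Hs) as [A [B _]].
    apply (continuous_minus (V := R_NormedModule) e (fun _ => (d / 4)%R)); [|apply continuous_const].
    apply (continuous_Cmod_comp _ (fun s => W (p s) - V (p s))).
    assert (Hp : pcont p s).
    { apply continuous_cplus; [apply continuous_const|].
      apply continuous_cmult; [apply continuous_RtoC, continuous_id|apply continuous_const]. }
    apply continuous_cminus; now apply continuous_ccomp.
  - lra.
  - unfold e. rewrite p0, E0. replace (V x - V x) with (RtoC 0) by ring. rewrite Cmod_0. lra.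
  - lra.
  - destruct (Hdi s Hs) as [E2|E2]; lra.
Qed.

(** Testing with [u = -1 + i y] gives [1 <= Re om + y Im om] for every [y], which forces
    [Im om = 0]. This extracts the real ratio in Jack's lemma. *)
Lemma real_ge_1_of_inward (om : C) :
  (forall u, (Re u < 0)%R -> (Re (om * u) <= Re u)%R) -> exists m, (1 <= m)%R /\ om = RtoC m.
Proof.
  intros H.
  assert (Hy : forall y, (1 <= Re om + y * Im om)%R).
  { intros y. specialize (H (-1, y)%R). rewrite re_mult in H. change (Re (-1, y)%R) with (-1)%R in H.
    change (Im (-1, y)%R) with y in H. lra. }
  assert (Him : Im om = 0%R).
  { destruct (Req_dec (Im om) 0) as [E|N]; [exact E|exfalso].
    specialize (Hy (- Re om / Im om)%R). unfold Rdiv in Hy. rewrite Rmult_assoc, Rinv_l in Hy by exact N. lra. }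
  exists (Re om). split; [specialize (Hy 0%R); lra|].
  apply injective_projections; [reflexivity|exact Him].
Qed.

(** The Miller--Mocanu contact lemma: at the bad point [z0] of least modulus the lift [q^-1 o k] reaches
    the unit circle; it extends across [z0] through the local inverse of [g], and Jack's lemma applies. *)
Lemma boundary_contact (q g k : C -> C) (zs : C) :
  (forall z, disk z -> g z = q z) ->
  (forall z, (Cmod z <= 1)%R -> ~ pole_set q z -> analytic_at g z) ->
  injective_on (fun z => (Cmod z <= 1)%R /\ ~ pole_set q z) g ->
  (forall zeta, circle zeta -> ~ pole_set q zeta -> C_derive g zeta <> 0) ->
  analytic_on disk k -> k 0 = q 0 -> disk zs -> ~ image disk q (k zs) ->
  exists z0 zeta0 m, disk z0 /\ z0 <> 0 /\ circle zeta0 /\ ~ pole_set q zeta0 /\ (1 <= m)%R /\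
    k z0 = g zeta0 /\ z0 * C_derive k z0 = RtoC m * (zeta0 * C_derive g zeta0).
Proof.
  intros Hgq Hga Hgi Hg' Hk H0 Hzs Hbad.
  assert (Hnp : forall z, disk z -> ~ pole_set q z).
  { intros z Hz [Hc _]. unfold disk, circle in *. lra. }
  assert (Hq : analytic_on disk q).
  { intros z Hz. apply (analytic_at_ext_loc g).
    - apply (filter_imp (F := cnear z)) with (2 := disk_open z Hz). exact Hgq.
    - apply Hga; [unfold disk in Hz; lra|now apply Hnp]. }
  assert (Hi : injective_on disk q).
  { intros x y Hx Hy E. apply Hgi; [split; [unfold disk in Hx; lra|now apply Hnp]|split; [unfold disk in Hy; lra|now apply Hnp]|].
    now rewrite !Hgq. }
  (* The points where lifting fails form a closed set, as the image of [q] is open. One of least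
     modulus is taken, so that [k] lifts on the whole open ball of radius [|z0|]. *)
  destruct (compact_min (fun z => (Cmod z <= Cmod zs)%R /\ ~ image disk q (k z)) Cmod (Cmod zs)) as [z0 [[Hz0 Hb0] Hmin]].
  - exists zs. split; [lra|exact Hbad].
  - intros z [Hz _]. exact Hz.
  - intros z Hz. assert (Hle : (Cmod z <= Cmod zs)%R).
    { apply (closed_ball_closed (Cmod zs) z). intros e He. destruct (Hz e He) as [x [[Hx _] Dx]]. now exists x. }
    split; [exact Hle|]. intros [x [Dx Ex]].
    assert (Dz : disk z) by now apply (disk_le _ zs).
    destruct (proj1 (cnear_ex _ _) (image_open disk q k z x disk_open Hq Hi Dx Ex (analytic_at_ccont _ _ (Hk z Dz)) 1%R Rlt_0_1)) as [d [Hd Hn]].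
    destruct (Hz d Hd) as [y [[_ Ny] Dy]]. destruct (Hn y Dy) as [x' [Dx' [Ex' _]]].
    apply Ny. now exists x'.
  - intros z _ e He. apply cnear_ex. exists e. split; [exact He|]. intros x Hx _.
    eapply Rle_lt_trans; [apply Cmod_sub_le|exact Hx].
  - assert (Dz0 : disk z0) by now apply (disk_le _ zs).
    assert (Nz0 : z0 <> 0).
    { intros ->. apply Hb0. exists 0. split; [apply disk_0|now symmetry]. }
    set (r0 := Cmod z0). assert (Hr0 : (0 < r0)%R) by now apply Cmod_gt_0.
    assert (Hr1 : (r0 < 1)%R) by exact Dz0.
    assert (Him : forall z, (Cmod z < r0)%R -> analytic_at k z /\ image disk q (k z)).
    { intros z Hz. split; [apply Hk, (disk_le _ z0); auto; now left|].
      apply NNPP. intros Hn. assert (H := Hmin z). unfold r0 in *. 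
      assert (Cmod z0 <= Cmod z)%R; [|lra]. apply H. split; [lra|exact Hn]. }
    set (W := lift disk q k).
    assert (HW : forall z, (Cmod z < r0)%R -> disk (W z) /\ q (W z) = k z).
    { intros z Hz. now apply lift_spec, Him. }
    assert (HWs : forall z, (Cmod z < r0)%R -> (r0 * Cmod (W z) <= Cmod z)%R).
    { intros z Hz. apply (lift_schwarz q k r0 z); auto. now split. }
    assert (HWa : forall z, (Cmod z < r0)%R -> ccont W z).
    { intros z Hz. destruct (Him z Hz) as [A B]. apply lift_ccont; auto. exact disk_open. now apply analytic_at_ccont. }
    (* Points approaching [z0] along its radius. [W] is not known to have a limit there, so [zeta0]
       will only be a cluster value of [W (xn n)]. *)
    set (xn := fun n => RtoC (1 - / (INR n + 2)) * z0).
    assert (Hinv : forall n, (0 < / (INR n + 2) <= / 2)%R).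
    { intros n. assert (Hp := pos_INR n). split; [apply Rinv_0_lt_compat; lra|apply Rinv_le_contravar; lra]. }
    assert (Hxn : forall n, (Cmod (xn n) < r0)%R).
    { intros n. unfold xn. specialize (Hinv n). rewrite Cmod_mult, Cmod_R, Rabs_pos_eq by lra. fold r0. nra. }
    assert (Hxd : forall n, Cmod (xn n - z0) = (/ (INR n + 2) * r0)%R).
    { intros n. unfold xn. replace (RtoC (1 - / (INR n + 2)) * z0 - z0) with (- (RtoC (/ (INR n + 2)) * z0)) by (rewrite RtoC_minus; ring).
      specialize (Hinv n). rewrite Cmod_opp, Cmod_mult, Cmod_R, Rabs_pos_eq by lra. reflexivity. }
    assert (Hxlim : forall e, (0 < e)%R -> exists N, forall n, (N <= n)%nat -> (Cmod (xn n - z0) < e)%R).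
    { intros e He. destruct (archimed_cor1 e He) as [K [HK1 HK2]]. exists K. intros n Hn. rewrite Hxd.
      assert (/ (INR n + 2) <= / INR K)%R.
      { apply Rinv_le_contravar; [now apply lt_0_INR|]. assert (INR K <= INR n)%R by (apply le_INR; lia). lra. }
      specialize (Hinv n). nra. }
    destruct (bounded_cluster (fun n => W (xn n)) 1) as [zeta0 Hclu].
    { intros n. left. apply HW, Hxn. }
    assert (Hpick : forall e d P, (0 < e)%R -> (0 < d)%R -> cnear z0 P ->
        exists n, (Cmod (W (xn n) - zeta0) < e)%R /\ (Cmod (xn n - z0) < d)%R /\ P (xn n)).
    { intros e d P He Hd HP. destruct (proj1 (cnear_ex _ _) HP) as [d' [Hd' HP']].
      destruct (Hxlim (Rmin d d')) as [N HN]; [now apply Rmin_pos|].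
      destruct (Hclu e He N) as [n [Hn Dn]]. exists n. specialize (HN n Hn). split; [exact Dn|split].
      - eapply Rlt_le_trans; [exact HN|apply Rmin_l].
      - apply HP'. eapply Rlt_le_trans; [exact HN|apply Rmin_r]. }
    assert (Hkc := analytic_at_ccont _ _ (Hk z0 Dz0)).
    assert (Hz1 : (Cmod zeta0 <= 1)%R).
    { apply (closed_ball_closed 1 zeta0). intros e He. destruct (Hclu e He O) as [n [_ Hn]].
      exists (W (xn n)). split; [left; apply HW, Hxn|exact Hn]. }
    (* At a point of the pole set the values [q (W (xn n)) = k (xn n)] would become arbitrarily
       large, but they stay near [k z0]. *)
    assert (Hpole : ~ pole_set q zeta0).
    { intros [_ Hlim].
      assert (Hev : Rbar_locally p_infty (fun x => (Cmod (k z0) + 1 < x)%R)) by (exists (Cmod (k z0) + 1)%R; auto).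
      apply Hlim in Hev. apply locally_C in Hev.
      destruct (proj1 (cnear_ex _ _) Hev) as [d [Hd Hd']].
      destruct (Hpick d 1%R _ Hd Rlt_0_1 (proj1 (ccont_eps k z0) Hkc 1%R Rlt_0_1)) as [n [A [_ B]]].
      specialize (Hd' _ A (proj1 (HW _ (Hxn n)))). cbv beta in Hd'. rewrite (proj2 (HW _ (Hxn n))) in Hd'.
      assert (Ht := Cmod_triangle (k z0) (k (xn n) - k z0)).
      replace (k z0 + (k (xn n) - k z0)) with (k (xn n)) in Ht by ring. lra. }
    assert (Hg0 := Hga zeta0 Hz1 Hpole).
    assert (HgW : forall z, (Cmod z < r0)%R -> g (W z) = k z).
    { intros z Hz. rewrite Hgq; now apply HW. }
    assert (Eg : g zeta0 = k z0).
    { apply Ceq_minus, Cmod_eq_0, Rle_antisym; [|apply Cmod_ge_0]. apply le_epsilon. intros e He.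
      destruct (proj1 (cnear_ex _ _) (proj1 (ccont_eps g zeta0) (analytic_at_ccont _ _ Hg0) (e / 2)%R ltac:(lra))) as [d [Hd Hd']].
      destruct (Hpick d 1%R _ Hd Rlt_0_1 (proj1 (ccont_eps k z0) Hkc (e / 2)%R ltac:(lra))) as [n [A [_ B]]].
      specialize (Hd' _ A). rewrite HgW in Hd' by apply Hxn.
      replace (g zeta0 - k z0) with ((k (xn n) - k z0) - (k (xn n) - g zeta0)) by ring.
      eapply Rle_trans; [apply Cmod_triangle|]. rewrite Cmod_opp. lra. }
    (* A cluster value inside the disk would exhibit [k z0] in the image of [q]. *)
    assert (Hcirc : circle zeta0).
    { destruct Hz1 as [Hl|E]; [exfalso|exact E]. apply Hb0. exists zeta0. split; [exact Hl|]. now rewrite <- Hgq. }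
    assert (Hd0 := Hg' zeta0 Hcirc Hpole).
    destruct (locally_injective g zeta0 Hg0 Hd0) as [d1 [Hd1 Hinj1]].
    destruct (proj1 (cnear_ex _ _) (analytic_at_locally g zeta0 Hg0)) as [d2 [Hd2 Han2]].
    set (d := Rmin d1 d2).
    assert (Hd : (0 < d)%R) by now apply Rmin_pos.
    set (U := fun x => (Cmod (x - zeta0) < d)%R).
    assert (HUo : copen U) by exact (ball_open zeta0 d).
    assert (HUa : analytic_on U g).
    { intros x Hx. apply Han2. eapply Rlt_le_trans; [exact Hx|apply Rmin_r]. }
    assert (HUi : injective_on U g).
    { intros x y Hx Hy. apply Hinj1; eapply Rlt_le_trans; eauto; apply Rmin_l. }
    assert (HU0 : U zeta0) by (unfold U; replace (zeta0 - zeta0) with (RtoC 0) by ring; now rewrite Cmod_0).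
    (* [V] is defined on a full neighbourhood of [z0] and can be differentiated there, whereas the
       Schwarz bound is known for [W]; the two are shown to agree near [z0] inside the ball. *)
    set (V := lift U g k).
    assert (EV0 : V z0 = zeta0) by (apply lift_eq; auto).
    assert (Hnear := image_open U g k z0 zeta0 HUo HUa HUi HU0 Eg Hkc (d / 2)%R ltac:(lra)).
    destruct (proj1 (cnear_ex _ _) (filter_and _ _ Hnear (disk_open z0 Dz0))) as [dl [Hdl HV']].
    assert (HV : forall z, (Cmod (z - z0) < dl)%R -> U (V z) /\ g (V z) = k z /\ (Cmod (V z - zeta0) < d / 2)%R /\ ccont V z).
    { intros z Hz. destruct (HV' z Hz) as [[x' [Ux [Ex Dx]]] Dz].
      assert (EV : V z = x') by (apply lift_eq; auto). rewrite EV. repeat split; auto.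
      apply lift_ccont; auto; [now exists x'|]. apply analytic_at_ccont, Hk, Dz. }
    destruct (Hpick d dl (fun _ => True) Hd Hdl (filter_forall _ (fun _ => I))) as [n [Dn1 [Dn2 _]]].
    assert (EWV : forall z, (Cmod (z - z0) < dl)%R -> (Cmod z < r0)%R -> (Cmod (W z - zeta0) < d)%R -> W z = V z).
    { intros z A B Dz. apply HUi; [exact Dz|now apply HV|]. rewrite HgW by exact B. symmetry. now apply HV. }
    (* The branches agree at one [xn n] close to [z0]. The intersection of the two balls is convex,
       so the segment from there to [z] stays in it and the equality propagates. *)
    assert (EWV2 : forall z, (Cmod (z - z0) < dl)%R -> (Cmod z < r0)%R -> W z = V z).
    { intros z A B. apply (segment_eq V W zeta0 (xn n) z d Hd).
      - apply EWV; auto.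
      - intros s Hs.
        assert (C1 : (Cmod (xn n + RtoC s * (z - xn n) - z0) < dl)%R) by now apply Cmod_convex.
        assert (C2 : (Cmod (xn n + RtoC s * (z - xn n)) < r0)%R).
        { assert (C3 := Cmod_convex z (xn n) 0 r0 s Hs). 
          assert (E0 : forall u : C, u - 0 = u) by (intros; ring). rewrite !E0 in C3. apply C3; auto. }
        split; [now apply HWa|]. split; [now apply HV|]. split; [now apply HV|]. now apply EWV. }
    assert (DV := lift_is_cderive U g k z0 HUo HUa HUi (ex_intro _ zeta0 (conj HU0 Eg)) (Hk z0 Dz0)).
    fold V in DV. rewrite EV0 in DV.
    set (l := C_derive k z0 / C_derive g zeta0) in *.
    assert (Mz : Cmod zeta0 = 1%R) by exact Hcirc.
    destruct (real_ge_1_of_inward (Cconj zeta0 * l * z0)) as [m [Hm Em]].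
    (* For [Re u < 0] the point [z0 (1 + t u)] lies inside the ball for small [t > 0], so Schwarz's
       lemma gives [|V| <= |1 + t u|] there. Differentiating at [t = 0], where [|V| = 1], yields the
       inequality. *)
    { intros u Hu.
      assert (Mu := Cmod_ge_0 u).
      assert (Hu0 : (0 < Cmod u)%R).
      { apply Cmod_gt_0. intros ->. change (Re 0) with 0%R in Hu. lra. }
      (* The first bound makes [|1 + t u| < 1], the second keeps the point where [V] is
         controlled. *)
      set (dt := Rmin (- Re u / (Cmod u * Cmod u)) (dl / (Cmod z0 * Cmod u))).
      assert (Hz0u : (0 < Cmod z0 * Cmod u)%R) by (apply Rmult_lt_0_compat; auto).
      assert (Hdt : (0 < dt)%R) by (apply Rmin_pos; apply Rdiv_lt_0_compat; nra).
      assert (H := cderive_Cmod_growth V z0 l (z0 * u) (2 * Re u) (Cmod u * Cmod u) dt DV Hdt).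
      rewrite EV0 in H.
      replace (Cconj zeta0 * (l * (z0 * u))) with (Cconj zeta0 * l * z0 * u) in H by ring.
      assert (2 * Re (Cconj zeta0 * l * z0 * u) <= 2 * Re u)%R; [|lra].
      apply H. intros t Ht.
      assert (Ht1 : (t * (Cmod u * Cmod u) < - Re u)%R).
      { assert (Hl := Rlt_le_trans _ _ _ (proj2 Ht) (Rmin_l _ _)).
        apply (Rmult_lt_compat_r (Cmod u * Cmod u)) in Hl; [|nra].
        unfold Rdiv in Hl. rewrite Rmult_assoc, Rinv_l in Hl by nra. lra. }
      assert (Ht2 : (t * (Cmod z0 * Cmod u) < dl)%R).
      { assert (Hl := Rlt_le_trans _ _ _ (proj2 Ht) (Rmin_r _ _)).
        apply (Rmult_lt_compat_r (Cmod z0 * Cmod u)) in Hl; [|nra].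
        unfold Rdiv in Hl. rewrite Rmult_assoc, Rinv_l in Hl by nra. lra. }
      set (z := z0 + RtoC t * (z0 * u)).
      assert (Hsq : (Cmod (1 + RtoC t * u) * Cmod (1 + RtoC t * u) = 1 + t * (2 * Re u) + t * t * (Cmod u * Cmod u))%R).
      { rewrite !Cmod_sqr, re_plus, im_plus, re_scal_l, im_scal_l, re_RtoC, im_RtoC. ring. }
      assert (Ez : Cmod z = (r0 * Cmod (1 + RtoC t * u))%R).
      { unfold z, r0. rewrite <- Cmod_mult. f_equal. ring. }
      assert (Hlt1 : (Cmod (1 + RtoC t * u) < 1)%R).
      { generalize (Cmod_ge_0 (1 + RtoC t * u)). nra. }
      assert (Hz : (Cmod z < r0)%R) by (rewrite Ez; nra).
      assert (Hzd : (Cmod (z - z0) < dl)%R).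
      { replace (z - z0) with (RtoC t * (z0 * u)) by (unfold z; ring).
        rewrite !Cmod_mult, Cmod_R, Rabs_pos_eq by lra. exact Ht2. }
      rewrite <- (EWV2 z Hzd Hz), Mz.
      assert (HWz := HWs z Hz). rewrite Ez in HWz.
      assert (HWz2 : (Cmod (W z) <= Cmod (1 + RtoC t * u))%R) by (apply (Rmult_le_reg_l r0); lra).
      assert (Hp := Cmod_ge_0 (W z)).
      rewrite Rmult_1_r, <- Hsq. nra. }
    exists z0, zeta0, m. repeat split; auto.
    assert (Ecc : zeta0 * Cconj zeta0 = 1).
    { rewrite <- Cmod2_conj, Mz. simpl. f_equal. ring. }
    replace (RtoC m * (zeta0 * C_derive g zeta0)) with (zeta0 * Cconj zeta0 * (l * z0 * C_derive g zeta0)) by (rewrite <- Em; ring).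
    rewrite Ecc. unfold l. field. exact Hd0.
Qed.

Lemma C_derive_scale (f : C -> C) (c z : C) :
  analytic_at f (c * z) -> C_derive (fun x => f (c * x)) z = c * C_derive f (c * z).
Proof.
  intros H. apply is_C_derive_unique. rewrite Cmult_comm.
  apply (is_cderive_comp f (fun x => c * x)); [now apply analytic_at_is_cderive|apply is_cderive_linear].
Qed.

Lemma analytic_at_scale (f : C -> C) (c z : C) : analytic_at f (c * z) -> analytic_at (fun x => f (c * x)) z.
Proof.
  intros H. apply (analytic_at_comp f (fun x => c * x)); [exact H|].
  apply analytic_at_mult; [apply analytic_at_const|apply analytic_at_id].
Qed.

(** After a dilation by [rho] with [|z| < rho < 1], [psi] is analytic and injective on the closed
    disk and serves as its own boundary extension. Contact then equates a value of [h(psi)] at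
    [w (rho z0)], a point of modulus less than [rho], with the value that [convex_avoid]
    excludes. *)
Theorem convex_subordination (psi q w : C -> C) (gam : C) :
  convex_univalent psi -> analytic_on disk q -> q 0 = psi 0 -> (0 <= Re gam)%R ->
  (forall z, disk z -> (Cmod (w z) <= Cmod z)%R) ->
  (forall z, disk z -> gam * q z + zder q z = gam * psi (w z) + zder psi (w z)) ->
  subordinate q psi.
Proof.
  intros Hpsi Hq H0 Hgam Hw HE. destruct (Hpsi) as [[Ha Hi] _].
  apply subordinate_of_image; auto; [now split|].
  intros z Hz. apply NNPP. intros Hno.
  set (rho := ((Cmod z + 1) / 2)%R).
  assert (Hz0 := Cmod_ge_0 z). assert (Hz1 : (Cmod z < 1)%R) by exact Hz.
  assert (Hrho : (0 < rho < 1 /\ Cmod z < rho)%R) by (unfold rho; lra).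
  assert (Mr : Cmod (RtoC rho) = rho) by (rewrite Cmod_R; apply Rabs_pos_eq; lra).
  assert (Nr : RtoC rho <> 0) by (apply Cmod_gt_0; lra).
  assert (Hsc : forall x, (Cmod x <= 1)%R -> disk (RtoC rho * x)).
  { intros x Hx. unfold disk. rewrite Cmod_mult, Mr. generalize (Cmod_ge_0 x). nra. }
  assert (Hne : forall x, disk x -> C_derive psi x <> 0).
  { intros x Hx. apply (injective_on_C_derive_ne disk); auto. exact disk_open. }
  destruct (boundary_contact (fun x => psi (RtoC rho * x)) (fun x => psi (RtoC rho * x)) (fun x => q (RtoC rho * x)) (z / RtoC rho))
    as [z0 [zeta0 [m [Dz0 [Nz0 [Cz [_ [Hm [E1 E2]]]]]]]]].
  - auto.
  - intros x Hx _. now apply analytic_at_scale, Ha, Hsc.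
  - intros x y [Hx _] [Hy _] E. apply Hi in E; [|now apply Hsc|now apply Hsc].
    replace x with (/ RtoC rho * (RtoC rho * x)) by (field; exact Nr). rewrite E. field. exact Nr.
  - intros zeta Hc _. rewrite C_derive_scale by (apply Ha, Hsc; unfold circle in Hc; lra).
    apply Cmult_neq_0; [exact Nr|]. apply Hne, Hsc. unfold circle in Hc; lra.
  - intros x Hx. apply analytic_at_scale, Hq, Hsc. unfold disk in Hx; lra.
  - now replace (RtoC rho * 0) with (RtoC 0) by ring.
  - unfold disk. rewrite Cmod_div, Mr by exact Nr.
    apply (Rmult_lt_reg_r rho); [lra|]. unfold Rdiv. rewrite Rmult_assoc, Rinv_l; lra.
  - replace (RtoC rho * (z / RtoC rho)) with z by (field; exact Nr).
    intros [x [Hx Ex]]. apply Hno. exists (RtoC rho * x). split; [|exact Ex]. apply Hsc. unfold disk in Hx; lra.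
  - assert (Dz : disk (RtoC rho * z0)) by (apply Hsc; unfold disk in Dz0; lra).
    assert (Dzeta : disk (RtoC rho * zeta0)) by (apply Hsc; unfold circle in Cz; lra).
    rewrite !C_derive_scale in E2 by auto.
    assert (Hlt : (Cmod (w (RtoC rho * z0)%C) < Cmod (RtoC rho * zeta0))%R).
    { eapply Rle_lt_trans; [now apply Hw|]. rewrite !Cmod_mult, Mr. unfold circle in Cz. rewrite Cz. unfold disk in Dz0. nra. }
    apply (convex_avoid psi Hpsi gam Hgam _ _ m Dzeta Hlt Hm).
    rewrite <- HE by exact Dz. rewrite E1. f_equal. unfold zder.
    replace (RtoC rho * z0 * C_derive q (RtoC rho * z0)) with (z0 * (RtoC rho * C_derive q (RtoC rho * z0))) by ring.
    rewrite E2. ring.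
Qed.

(** At the contact [zder g] is [1 / m] times [zder psi], so the boundary value of [gam g + zder g]
    is attained by [h(psi)] and hence by [Phi] at an interior point [w1]. Points near [zeta0] and
    near [w1] then share values, against the injectivity of [Phi]. *)
Theorem convex_superordination (psi q w : C -> C) (gam : C) :
  convex_univalent psi -> class_Q q -> q 0 = psi 0 -> (0 <= Re gam)%R ->
  injective_on disk (fun z => gam * q z + zder q z) ->
  (forall z, disk z -> (Cmod (w z) <= Cmod z)%R) ->
  (forall z, disk z -> gam * psi z + zder psi z = gam * q (w z) + zder q (w z)) ->
  subordinate psi q.
Proof.
  intros Hpsi HQ H0 Hgam Hinj Hw HE. destruct (Hpsi) as [[Ha Hi] _].
  destruct HQ as [g [Hgq [Hga [Hgi Hg']]]].
  assert (Hnp : forall z, disk z -> ~ pole_set q z).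
  { intros z Hz [Hc _]. unfold disk, circle in *. lra. }
  assert (Hgan : forall z, (Cmod z <= 1)%R -> ~ pole_set q z -> analytic_at g z) by (intros; apply Hga; now split).
  assert (Hgd : forall z, disk z -> analytic_at g z) by (intros z Hz; apply Hgan; [unfold disk in Hz; lra|now apply Hnp]).
  assert (Hn : forall z, disk z -> cnear z (fun x => g x = q x)).
  { intros z Hz. apply (filter_imp (F := cnear z)) with (2 := disk_open z Hz). exact Hgq. }
  assert (Hq : analytic_on disk q).
  { intros z Hz. apply (analytic_at_ext_loc g); auto. }
  assert (Hqi : injective_on disk q).
  { intros x y Hx Hy E. apply Hgi; [split; [unfold disk in Hx; lra|now apply Hnp]|split; [unfold disk in Hy; lra|now apply Hnp]|].
    now rewrite !Hgq. }
  apply subordinate_of_image; [now split|exact Ha|now symmetry|].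
  intros z Hz. apply NNPP. intros Hno.
  destruct (boundary_contact q g psi z Hgq Hgan Hgi Hg' Ha (eq_sym H0) Hz Hno)
    as [z0 [zeta0 [m [Dz0 [Nz0 [Cz [Pz [Hm [E1 E2]]]]]]]]].
  assert (Him : (0 < / m <= 1)%R).
  { split; [apply Rinv_0_lt_compat; lra|]. rewrite <- Rinv_1. apply Rinv_le_contravar; lra. }
  destruct (convex_attain psi Hpsi gam Hgam z0 (/ m) Dz0 Nz0 Him) as [z1 [Hz1 Ez1]].
  assert (Dz1 : disk z1) by now apply (disk_le _ z0).
  rewrite HE in Ez1 by exact Dz1.
  assert (Nm : RtoC m <> 0) by (intro E; apply RtoC_inj in E; lra).
  set (Psi := fun x => gam * g x + zder g x).
  set (Phi := fun x => gam * q x + zder q x).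
  set (w1 := w z1) in *.
  assert (EP : Phi w1 = Psi zeta0).
  { unfold Phi, Psi. rewrite Ez1, E1. f_equal. unfold zder. rewrite E2, RtoC_inv by lra. field. exact Nm. }
  assert (Dw1 : disk w1) by (apply (disk_le _ z1); auto; now apply Hw).
  assert (HPhi : analytic_on disk Phi).
  { intros x Hx. apply analytic_at_plus; apply analytic_at_mult;
      auto using analytic_at_const, analytic_at_id, analytic_at_C_derive. }
  assert (HPsi : analytic_at Psi zeta0).
  { assert (Hg0 : analytic_at g zeta0) by (apply Hgan; [unfold circle in Cz; lra|exact Pz]).
    apply analytic_at_plus; apply analytic_at_mult;
      auto using analytic_at_const, analytic_at_id, analytic_at_C_derive. }
  assert (Eq : forall x, disk x -> Psi x = Phi x).
  { intros x Hx. unfold Psi, Phi, zder. rewrite (C_derive_ext_loc g q x) by auto. now rewrite Hgq. }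
  (* Half the distance from [w1] to the circle: points within [rho] of [w1] have modulus below
     [1 - rho], while [y] below has modulus [1 - s >= 1 - rho / 2]. *)
  set (rho := ((1 - Cmod w1) / 2)%R).
  assert (Hrho : (0 < rho)%R) by (unfold disk in Dw1; unfold rho; lra).
  destruct (proj1 (cnear_ex _ _) (image_open disk Phi Psi zeta0 w1 disk_open HPhi Hinj Dw1 EP (analytic_at_ccont _ _ HPsi) rho Hrho)) as [d [Hd Hd']].
  set (s := Rmin (d / 2) (rho / 2)).
  assert (Hs : (0 < s)%R) by (apply Rmin_pos; lra).
  assert (Hs1 : (s <= d / 2)%R) by apply Rmin_l.
  assert (Hs2 : (s <= rho / 2)%R) by apply Rmin_r.
  assert (Hw0 := Cmod_ge_0 w1).
  assert (Mz : Cmod zeta0 = 1%R) by exact Cz.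
  set (y := RtoC (1 - s) * zeta0).
  assert (My : Cmod y = (1 - s)%R).
  { unfold y. rewrite Cmod_mult, Mz, Cmod_R, Rabs_pos_eq; [ring|]. unfold rho in *; lra. }
  assert (Dy : disk y) by (unfold disk; lra).
  destruct (Hd' y) as [x' [Dx' [Ex' Hx']]].
  { replace (y - zeta0) with (- (RtoC s * zeta0)) by (unfold y; rewrite RtoC_minus; ring).
    rewrite Cmod_opp, Cmod_mult, Mz, Cmod_R, Rabs_pos_eq; lra. }
  rewrite Eq in Ex' by exact Dy. apply Hinj in Ex'; auto. subst x'.
  generalize (Rle_abs (Cmod y - Cmod w1)) (Cmod_sub_le y w1). rewrite My. unfold rho in *. lra.
Qed.

(** * Logarithms and powers on the disk *)

Lemma Cexp_plus (x y : C) : Cexp (x + y) = Cexp x * Cexp y.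
Proof.
  unfold Cexp. rewrite re_plus, im_plus, exp_plus, cos_plus, sin_plus.
  apply injective_projections; simpl; ring.
Qed.
Lemma Cexp_0 : Cexp 0 = 1.
Proof. unfold Cexp. simpl. rewrite exp_0, cos_0, sin_0. apply injective_projections; simpl; ring. Qed.
Lemma Cexp_opp (x : C) : Cexp (- x) * Cexp x = 1.
Proof. rewrite <- Cexp_plus. replace (- x + x) with (RtoC 0) by ring. apply Cexp_0. Qed.
Lemma Cexp_ne_0 (x : C) : Cexp x <> 0.
Proof.
  intros E. assert (H := Cexp_opp x). rewrite E, Cmult_0_r in H. apply RtoC_inj in H. lra.
Qed.

(** Only the origin is computed, from the slopes of [exp], [cos] and [sin]; the error splits into
    three terms, whence [e / 3]. The addition formula carries the result to other points. *)
Lemma Cexp_is_cderive_0 : is_cderive Cexp 0 1.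
Proof.
  assert (Dexp : is_derive exp 0 1%R).
  { apply is_derive_Reals. rewrite <- exp_0. apply derivable_pt_lim_exp. }
  assert (Dcos : is_derive cos 0 0%R).
  { evar_last; [apply is_derive_Reals, derivable_pt_lim_cos|]. rewrite sin_0. apply Ropp_0. }
  assert (Dsin : is_derive sin 0 1%R).
  { evar_last; [apply is_derive_Reals, derivable_pt_lim_sin|]. apply cos_0. }
  assert (Cexp_cont : continuous exp 0%R) by (apply (ex_derive_continuous (K := R_AbsRing) (V := R_NormedModule) exp); now exists 1%R).
  destruct (proj1 (is_derive_slope _ _ _) Dexp) as [a [Ca [a0 Ea]]].
  destruct (proj1 (is_derive_slope _ _ _) Dcos) as [b [Cb [b0 Eb]]].
  destruct (proj1 (is_derive_slope _ _ _) Dsin) as [c [Cc [c0 Ec]]].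
  assert (HRe : forall h : R -> R, continuous h 0%R -> continuous (T := Cuni) (fun x => h (Re x)) (RtoC 0)).
  { intros h Hh. apply (@continuous_comp Cuni R_UniformSpace R_UniformSpace Re h); [|exact Hh].
    apply (continuous_Re_comp Cuni (fun x => x)), ccont_id. }
  assert (HIm : forall h : R -> R, continuous h 0%R -> continuous (T := Cuni) (fun x => h (Im x)) (RtoC 0)).
  { intros h Hh. apply (@continuous_comp Cuni R_UniformSpace R_UniformSpace Im h); [|exact Hh].
    apply (continuous_Im_comp Cuni (fun x => x)), ccont_id. }
  assert (K1 := HRe a Ca).
  assert (K2 := continuous_mult (K := R_AbsRing) _ _ _ (HRe exp Cexp_cont) (HIm b Cb)).
  assert (K3 := continuous_mult (K := R_AbsRing) _ _ _ (HRe exp Cexp_cont) (HIm c Cc)).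
  apply is_cderive_eps. intros e He.
  assert (He3 : (0 < e / 3)%R) by lra.
  generalize (filter_and _ _ (proj1 (filterlim_locally _ _) K1 (mkposreal _ He3))
    (filter_and _ _ (proj1 (filterlim_locally _ _) K2 (mkposreal _ He3)) (proj1 (filterlim_locally _ _) K3 (mkposreal _ He3)))).
  apply filter_imp. intros x [A [B D]].
  change (Rabs (a (Re x) - a 0%R) < e / 3)%R in A.
  change (Rabs (exp (Re x) * b (Im x) - exp 0 * b 0%R) < e / 3)%R in B.
  change (Rabs (exp (Re x) * c (Im x) - exp 0 * c 0%R) < e / 3)%R in D.
  specialize (Ea (Re x)). specialize (Eb (Im x)). specialize (Ec (Im x)).
  rewrite a0, b0, c0, exp_0, cos_0, sin_0 in *.
  replace (x - 0) with (x : C) by (generalize (x : C); intros; ring). rewrite Cexp_0.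
  assert (Ra := re_le_Cmod x). assert (Ia := im_le_Cmod x).
  eapply Rle_trans; [apply Cmod_le_Re_Im|].
  rewrite !re_minus, !im_minus, re_RtoC, im_RtoC, re_scal_l, im_scal_l.
  change (Re (Cexp x)) with (exp (Re x) * cos (Im x))%R.
  change (Im (Cexp x)) with (exp (Re x) * sin (Im x))%R.
  replace (exp (Re x) * cos (Im x) - 1 - 1 * Re x)%R
    with ((a (Re x) - 1) * Re x + (exp (Re x) * b (Im x) - 1 * 0) * Im x)%R.
  2:{ transitivity (exp (Re x) * (cos (Im x) - 1) + (exp (Re x) - 1) - Re x)%R; [rewrite Ea, Eb; ring|ring]. }
  replace (exp (Re x) * sin (Im x) - 0 - 1 * Im x)%R with ((exp (Re x) * c (Im x) - 1 * 1) * Im x)%R.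
  2:{ transitivity (exp (Re x) * (sin (Im x) - 0) - Im x)%R; [rewrite Ec; ring|ring]. }
  eapply Rle_trans; [apply Rplus_le_compat_r, Rabs_triang|]. rewrite !Rabs_mult.
  assert (HM := Cmod_ge_0 x).
  assert (P : forall y v, (Rabs y < e / 3)%R -> (Rabs v <= Cmod x)%R -> (Rabs y * Rabs v <= e / 3 * Cmod x)%R).
  { intros y v Hy Hv. apply Rmult_le_compat; auto using Rabs_pos; lra. }
  generalize (P _ _ A Ra) (P _ _ B Ia) (P _ _ D Ia). lra.
Qed.

Lemma Cexp_is_cderive (z : C) : is_cderive Cexp z (Cexp z).
Proof.
  apply (is_cderive_ext_loc (fun x => Cexp z * Cexp (x - z))).
  - apply filter_forall. intros x. rewrite <- Cexp_plus. f_equal.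
    apply (eq_trans (y := z + (x - z))); [reflexivity|ring].
  - eapply is_cderive_eq.
    + apply is_cderive_scal.
      apply (is_cderive_comp Cexp (fun x => x - z)).
      * replace (z - z) with (RtoC 0) by ring. apply Cexp_is_cderive_0.
      * apply is_cderive_minus; [apply is_cderive_id|apply is_cderive_const].
    + apply (eq_trans (y := Cexp z * (1 * (1 - 0)))); [reflexivity|ring].
Qed.

Lemma cseries_unshift (a : nat -> C) (l : C) :
  a O = 0 -> cseries (fun n => a (S n)) l -> cseries a l.
Proof.
  intros E H. apply is_series_decr_1.
  change (cseries (fun n => a (S n)) (l - a O)%C).
  rewrite E. now replace (l - 0)%C with l by ring.
Qed.

(** Termwise integration: [|b n / (n+1)| <= |b n|] keeps the integrated series convergent on the
    whole disk, and its derived series is that of [g]. *)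
Lemma primitive_on_disk (g : C -> C) :
  analytic_on disk g -> exists l : C -> C, l 0 = 0 /\ forall z, disk z -> is_cderive l z (g z).
Proof.
  intros Hg. destruct (analytic_on_disk_power_series g Hg) as [b Hb].
  set (c := fun n => match n with O => RtoC 0 | S k => b k / RtoC (INR (S k)) end).
  assert (HI : forall n, RtoC (INR (S n)) <> 0).
  { intros n E. apply RtoC_inj in E. generalize (lt_0_INR (S n) ltac:(lia)). lra. }
  assert (Ecb : forall n, cps_derive c n = b n) by (intros n; unfold cps_derive, c; field; apply HI).
  assert (Hex : forall z, disk z -> exists l, is_power_series c z l).
  { intros z Hz. unfold disk in Hz. assert (Hz0 := Cmod_ge_0 z).
    set (rho := ((Cmod z + 1) / 2)%R).
    assert (Mr : Cmod (RtoC rho) = rho) by (rewrite Cmod_R; apply Rabs_pos_eq; unfold rho; lra).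
    assert (HR : Rbar_lt (Rabs (Cmod z)) (CV_radius (fun n => Cmod (b n)))).
    { apply Rbar_lt_le_trans with rho.
      - simpl. rewrite Rabs_pos_eq by exact Hz0. unfold rho; lra.
      - rewrite <- Mr. apply (is_power_series_CV_radius b _ (g (RtoC rho))). apply Hb. unfold disk. rewrite Mr. unfold rho; lra. }
    destruct (ex_series_le (K := C_AbsRing) (V := C_CompleteNormedModule)
      (fun n => c (S n) * z ^ S n) (fun n => Rabs (Cmod (b n) * Cmod z ^ n))) as [l Hl].
    - intros n. change (Cmod (c (S n) * z ^ S n) <= Rabs (Cmod (b n) * Cmod z ^ n))%R.
      rewrite Rabs_pos_eq by (apply Rmult_le_pos; [apply Cmod_ge_0|now apply pow_le]).
      unfold c. rewrite Cmod_mult, Cmod_div, Cmod_R, Cmod_pow by apply HI.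
      rewrite Rabs_pos_eq by apply pos_INR.
      assert (Hn : (1 <= INR (S n))%R) by (rewrite S_INR; generalize (pos_INR n); lra).
      simpl pow. rewrite <- Rmult_assoc. apply Rmult_le_compat_r; [now apply pow_le|].
      assert (Hi : (/ INR (S n) <= 1)%R) by (rewrite <- Rinv_1; apply Rinv_le_contravar; lra).
      assert (Hi0 : (0 < / INR (S n))%R) by (apply Rinv_0_lt_compat; lra).
      unfold Rdiv. generalize (Cmod_ge_0 (b n)). intros Hbn.
      rewrite Rmult_assoc. rewrite <- (Rmult_1_r (Cmod (b n))) at 2.
      apply Rmult_le_compat_l; [exact Hbn|]. nra.
    - exact (CV_disk_inside _ _ HR).
    - exists l. apply is_power_series_cseries, cseries_unshift; [unfold c; ring|]. exact Hl. }
  set (l := fun z => epsilon (inhabits (RtoC 0)) (is_power_series c z)).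
  assert (Hl : forall z, disk z -> is_power_series c z (l z)) by (intros z Hz; apply epsilon_spec, Hex, Hz).
  exists l. split.
  - rewrite (is_power_series_at_0 c (l 0)); [reflexivity|]. apply Hl, disk_0.
  - intros z Hz. destruct (is_power_series_derive l 0 1 c) with (h := z) as [v [Hv Dv]].
    + intros h Hh. replace (0 + h) with h by ring. now apply Hl.
    + exact Hz.
    + replace (0 + z) with z in Dv by ring. replace (g z) with v; [exact Dv|].
      apply (is_power_series_unique (cps_derive c) z); [exact Hv|]. apply is_power_series_cseries.
      apply (is_series_ext (fun n => b n * z ^ n)); [intros n; now rewrite Ecb|].
      apply is_power_series_cseries, Hb, Hz.
Qed.

Lemma analytic_on_of_is_cderive (A : C -> Prop) (f f' : C -> C) :
  copen A -> (forall z, A z -> is_cderive f z (f' z) /\ ccont f' z) -> analytic_on A f.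
Proof.
  intros HA H z Hz. apply (analytic_at_of_near f f').
  apply (filter_imp (F := cnear z)) with (2 := HA z Hz). exact H.
Qed.

(** [l] is the primitive of [F' / F] vanishing at 0; the product [F * Cexp (- l)] then has
    derivative 0 and is constantly 1. *)
Lemma log_on_disk (F : C -> C) : analytic_on disk F -> F 0 = 1 -> zero_free F ->
  exists l, analytic_on disk l /\ l 0 = 0 /\ forall z, disk z -> Cexp (l z) = F z.
Proof.
  intros HF F0 Hz.
  assert (Hg : analytic_on disk (fun z => C_derive F z / F z)).
  { intros z Dz. apply analytic_at_div; auto. now apply analytic_at_C_derive, HF. }
  destruct (primitive_on_disk _ Hg) as [l [l0 Hl]].
  exists l. split; [|split; [exact l0|]].
  - apply (analytic_on_of_is_cderive disk l (fun z => C_derive F z / F z)); [exact disk_open|].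
    intros z Dz. split; [now apply Hl|now apply analytic_at_ccont, Hg].
  - intros z Dz.
    assert (E : F z * Cexp (- l z) = F 0 * Cexp (- l 0)).
    { apply (cderive_zero_const (fun z => F z * Cexp (- l z)) 0 z 1).
      - intros y Hy. assert (Dy : disk y) by (unfold disk; now replace (y - 0) with y in Hy by ring).
        eapply is_cderive_eq.
        + apply is_cderive_mult; [apply analytic_at_is_cderive, HF, Dy|].
          apply (is_cderive_comp Cexp (fun z => - l z)); [apply Cexp_is_cderive|apply is_cderive_opp, Hl, Dy].
        + apply (eq_trans (y := C_derive F y * Cexp (- l y) + F y * (Cexp (- l y) * - (C_derive F y / F y)))); [reflexivity|].
          field. now apply Hz.
      - now replace (z - 0) with z by ring. }
    rewrite F0, l0 in E. replace (- (0)) with (RtoC 0) in E by ring. rewrite Cexp_0 in E.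
    replace (F z) with (F z * Cexp (- l z) * Cexp (l z)).
    + rewrite E. ring.
    + rewrite <- Cmult_assoc, Cexp_opp. ring.
Qed.

(** A natural exponent uses the plain power, even if [F] has zeros; every other exponent, negative
    integers included, comes with a zero-free base and uses the logarithm. *)
Lemma power_exists (F : C -> C) (s : R) :
  analytic_on disk F -> F 0 = 1 -> (~ is_nat s -> zero_free F) -> is_power F s (power F s).
Proof.
  intros HF F0 Hz. apply (epsilon_spec (inhabits F) (is_power F s)).
  destruct (classic (is_nat s)) as [[n En]|N].
  - exists (fun z => F z ^ n). left. exists n. split; auto.
  - destruct (log_on_disk F HF F0 (Hz N)) as [l [Hl [l0 El]]].
    exists (fun z => Cexp (RtoC s * l z)). right; right. exists l. repeat split; auto.
Qed.

(** The chosen function may come from any clause of [is_power], so all three are examined. Existence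
    comes from the integer clause, which covers bases with zeros. *)
Lemma power_1 (F : C -> C) (z : C) : disk z -> power F 1 z = F z.
Proof.
  intros Hz.
  assert (H : is_power F 1 (power F 1)).
  { apply (epsilon_spec (inhabits F) (is_power F 1)). exists F. left. exists 1%nat. split; [reflexivity|]. intros x _. simpl. ring. }
  destruct H as [[n [En H]]|[[n [En H]]|[l [_ [_ [El H]]]]]]; rewrite H by exact Hz.
  - assert (n = 1%nat) as -> by (apply INR_eq; rewrite <- En; reflexivity). simpl. ring.
  - exfalso. generalize (pos_INR n). lra.
  - rewrite Cmult_1_l. now apply El.
Qed.

Lemma power_m1 (F : C -> C) (z : C) : disk z -> power F (- (1)) z = / F z.
Proof.
  intros Hz.
  assert (H : is_power F (- (1)) (power F (- (1)))).
  { apply (epsilon_spec (inhabits F) (is_power F (- (1)))). exists (fun z => / (F z ^ 1)). right; left. exists 1%nat. split; [reflexivity|]. reflexivity. }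
  destruct H as [[n [En H]]|[[n [En H]]|[l [_ [_ [El H]]]]]]; rewrite H by exact Hz.
  - exfalso. generalize (pos_INR n). lra.
  - assert (n = 1%nat) as -> by (apply INR_eq; simpl; lra). now rewrite Cpow_1_r.
  - replace (RtoC (- (1)) * l z) with (- l z) by (rewrite RtoC_opp; ring).
    rewrite <- El by exact Hz. assert (N := Cexp_ne_0 (l z)).
    replace (Cexp (- l z)) with (Cexp (- l z) * Cexp (l z) * / Cexp (l z)) by (field; exact N).
    rewrite Cexp_opp. ring.
Qed.

Lemma is_cderive_pow_log (F : C -> C) (n : nat) (z l : C) :
  is_cderive F z l -> F z <> 0 -> is_cderive (fun x => F x ^ n) z (RtoC (INR n) * (l / F z) * F z ^ n).
Proof.
  intros HF Hz. induction n as [|n IH].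
  - eapply is_cderive_eq; [apply (is_cderive_const 1)|]. simpl. ring.
  - eapply is_cderive_eq; [apply (is_cderive_mult F (fun x => F x ^ n)); [exact HF|exact IH]|].
    apply (eq_trans (y := l * F z ^ n + F z * (RtoC (INR n) * (l / F z) * F z ^ n))); [reflexivity|].
    rewrite S_INR, RtoC_plus, Cpow_S. field. exact Hz.
Qed.

(** All three clauses obey the same logarithmic derivative rule, which makes the computation of
    [Phi] uniform in [mu] and [nu]. *)
Lemma is_power_is_cderive (F G : C -> C) (s : R) (z : C) :
  is_power F s G -> analytic_on disk F -> disk z -> F z <> 0 ->
  is_cderive G z (RtoC s * (C_derive F z / F z) * G z).
Proof.
  intros HG HF Hz Nz.
  assert (Hloc : forall H : C -> C, (forall x, disk x -> G x = H x) -> cnear z (fun x => H x = G x)).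
  { intros H E. apply (filter_imp (F := cnear z)) with (2 := disk_open z Hz). intros x Hx. symmetry. now apply E. }
  assert (DF := analytic_at_is_cderive F z (HF z Hz)).
  destruct HG as [[n [-> E]]|[[n [-> E]]|[l [Hl [_ [El E]]]]]]; (eapply is_cderive_ext_loc; [apply Hloc, E|]); rewrite E by exact Hz.
  - now apply is_cderive_pow_log.
  - assert (Nn := Cpow_nz (F z) n Nz). eapply is_cderive_eq.
    + apply (is_cderive_inv (fun x => F x ^ n)); [apply is_cderive_pow_log; [exact DF|exact Nz]|exact Nn].
    + rewrite RtoC_opp.
      apply (eq_trans (y := - (RtoC (INR n) * (C_derive F z / F z) * F z ^ n) / (F z ^ n * F z ^ n))); [reflexivity|].
      field. auto.
  - assert (Dl := analytic_at_is_cderive l z (Hl z Hz)).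
    assert (El' : C_derive F z = F z * C_derive l z).
    { rewrite <- (El z Hz). apply is_C_derive_unique. apply (is_cderive_ext_loc (fun x => Cexp (l x))).
      - apply (filter_imp (F := cnear z)) with (2 := disk_open z Hz). exact El.
      - apply (is_cderive_comp Cexp l); [apply Cexp_is_cderive|exact Dl]. }
    eapply is_cderive_eq.
    + apply (is_cderive_comp Cexp (fun x => RtoC s * l x)); [apply Cexp_is_cderive|].
      apply is_cderive_scal, Dl.
    + cbv beta.
      rewrite El'. field. exact Nz.
Qed.

(** * Removable singularities and the quotients by [z^p] *)

Lemma extend_eq (G H : C -> C) (z : C) :
  cnear z (fun x => x <> z -> G x = H x) -> ccont H z -> extend G z = H z.
Proof.
  intros E Hc. apply is_C_lim_unique. intros P HP. apply locally_C in HP.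
  assert (Hn := filter_and _ _ E (Hc P HP)). 
  apply locally_C. apply (filter_imp (F := cnear z)) with (2 := Hn).
  intros x [A B] Nx. rewrite A by exact Nx. exact B.
Qed.

(** Each passage to the slope at 0 takes out one factor [z] and shifts the coefficients, so after
    [p] steps the constant term is [a p]. *)
Lemma divide_pow (p : nat) : forall (a : nat -> C) (g : C -> C),
  analytic_on disk g -> (forall z, disk z -> is_power_series a z (g z)) -> (forall k, (k < p)%nat -> a k = 0) ->
  exists F, analytic_on disk F /\ F 0 = a p /\ forall z, disk z -> g z = z ^ p * F z.
Proof.
  induction p as [|p IH]; intros a g Hg Ha H0.
  - exists g. split; [exact Hg|split].
    + apply is_power_series_at_0, Ha, disk_0.
    + intros z _. simpl. ring.
  - destruct (IH (fun n => a (S n)) (slope g 0)) as [F [HF [F0 E]]].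
    + intros z Hz. apply analytic_at_slope; apply Hg; [apply disk_0|exact Hz].
    + intros z Hz. replace z with (0 + z) at 2 by ring.
      apply (slope_power_series g 0 1 a Rlt_0_1); [|exact Hz].
      intros h Hh. replace (0 + h) with h by ring. now apply Ha.
    + intros k Hk. apply H0. lia.
    + exists F. split; [exact HF|split; [exact F0|]].
      intros z Hz. assert (E0 : g 0 = 0).
      { transitivity (a O); [apply is_power_series_at_0, Ha, disk_0|apply H0; lia]. }
      replace (g z) with (g z - g 0) by (rewrite E0; ring).
      rewrite slope_spec, E by exact Hz. rewrite Cpow_S. ring.
Qed.

Lemma quot_pow_spec (p : nat) (g : C -> C) : class_A p g ->
  analytic_on disk (quot_pow p g) /\ quot_pow p g 0 = 1 /\
  forall z, disk z -> g z = z ^ p * quot_pow p g z.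
Proof.
  intros [Hg [a [H0 [Hp Ha]]]].
  destruct (divide_pow p a g Hg Ha H0) as [F [HF [F0 E]]].
  assert (EQ : forall z, disk z -> quot_pow p g z = F z).
  { intros z Hz. apply extend_eq; [|now apply analytic_at_ccont, HF].
    assert (Hn : cnear z (fun x => x <> z -> x <> RtoC 0)).
    { destruct (Ceq_dec z 0) as [->|Nz]; [apply filter_forall; auto|].
      generalize (ccont_ne (fun x => x) z 0 (ccont_id z) Nz). apply filter_imp. auto. }
    generalize (filter_and _ _ Hn (disk_open z Hz)). apply filter_imp. intros x [Nx Dx] Nxz.
    specialize (Nx Nxz). rewrite E by exact Dx. 
    apply (eq_trans (y := (x : C) ^ p * F x / (x : C) ^ p)); [reflexivity|].
    field. now apply Cpow_nz. }
  split; [|split].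
  - intros z Hz. apply (analytic_at_ext_loc F); [|now apply HF].
    apply (filter_imp (F := cnear z)) with (2 := disk_open z Hz). intros x Hx. symmetry. now apply EQ.
  - rewrite EQ by apply disk_0. now rewrite F0.
  - intros z Hz. rewrite EQ by exact Hz. now apply E.
Qed.

(** The identity theorem by minimality. The points near which [F] vanishes identically form a
    relatively closed set, by the local alternative. One of least modulus could be moved inward
    along its radius unless it is 0, where [F] does not vanish. *)
Lemma zeros_isolated_on_disk (F : C -> C) (z : C) :
  analytic_on disk F -> F 0 <> 0 -> disk z -> cnear z (fun x => x <> z -> F x <> 0).
Proof.
  intros HF H0 Hz.
  destruct (analytic_at_isolated_zero F z (HF z Hz)) as [H|H]; [exfalso|exact H].
  destruct (compact_min (fun x => (Cmod x <= Cmod z)%R /\ cnear x (fun y => F y = 0)) Cmod (Cmod z)) as [x [[Hx Nx] Hmin]].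
  - exists z. split; [lra|exact H].
  - now intros x [Hx _].
  - intros x Hcl. assert (Hle : (Cmod x <= Cmod z)%R).
    { apply (closed_ball_closed (Cmod z) x). intros e He. destruct (Hcl e He) as [y [[Hy _] Dy]]. now exists y. }
    split; [exact Hle|].
    destruct (analytic_at_isolated_zero F x (HF x (disk_le x z Hle Hz))) as [Hn|Hn]; [exact Hn|].
    destruct (proj1 (cnear_ex _ _) Hn) as [d [Hd Hn']]. destruct (Hcl d Hd) as [y [[_ Ny] Dy]].
    destruct (Ceq_dec y x) as [<-|Nyx]; [exact Ny|]. exfalso.
    apply (Hn' y Dy Nyx). apply (locally_singleton (T := Cuni) y _ Ny).
  - intros x _ e He. apply cnear_ex. exists e. split; [exact He|]. intros y Hy _.
    eapply Rle_lt_trans; [apply Cmod_sub_le|exact Hy].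
  - destruct (Ceq_dec x 0) as [->|N].
    + apply H0. apply (locally_singleton (T := Cuni) _ _ Nx).
    + assert (Hp := proj1 (Cmod_gt_0 _) N).
      destruct (proj1 (cnear_ex _ _) (locally_locally (T := Cuni) x _ Nx)) as [d [Hd Hd']].
      set (s := Rmin (1 / 2) (d / (2 * Cmod x))).
      assert (Hs : (0 < s)%R) by (apply Rmin_pos; [lra|apply Rdiv_lt_0_compat; lra]).
      assert (Hs1 : (s <= 1 / 2)%R) by apply Rmin_l.
      assert (Hs2 : (s * Cmod x < d)%R).
      { apply Rle_lt_trans with (d / (2 * Cmod x) * Cmod x)%R.
        - apply Rmult_le_compat_r; [lra|apply Rmin_r].
        - replace (d / (2 * Cmod x) * Cmod x)%R with (d / 2)%R by (field; lra). lra. }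
      assert (My : Cmod (RtoC (1 - s) * x) = ((1 - s) * Cmod x)%R) by (rewrite Cmod_mult, Cmod_R, Rabs_pos_eq; lra).
      assert (Hm : (Cmod x <= Cmod (RtoC (1 - s) * x))%R).
      { apply Hmin. split; [rewrite My; nra|]. apply Hd'.
        replace (RtoC (1 - s) * x - x) with (- (RtoC s * x)) by (rewrite RtoC_minus; ring).
        rewrite Cmod_opp, Cmod_mult, Cmod_R, Rabs_pos_eq by lra. exact Hs2. }
      rewrite My in Hm. nra.
Qed.

(** In the recurrence for [z^p F] the terms with [p] cancel and [z^p] divides out. At [z = 0], where
    this division is impossible, both sides vanish because the two quotients equal 1. *)
Lemma quot_pow_recurrence (p : nat) (D : C -> Prop) (L : C -> (C -> C) -> (C -> C)) (alpha : C -> C)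
  (b : C) (f : C -> C) (z : C) :
  operator_family p D L alpha -> D b -> D (b + 1) -> class_A p f -> disk z ->
  z * C_derive (quot_pow p (L b f)) z =
    alpha b * (quot_pow p (L (b + 1) f) z - quot_pow p (L b f) z).
Proof.
  intros [HL Hrec] Hb Hb1 Hf Hz.
  destruct (quot_pow_spec p (L b f) (proj1 (HL b Hb) f Hf)) as [HF [F0 E]].
  destruct (quot_pow_spec p (L (b + 1) f) (proj1 (HL (b + 1) Hb1) f Hf)) as [_ [F1 E1]].
  destruct (Ceq_dec z 0) as [->|Nz]; [rewrite F0, F1; ring|].
  set (F := quot_pow p (L b f)) in *.
  assert (Nzp := Cpow_nz z p Nz).
  assert (H := Hrec b Hb Hb1 f Hf z Hz).
  assert (HD : C_derive (L b f) z = RtoC (INR p) * (1 / z) * z ^ p * F z + z ^ p * C_derive F z).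
  { apply is_C_derive_unique. apply (is_cderive_ext_loc (fun x => x ^ p * F x)).
    - apply (filter_imp (F := cnear z)) with (2 := disk_open z Hz). intros x Hx. symmetry. now apply E.
    - apply (is_cderive_mult (fun x => x ^ p) F); [|now apply analytic_at_is_cderive, HF].
      apply (is_cderive_pow_log (fun x => x)); [apply is_cderive_id|exact Nz]. }
  rewrite HD, (E z Hz), (E1 z Hz) in H.
  assert (H2 : z ^ p * (z * C_derive F z - alpha b * (quot_pow p (L (b + 1) f) z - F z)) = 0).
  { transitivity (z * (RtoC (INR p) * (1 / z) * z ^ p * F z + z ^ p * C_derive F z) -
      (alpha b * (z ^ p * quot_pow p (L (b + 1) f) z) - (alpha b - RtoC (INR p)) * (z ^ p * F z))).
    - field. exact Nz.
    - rewrite H. ring. }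
  apply Ceq_minus. set (X := z * C_derive F z - _) in *.
  replace X with (/ z ^ p * (z ^ p * X)) by (field; exact Nzp). rewrite H2. ring.
Qed.

Theorem corollary3p1 (p : nat) (hp : (1 <= p)%nat)
  (D : C -> Prop) (L : C -> (C -> C) -> (C -> C)) (alpha : C -> C)
  (hL : operator_family p D L alpha)
  (a : C) (ha : D a) (ha1 : D (a + 1)%C) (ha2 : D (a + 1 + 1)%C)
  (mu nu : R) (hmunu : ~ (mu = 0%R /\ nu = 0%R))
  (f : C -> C) (hf : class_A p f)
  (hzmu : ~ is_nat mu -> zero_free (quot_pow p (L (a + 1)%C f)))
  (hznu : ~ is_nat (- nu) -> zero_free (quot_pow p (L a f)))
  (psi1 psi2 : C -> C)
  (hpsi1 : convex_univalent psi1) (hpsi1_0 : psi1 (RtoC 0) = RtoC 1)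
  (hpsi2 : convex_univalent psi2) (hpsi2_0 : psi2 (RtoC 0) = RtoC 1)
  (halpha : alpha (a + 1)%C <> RtoC 0)
  (hre : (0 <= Re (alpha (a + 1)%C * RtoC mu - alpha a * RtoC nu)%C)%R) :
  let Om : C -> C := Omega p L mu nu a f in
  let Phi : C -> C := extend (fun z =>
    (Om z * (RtoC mu * Omega p L 1 1 (a + 1)%C f z
             - alpha a * RtoC nu / alpha (a + 1) * Omega p L 1 1 a f z))%C) in
  let chi : (C -> C) -> C -> C := fun psi z =>
    (1 / alpha (a + 1) *
       ((alpha (a + 1) * RtoC mu - alpha a * RtoC nu) * psi z
        + z * C_derive psi z))%C in
  (exists z, disk z /\ Om z <> RtoC 0) ->
  class_H11 Om ->
  class_Q Om ->
  univalent Phi ->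
  subordinate (chi psi1) Phi ->
  subordinate Phi (chi psi2) ->
  subordinate psi1 Om /\ subordinate Om psi2.
Proof.
  intros Om Phi chi _ [HOm [c [Hc0 Hc]]] HQ [_ HPhi] [w1 [_ [Hw1 E1]]] [w2 [_ [Hw2 E2]]].
  set (gam := alpha (a + 1) * RtoC mu - alpha a * RtoC nu) in *.
  assert (HA := fun b Hb => proj1 (proj1 hL b Hb) f hf).
  destruct (quot_pow_spec p _ (HA a ha)) as [HF0 [F00 _]].
  destruct (quot_pow_spec p _ (HA (a + 1) ha1)) as [HF1 [F10 _]].
  assert (R0 := fun z => quot_pow_recurrence p D L alpha a f z hL ha ha1 hf).
  assert (R1 := fun z => quot_pow_recurrence p D L alpha (a + 1) f z hL ha1 ha2 hf).
  assert (P1 := power_exists _ mu HF1 F10 hzmu).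
  assert (P0 := power_exists _ (- nu) HF0 F00 hznu).
  (* The formula is computed where both quotients are nonzero. Their zeros are isolated, since both
     equal 1 at the origin, and the right side is continuous, [Om] being analytic; so [extend]
     returns it at every point. *)
  assert (EPhi : forall z, disk z -> Phi z = / alpha (a + 1) * (gam * Om z + zder Om z)).
  { intros z Hz. apply (extend_eq _ (fun z => / alpha (a + 1) * (gam * Om z + zder Om z))).
    - assert (N1 : RtoC 1 <> 0) by (intro E; apply RtoC_inj in E; lra).
      assert (Z0 := zeros_isolated_on_disk _ z HF0 ltac:(now rewrite F00) Hz).
      assert (Z1 := zeros_isolated_on_disk _ z HF1 ltac:(now rewrite F10) Hz).
      generalize (filter_and _ _ (disk_open z Hz) (filter_and _ _ Z0 Z1)). apply filter_imp.
      intros x [Dx [N0x N1x]] Nx. specialize (N0x Nx). specialize (N1x Nx).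
      assert (DOm := is_cderive_mult _ _ x _ _ (is_power_is_cderive _ _ _ x P1 HF1 Dx N1x) (is_power_is_cderive _ _ _ x P0 HF0 Dx N0x)).
      apply is_C_derive_unique in DOm. match type of DOm with _ = ?r => change (C_derive Om x = r) in DOm end.
      unfold zder. rewrite DOm. unfold Omega. rewrite !power_1, !power_m1 by exact Dx.
      assert (R0x := R0 x Dx). assert (R1x := R1 x Dx).
      unfold Om, Omega. 
      set (F0 := quot_pow p (L a f)) in *. set (F1 := quot_pow p (L (a + 1) f)) in *.
      set (F2 := quot_pow p (L (a + 1 + 1) f)) in *.
      set (G1 := power F1 mu x) in *. set (G0 := power F0 (- nu) x) in *.
      rewrite RtoC_opp.
      (* By the recurrences [x Om' / Om] is [alpha (a + 1) mu (F2 / F1 - 1) - alpha a nu (F1 / F0 -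
         1)]. Adding [gam] cancels the constants and leaves [alpha (a + 1)] times the bracket in
         [Phi]. *)
      replace (x * (RtoC mu * (C_derive F1 x / F1 x) * G1 * G0 + G1 * (- RtoC nu * (C_derive F0 x / F0 x) * G0)))
        with (G1 * G0 * (RtoC mu * (x * C_derive F1 x) / F1 x - RtoC nu * (x * C_derive F0 x) / F0 x)) by (field; auto).
      rewrite R0x, R1x. unfold gam. field. auto.
    - apply ccont_mult; [apply ccont_const|]. apply ccont_plus.
      + apply ccont_mult; [apply ccont_const|]. now apply analytic_at_ccont, HOm.
      + apply ccont_mult; [apply ccont_id|]. now apply analytic_at_ccont, analytic_at_C_derive, HOm. }
  assert (Om0 : Om 0 = 1) by (rewrite <- Hc0; apply is_power_series_at_0, Hc, disk_0).
  assert (Hchi : forall psi z, chi psi z = / alpha (a + 1) * (gam * psi z + zder psi z)).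
  { intros psi z. unfold chi, zder. field. exact halpha. }
  (* Both subordinations carry the common factor [/ alpha (a + 1)]; cancelling it leaves equations
     between values of [gam psi + zder psi] and [gam Om + zder Om]. *)
  assert (Hcan : forall u v, / alpha (a + 1) * u = / alpha (a + 1) * v -> u = v).
  { intros u v E. replace u with (alpha (a + 1) * (/ alpha (a + 1) * u)) by (field; exact halpha).
    rewrite E. field. exact halpha. }
  split.
  - apply (convex_superordination psi1 Om w1 gam); auto.
    + now rewrite Om0, hpsi1_0.
    + intros x y Hx Hy E. apply HPhi; auto. now rewrite !EPhi, E.
    + intros z Hz. apply Hcan. rewrite <- (Hchi psi1), <- (EPhi (w1 z)) by (apply (disk_le _ z); auto). now apply E1.
  - apply (convex_subordination psi2 Om w2 gam); auto.
    + now rewrite Om0, hpsi2_0.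
    + intros z Hz. apply Hcan. rewrite <- (Hchi psi2), <- (EPhi z) by exact Hz. now apply E2.
Qed.
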